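(* Let $\kappa\ge0$ and $D>0$ satisfy $$e^{D^2\kappa/2}+\sqrt{\big(3\kappa D^2/2+e^{D^2\kappa/2}-1\big)\big(2+e^{D^2\kappa/2}\big)}<2.$$ Then there is a constant $\lambda=\lambda(\kappa,D)>0$, depending only on $\kappa$ and $D$, such that every irreducible reversible finite Markov chain $(\mathcal X,Q,\pi)$ with $\mathrm{Ric}(\mathcal X,Q,\pi)\ge-\kappa$ (entropic Ricci curvature bounded below by $-\kappa$) and such that the diameter of $(\mathcal X,d_{\mathcal W})$ is bounded by $D$ satisfies the Poincar\'e inequality $\mathrm{PI}(\lambda)$. In particular, there is a universal constant $c>0$ such that whenever $\mathrm{Ric}(\mathcal X,Q,\pi)\ge0$ and the diameter of $(\mathcal X,d_{\mathcal W})$ is bounded by $D$, then $\mathrm{PI}(cD^{-2})$ holds.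
   Context: Setting. $\mathcal X$ is a finite set and $Q:\mathcal X\times\mathcal X\to[0,\infty)$ is a collection of transition rates with $Q(x,x)=0$, irreducible: any $x,y$ are joined by a sequence $x=x_1,\dots,x_n=y$ with $Q(x_i,x_{i+1})>0$. $\pi$ is the unique (strictly positive) stationary probability measure of the associated continuous time Markov chain, assumed reversible: $Q(x,y)\pi(x)=Q(y,x)\pi(y)$ for all $x,y$. Transport distance. $\mathcal P(\mathcal X)=\{\rho:\mathcal X\to[0,\infty): \sum_x\rho(x)\pi(x)=1\}$ is the set of probability densities. Let $\theta(s,t)=\int_0^1 s^{1-p}t^p\,dp$ (logarithmic mean) and $\hat\rho(x,y)=\theta(\rho(x),\rho(y))$. For $\rho_0,\rho_1\in\mathcal P(\mathcal X)$, $$\mathcal W(\rho_0,\rho_1)^2=\inf\Big\{\tfrac12\int_0^1\sum_{x,y}(\psi_t(x)-\psi_t(y))^2\hat\rho_t(x,y)Q(x,y)\pi(x)\,dt\Big\},$$ the infimum being over absolutely continuous curves $\rho:[0,1]\to\mathcal P(\mathcal X)$ with endpoints $\rho_0,\rho_1$ and measurable $\psi:[0,1]\to\mathbb R^{\mathcal X}$ such that for a.e. $t$ and all $x$: $\frac{d}{dt}\rho_t(x)+\sum_y(\psi_t(y)-\psi_t(x))\hat\rho_t(x,y)Q(x,y)=0$. $\mathcal W$ is a metric on $\mathcal P(\mathcal X)$. On $\mathcal X$ one sets $d_{\mathcal W}(x,y)=\mathcal W(\delta_x,\delta_y)$, where $\delta_x$ is identified with the density $\mathbf 1_{\{x\}}/\pi(x)$.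 Curvature. Let $\mathcal H(\rho)=\sum_x\pi(x)\rho(x)\log\rho(x)$ (with $0\log0=0$). A constant speed geodesic is a curve $(\rho_t)_{t\in[0,1]}$ with $\mathcal W(\rho_s,\rho_t)=|s-t|\mathcal W(\rho_0,\rho_1)$. For $k\in\mathbb R$, $\mathrm{Ric}(\mathcal X,Q,\pi)\ge k$ means that for every constant speed geodesic $(\rho_t)$ in $(\mathcal P(\mathcal X),\mathcal W)$ and $t\in[0,1]$: $\mathcal H(\rho_t)\le(1-t)\mathcal H(\rho_0)+t\mathcal H(\rho_1)-\frac k2t(1-t)\mathcal W(\rho_0,\rho_1)^2$. $\mathrm{PI}(\lambda)$ means: $\mathrm{Var}_\pi(\psi)\le\frac1\lambda\mathcal E(\psi,\psi)$ for all $\psi\in\mathbb R^{\mathcal X}$, where $\mathrm{Var}_\pi(\psi)=\pi[\psi^2]-\pi[\psi]^2$, $\pi[f]=\sum_xf(x)\pi(x)$ and $\mathcal E(\psi,\psi)=\frac12\sum_{x,y}(\psi(y)-\psi(x))^2Q(x,y)\pi(x)$. ''Universal'' means independent of $\mathcal X,Q,\pi,D$. *)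

(* Defs.v *)
From HB Require Import structures.
From mathcomp Require Import all_boot all_order all_algebra.
From mathcomp Require Import all_classical all_reals all_analysis.

Set Implicit Arguments.
Unset Strict Implicit.
Unset Printing Implicit Defensive.

Import Order.TTheory GRing.Theory Num.Theory.
Import numFieldNormedType.Exports.

Local Open Scope classical_set_scope.
Local Open Scope ring_scope.

Record reversible_chain (R : realType) (X : finType)
    (Q : X -> X -> R) (pi : X -> R) : Prop := ReversibleChain {
  rates_ge0 : forall x y, 0 <= Q x y;
  rates_diag : forall x, Q x x = 0;
  irreducible : forall x y, connect [rel u v | 0 < Q u v] x y;
  pi_gt0 : forall x, 0 < pi x;
  pi_sum1 : \sum_x pi x = 1;
  pi_stationary : forall y, \sum_x pi x * Q x y = pi y * \sum_x Q y x;
  detailed_balance : forall x y, Q x y * pi x = Q y x * pi y }.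

Definition density (R : realType) (X : finType) (pi : X -> R) : set (X -> R) :=
  [set rho | (forall x, 0 <= rho x) /\ \sum_x rho x * pi x = 1].

(* [0 `^ p = 0] for [p != 0], so that [log_mean 0 t = log_mean s 0 = 0]. *)
Definition log_mean (R : realType) (s t : R) : R :=
  \int[@lebesgue_measure R]_(p in `[0, 1]) (s `^ (1 - p) * t `^ p).

Definition rho_hat (R : realType) (X : finType) (rho : X -> R) (x y : X) : R :=
  log_mean (rho x) (rho y).

Definition absolutely_continuous (R : realType) (f : R -> R) (u v : R) : Prop :=
  forall e : R, 0 < e -> exists2 d : R, 0 < d &
    forall (n : nat) (a b : 'I_n -> R),
      (forall i, u <= a i /\ a i <= b i /\ b i <= v) ->
      trivIset setT (fun i => [set` `]a i, b i[]) ->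
      \sum_i (b i - a i) < d ->
      \sum_i `|f (b i) - f (a i)| < e.

(* Curves are total functions of [t : R]; only their values on [`[0, 1]] are
   constrained. At the two endpoints, a null set, the two-sided derivative
   depends on values outside [`[0, 1]]. *)
Record transport_plan (R : realType) (X : finType)
    (Q : X -> X -> R) (pi : X -> R) (rho0 rho1 : X -> R)
    (rho psi : R -> X -> R) : Prop := TransportPlan {
  plan_density : forall t : R, t \in `[0, 1] -> density pi (rho t);
  plan_source : rho 0 = rho0;
  plan_target : rho 1 = rho1;
  plan_ac : forall x, absolutely_continuous (fun t => rho t x) 0 1;
  plan_measurable : forall x, measurable_fun `[0 : R, 1 : R] (fun t : R => psi t x);
  plan_continuity_equation :
    {ae @lebesgue_measure R, forall t : R, t \in `[0, 1] -> forall x,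
       derivable (fun s : R => rho s x) t 1 /\
       derive1 (fun s : R => rho s x) t +
         \sum_y (psi t y - psi t x) * rho_hat (rho t) x y * Q x y = 0} }.

Definition action (R : realType) (X : finType) (Q : X -> X -> R) (pi : X -> R)
    (rho psi : R -> X -> R) : \bar R :=
  ((2^-1)%:E * \int[@lebesgue_measure R]_(t in `[0%R, 1%R])
     (\sum_x \sum_y (psi t x - psi t y) ^+ 2 * rho_hat (rho t) x y
        * Q x y * pi x)%:E)%E.

(* Extended-real valued, so that no convention is needed when the infimum is
   over the empty set. *)
Definition W (R : realType) (X : finType) (Q : X -> X -> R) (pi : X -> R)
    (rho0 rho1 : X -> R) : \bar R :=
  sqrte (ereal_inf [set a : \bar R | exists rho psi : R -> X -> R,
    transport_plan Q pi rho0 rho1 rho psi /\ a = action Q pi rho psi]).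

Definition dirac_density (R : realType) (X : finType) (pi : X -> R) (x : X) :
    X -> R :=
  fun y => if y == x then (pi x)^-1 else 0.

Definition dW (R : realType) (X : finType) (Q : X -> X -> R) (pi : X -> R)
    (x y : X) : \bar R :=
  W Q pi (dirac_density pi x) (dirac_density pi y).

Definition diamW (R : realType) (X : finType) (Q : X -> X -> R) (pi : X -> R) :
    \bar R :=
  ereal_sup [set d : \bar R | exists x y : X, d = dW Q pi x y].

(* The library sets [ln 0 = 0], consistently with [0 log 0 = 0]. *)
Definition entropy (R : realType) (X : finType) (pi rho : X -> R) : R :=
  \sum_x pi x * rho x * ln (rho x).

Definition constant_speed_geodesic (R : realType) (X : finType)
    (Q : X -> X -> R) (pi : X -> R) (rho : R -> X -> R) : Prop :=
  (forall t : R, t \in `[0, 1] -> density pi (rho t)) /\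
  (forall s t : R, s \in `[0, 1] -> t \in `[0, 1] ->
     W Q pi (rho s) (rho t) = (`|s - t|%:E * W Q pi (rho 0%R) (rho 1%R))%E).

Definition Ric_ge (R : realType) (X : finType)
    (Q : X -> X -> R) (pi : X -> R) (k : R) : Prop :=
  forall rho : R -> X -> R, constant_speed_geodesic Q pi rho ->
  forall t : R, t \in `[0, 1] ->
    ((entropy pi (rho t))%:E <=
       ((1 - t) * entropy pi (rho 0) + t * entropy pi (rho 1))%:E
       - (k / 2 * t * (1 - t))%:E * W Q pi (rho 0%R) (rho 1%R) ^+ 2)%E.

Definition mean (R : realType) (X : finType) (pi f : X -> R) : R :=
  \sum_x f x * pi x.

Definition variance (R : realType) (X : finType) (pi psi : X -> R) : R :=
  mean pi (fun x => psi x ^+ 2) - mean pi psi ^+ 2.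

Definition dirichlet (R : realType) (X : finType)
    (Q : X -> X -> R) (pi psi : X -> R) : R :=
  2^-1 * \sum_x \sum_y (psi y - psi x) ^+ 2 * Q x y * pi x.

Definition PI (R : realType) (X : finType)
    (Q : X -> X -> R) (pi : X -> R) (lambda : R) : Prop :=
  forall psi : X -> R, variance pi psi <= lambda^-1 * dirichlet Q pi psi.

(* Main.v *)
(** Geodesics from [rho] to the uniform density [1] exist, as limits of nearly
    optimal curves, and [1] lies within [D] of every density, because [W^2] is
    jointly convex and densities are mixtures of Dirac masses.  The curvature
    bound along such a geodesic yields, for positive [rho], an HWI inequality
    [H(rho) <= 2 D sqrt (2 I(rho)) + kappa D^2 / 2], where
    [I(rho) = 1/2 sum (ln rho(x) - ln rho(y))^2 rho_hat(x,y) Q(x,y) pi(x)],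
    and the hypothesis forces [kappa D^2 / 2 <= 1/12].

    Let [0 <= h <= 1] with [pi(h > 0) <= 1/2] and [pi(h = 1) >= 49/50 pi(h > 0)].
    The density proportional to [M^h], [M = 8 / pi(h = 1)], has entropy at least
    [1/12 + c ln M], so the HWI inequality bounds [pi(h = 1)] by a multiple of
    [D^2 E(h)].  Applied to the slices of [g >= 0] between consecutive levels
    [s_k] of a geometric sequence, this gives an alternative: either the mass of
    [g >= s_k] decreases by a factor 49/50 at the next level, or it is controlled
    by the energy of the slice.  Summing over [k] bounds [pi(g^2)] by a multiple
    of [D^2 E(g)]; the positive and negative parts of [psi - median] conclude. *)

(* Geodesics arise here only as limits of curves and carry no velocity field, so the entropy is
   never differentiated along them. The convexity inequality is used at a single small time: the
   tangent inequality for [t ln t] replaces the entropy by the linear functional with weight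
   [ln rho], whose growth along any cheap plan is bounded through the continuity equation. Two
   obstacles shape the transport part. Densities may vanish, which is cured by mixing with the
   uniform density. A convex combination of plans has a flux that is not a gradient, so it is
   projected onto gradients by solving a Poisson equation explicitly, which keeps the potential
   measurable in time. The test density [M^h] suits the HWI inequality because its logarithm varies
   as [ln M] times [h]: its information is at most [M (ln M)^2 E(h)], while its entropy beyond 1/12
   is at least [c ln M]. Hence [ln M] cancels, and [M] of order [1 / pi(h = 1)] leaves a bound
   linear in that mass, without logarithmic loss. *)
Require Import Defs.
From HB Require Import structures.
From mathcomp Require Import all_boot all_order all_algebra.
From mathcomp Require Import all_classical all_reals all_analysis.
From mathcomp Require Import measurable_realfun ring lra.

Set Implicit Arguments.
Unset Strict Implicit.
Unset Printing Implicit Defensive.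

Import Order.TTheory GRing.Theory Num.Theory.
Import numFieldNormedType.Exports.

Local Open Scope classical_set_scope.
Local Open Scope ring_scope.

(** * Absolutely continuous functions *)

(** The step is applied at the supremum of the points where [P] holds: a point [u] just to its left
    carries [P] to the supremum and beyond it. This plays the part of a compactness argument in
    which the covering intervals may be of different kinds. *)
Lemma real_induction (R : realType) (a b : R) (P : R -> Prop) :
  a <= b -> P a ->
  (forall t, a <= t <= b -> exists2 d, 0 < d &
     forall u v, a <= u <= b -> a <= v <= b ->
       t - d < u <= t -> t <= v < t + d -> P u -> P v) ->
  P b.
Proof.
move=> ab Pa H.
pose S := [set t : R | a <= t <= b /\ P t].
have Sa : S a by split=> //; rewrite lexx.
have supS : has_sup S.
  by split; [exists a | exists b => t [/andP[]]].
set c := sup S.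
have ac : a <= c by apply: ub_le_sup => //; exact: supS.2.
have cb : c <= b by apply: ge_sup => [|t [/andP[]]//]; exact: supS.1.
have [|d d0 Hd] := H c; first by rewrite ac cb.
have [u [/andP[au ub] Pu] ucd] := sup_adherent d0 supS.
have uc : u <= c by apply: ub_le_sup => //; [exact: supS.2 | split=> //; rewrite au].
have key v : a <= v <= b -> c <= v < c + d -> P v.
  by move=> av cv; apply: (Hd u v) => //; rewrite ?au ?ub ?ucd.
have [cltb|] := ltP c b; last first.
  by move=> bc; apply: key; [rewrite ab lexx | rewrite cb (le_lt_trans bc)// ltrDl].
pose v := Num.min b (c + d / 2).
have vb : v <= b by rewrite /v ge_min lexx.
have cv : c < v by rewrite /v lt_min cltb /=; lra.
have vd : v < c + d by rewrite /v gt_min; apply/orP; right; lra.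
have av : a <= v <= b by rewrite vb andbT; lra.
have : S v by split=> //; apply: key => //; rewrite vd andbT ltW.
by move/(ub_le_sup supS.2); rewrite leNgt cv.
Qed.

Lemma derivable_approx (R : realType) (f : R -> R) (t : R) :
  derivable f t 1 -> forall e, 0 < e -> exists2 d, 0 < d &
  forall v, `|v - t| < d -> `|f v - f t - derive1 f t * (v - t)| <= e * `|v - t|.
Proof.
move=> df e e0.
have : h^-1 *: (f (h + t) - f t) @[h --> 0^'] --> derive1 f t.
  rewrite derive1E; have := df; rewrite /derivable /derive.
  rewrite (_ : (fun h : R => h^-1 *: (f (h *: 1 + t) - f t)) =
     (fun h : R => h^-1 *: (f (h + t) - f t))) //.
  by apply/funext => h; rewrite /GRing.scale /= mulr1.
move=> /cvgrPdist_le/(_ e e0) [d /= d0 Hd]; exists d => // v vd.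
have [->|vt] := eqVneq v t; first by rewrite !subrr mulr0 subrr normr0 mulr0.
have vt0 : v - t != 0 by rewrite subr_eq0.
have := Hd (v - t); rewrite /= sub0r normrN => /(_ vd vt0).
rewrite subrK /GRing.scale /= => h.
rewrite (_ : f v - f t - _ = - (derive1 f t - (v - t)^-1 * (f v - f t)) * (v - t)).
  by rewrite normrM normrN ler_pM2r ?normr_gt0.
by field.
Qed.

(** A straddle lemma: because [u <= t <= v], the linearisation errors at the two ends add up to a
    multiple of [v - u], so that such increments can be chained over adjacent intervals. *)
Lemma derivable_increment_le (R : realType) (f G : R -> R) (t e : R) :
  derivable f t 1 -> derivable G t 1 -> derive1 f t <= derive1 G t -> 0 < e ->
  exists2 d, 0 < d & forall u v, t - d < u <= t -> t <= v < t + d ->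
    f v - f u <= G v - G u + e * (v - u).
Proof.
move=> df dG dfG e0; have e20 : 0 < e / 2 by lra.
have [d1 d10 H1] := derivable_approx df e20.
have [d2 d20 H2] := derivable_approx dG e20.
exists (Num.min d1 d2); first by rewrite lt_min d10.
have [D1 D2] : Num.min d1 d2 <= d1 /\ Num.min d1 d2 <= d2.
  by rewrite !ge_min !lexx orbT.
move=> u v /andP[ut1 ut2] /andP[vt1 vt2].
have vt : `|v - t| = v - t by rewrite ger0_norm ?subr_ge0.
have ut : `|u - t| = t - u by rewrite distrC ger0_norm ?subr_ge0.
have v1 : v - t < d1 by lra.
have v2 : v - t < d2 by lra.
have u1 : t - u < d1 by lra.
have u2 : t - u < d2 by lra.
have := H1 v; rewrite vt ler_norml => /(_ v1)/andP[_ h1].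
have := H1 u; rewrite ut ler_norml => /(_ u1)/andP[h2 _].
have := H2 v; rewrite vt ler_norml => /(_ v2)/andP[h3 _].
have := H2 u; rewrite ut ler_norml => /(_ u2)/andP[_ h4].
have : 0 <= (derive1 G t - derive1 f t) * (v - u) by rewrite mulr_ge0 ?subr_ge0 // (le_trans ut2).
move: h1 h2 h3 h4; clear; lra.
Qed.

(** Outer regularity of the exceptional null set. The points [a] and [b] are added to it because
    derivatives will be controlled only inside the open interval. *)
Lemma ae_open_cover (R : realType) (P : R -> Prop) (a b d : R) : 0 < d ->
  {ae @lebesgue_measure R, forall t, P t} ->
  exists U : set R, [/\ open U, U a, U b, (lebesgue_measure U < d%:E)%E &
    forall t, ~ P t -> U t].
Proof.
move=> d0 [N [mN N0 sub]].
pose N1 : set (measurableTypeR R) := N `|` ([set a] `|` [set b]).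
have mN1 : measurable N1 by apply: measurableU => //; apply: measurableU.
have N10 : lebesgue_measure N1 = 0%E.
  apply: null_set_setU => //; first by apply: measurableU.
  by apply: null_set_setU => //; exact: lebesgue_measure_set1.
have [] := @lebesgue_regularity_outer R N1 d mN1 _ d0; first by rewrite [X in (X < _)%E]N10.
move=> U [oU N1U UN1].
have mU : measurable (U : set (measurableTypeR R)) by exact: open_measurable.
exists U; split=> //.
- by apply: N1U; right; left.
- by apply: N1U; right; right.
- rewrite (_ : lebesgue_measure U = lebesgue_measure (U `\` N1))//.
  have -> := @measureDI _ (measurableTypeR R) R lebesgue_measure U N1 mU mN1.
  rewrite [X in (_ + X)%E](_ : _ = 0%E) ?adde0//.
  by apply: (@subset_measure0 _ (measurableTypeR R) R _ _ N1) => //; exact: measurableI.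
- by move=> t Pt; apply: N1U; left; exact: sub.
Qed.

Lemma lebesgue_measure_extend (R : realType) (U : set R) (a u v : R) :
  open U -> a <= u -> u <= v -> (forall x, u < x < v -> U x) ->
  ((v - u)%:E + lebesgue_measure (U `&` `]a, u[) <= lebesgue_measure (U `&` `]a, v[))%E.
Proof.
move=> oU au uv uvU.
have mU : measurable (U : set (measurableTypeR R)) by exact: open_measurable.
rewrite (_ : (v - u)%:E = lebesgue_measure (`]u, v[%classic : set R)); last first.
  rewrite lebesgue_measure_itv/= lte_fin EFinB; case: ltP => // vu.
  by rewrite (_ : u = v) ?subee//; apply/eqP; rewrite eq_le uv.
rewrite addeC -(@measureU _ R (measurableTypeR R) lebesgue_measure)//; first last.
- apply/seteqP; split=> x //= [[_]]; rewrite !in_itv/= => /andP[_ xu] /andP[ux _].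
  by move: (lt_trans xu ux); rewrite ltxx.
- by apply: measurableI.
apply: (@le_measure _ (measurableTypeR R)); rewrite ?inE.
- by apply: measurableU => //; exact: measurableI.
- exact: measurableI.
move=> x [[Ux]|] /=; rewrite !in_itv/=.
  by move=> /andP[-> xu]; split=> //; exact: lt_le_trans uv.
move=> /andP[ux xv]; split; last by rewrite xv andbT (le_lt_trans au).
by apply: uvU; rewrite ux.
Qed.

(** Real induction from [a] to [b]. At a good point the derivatives compare the increments up to
    [e * (v - u)]. Bad points lie in an open set [U] of small measure; the steps made there have
    small total length, so absolute continuity makes their total variation of [f] less than [e],
    while [G] can only increase. *)
Lemma ac_le_increment (R : realType) (a b : R) (f G : R -> R) :
  a <= b -> absolutely_continuous f a b ->
  (forall s t, a <= s -> s <= t -> t <= b -> G s <= G t) ->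
  {ae @lebesgue_measure R, forall t, t \in `]a, b[ ->
     [/\ derivable f t 1, derivable G t 1 & derive1 f t <= derive1 G t]} ->
  f b - f a <= G b - G a.
Proof.
move=> ab acf Gmono aeP.
suff main : forall e : R, 0 < e -> f b - f a <= G b - G a + e * (b - a) + e.
  apply/ler_addgt0Pr => e e0.
  have c0 : 0 < b - a + 1 by lra.
  have := main (e / (b - a + 1)); rewrite divr_gt0// => /(_ isT).
  rewrite (_ : G b - G a + _ + _ = G b - G a + e / (b - a + 1) * (b - a + 1)); last by ring.
  by rewrite divfK// gt_eqF.
move=> e e0.
have [d d0 Hd] := acf e e0.
have [U [oU Ua Ub muU notU]] := ae_open_cover a b d0 aeP.
have mono_muU u v : u <= v ->
  (lebesgue_measure (U `&` `]a, u[) <= lebesgue_measure (U `&` `]a, v[))%E.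
  move=> uv; have mU : measurable (U : set (measurableTypeR R)).
    exact: open_measurable.
  apply: (@le_measure _ (measurableTypeR R)); rewrite ?inE; [exact: measurableI..|].
  move=> x [Ux]; rewrite /= !in_itv/= => /andP[-> xu]; split=> //.
  exact: lt_le_trans uv.
pose len (s : seq (R * R)) := \sum_(p <- s) (p.2 - p.1).
(* Invariant: [s] lists from left to right the intervals crossed inside [U]. Their variations are
   only recorded, and are bounded all at once at the end. *)
pose P t := exists s : seq (R * R),
  [/\ forall p, p \in s -> [/\ a <= p.1, p.1 <= p.2 & p.2 <= t],
      pairwise (fun p q : R * R => p.2 <= q.1) s,
      ((len s)%:E <= lebesgue_measure (U `&` `]a, t[))%E &
      f t - f a <= G t - G a + e * (t - a) + \sum_(p <- s) `|f p.2 - f p.1| ].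
have [||s [s1 s2 s3 s4]] := @real_induction R a b P ab.
- exists [::]; split=> //.
    by rewrite /len big_nil; exact: measure_ge0.
  by rewrite big_nil !subrr mulr0 !addr0.
- move=> t /andP[at_ tb].
  have [tU|tU] := pselect (U t).
    have : nbhs t U by apply: open_nbhs_nbhs; split.
    move=> /nbhs_ballP [d' /= d'0 Hd']; exists d' => //.
    move=> u v /andP[au ub] /andP[av vb] /andP[ut1 ut2] /andP[vt1 vt2].
    move=> [s [s1 s2 s3 s4]]; exists (rcons s (u, v)).
    have uv : u <= v by exact: le_trans vt1.
    split.
    + move=> p; rewrite mem_rcons inE => /orP[/eqP->//|/s1 [? ? ?]].
      by split=> //; exact: le_trans uv.
    + by rewrite pairwise_rcons s2 andbT; apply/allP => p /s1 [].
    + rewrite /len -cats1 big_cat/= big_seq1/= addrC EFinD.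
      apply: le_trans (lebesgue_measure_extend oU au uv _); first exact: leeD2l.
      move=> x /andP[ux xv]; apply: Hd'; rewrite /ball/= ltr_norml.
      by move: ut1 vt2 ux xv; clear; move=> *; apply/andP; split; lra.
    + rewrite -cats1 big_cat/= big_seq1/=.
      have := ler_norm (f v - f u).
      have := Gmono u v au uv vb.
      have : 0 <= e * (v - u) by rewrite mulr_ge0 ?subr_ge0 ?(ltW e0).
      move: s4; clear; lra.
  have [df dG dfG] : [/\ derivable f t 1, derivable G t 1 & derive1 f t <= derive1 G t].
    have tab : t \in `]a, b[.
      rewrite in_itv/=; apply/andP; split; rewrite lt_neqAle ?at_ ?tb andbT.
        by apply/eqP => E; apply: tU; rewrite -E.
      by apply/eqP => E; apply: tU; rewrite E.
    by apply: contrapT => H; apply: tU; apply: notU => /(_ tab).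
  have [d' d'0 Hd'] := derivable_increment_le df dG dfG e0.
  exists d' => //.
  move=> u v /andP[au ub] /andP[av vb] ut vt.
  have uv : u <= v by case/andP: ut => _ /le_trans; apply; case/andP: vt.
  move=> [s [s1 s2 s3 s4]]; exists s.
  split=> //.
  + by move=> p /s1 [? ? pu]; split=> //; exact: le_trans uv.
  + exact: le_trans (mono_muU _ _ uv).
  + by move: (Hd' u v ut vt) s4; clear; lra.
apply: le_trans s4 _; rewrite lerD2l.
have := Hd (size s) (fun i => (nth (0, 0) s i).1) (fun i => (nth (0, 0) s i).2).
have sumE (F : R * R -> R) : \sum_(i < size s) F (nth (0, 0) s i) = \sum_(p <- s) F p.
  by rewrite (big_nth (0, 0)) big_mkord.
rewrite (sumE (fun p => p.2 - p.1)) (sumE (fun p => `|f p.2 - f p.1|)).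
move=> H; apply/ltW/H.
- by move=> i; have [] := s1 _ (mem_nth (0, 0) (ltn_ord i)).
- move=> i j _ _ [x [/=]]; rewrite !in_itv/= => /andP[x1 x2] /andP[x3 x4].
  apply: val_inj; case: (ltngtP i j) => // ij.
    have := (pairwiseP (0, 0) s2) i j; rewrite !inE => /(_ (ltn_ord _) (ltn_ord _) ij).
    by move=> /(lt_le_trans x2)/lt_trans/(_ x3); rewrite ltxx.
  have := (pairwiseP (0, 0) s2) j i; rewrite !inE => /(_ (ltn_ord _) (ltn_ord _) ij).
  by move=> /(lt_le_trans x4)/lt_trans/(_ x1); rewrite ltxx.
rewrite -lte_fin; apply: le_lt_trans muU; apply: le_trans s3 _.
have mU : measurable (U : set (measurableTypeR R)) by exact: open_measurable.
by apply: (@le_measure _ (measurableTypeR R)); rewrite ?inE//; exact: measurableI.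
Qed.

Lemma ae_imply2 (R : realType) (P1 P2 P : R -> Prop) :
  (forall t, P1 t -> P2 t -> P t) ->
  {ae @lebesgue_measure R, forall t, P1 t} -> {ae @lebesgue_measure R, forall t, P2 t} ->
  {ae @lebesgue_measure R, forall t, P t}.
Proof. exact: (@filterS2 _ _ (ae_filter_ringOfSetsType (@lebesgue_measure R))). Qed.

Lemma ae_imply (R : realType) (P1 P : R -> Prop) :
  (forall t, P1 t -> P t) ->
  {ae @lebesgue_measure R, forall t, P1 t} -> {ae @lebesgue_measure R, forall t, P t}.
Proof. exact: (@filterS _ _ (ae_filter_ringOfSetsType (@lebesgue_measure R))). Qed.

(** Lebesgue differentiation gives the primitive [G] of [g] the derivative [g] almost everywhere,
    and [G] is monotone since [g] is nonnegative, so [ac_le_increment] applies. If the integral is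
    infinite the claim is trivial. *)
Lemma ac_le_integral (R : realType) (a b : R) (f g : R -> R) :
  a <= b -> absolutely_continuous f a b ->
  measurable_fun (`[a, b] : set R) g -> (forall t, a <= t <= b -> 0 <= g t) ->
  {ae @lebesgue_measure R, forall t, t \in `]a, b[ ->
     derivable f t 1 /\ derive1 f t <= g t} ->
  ((f b - f a)%:E <= \int[@lebesgue_measure R]_(t in `[a, b]) (g t)%:E)%E.
Proof.
move=> ab acf mg g0 aeP.
have ige0 : (0 <= \int[@lebesgue_measure R]_(t in `[a, b]) (g t)%:E)%E.
  by apply: integral_ge0 => t /=; rewrite in_itv/= => /g0; rewrite lee_fin.
have [->|fin] := eqVneq (\int[@lebesgue_measure R]_(t in `[a, b]) (g t)%:E)%E +oo%E.
  exact: leey.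
have ig : (@lebesgue_measure R).-integrable `[a, b] (EFin \o g).
  apply/integrableP; split; first exact/measurable_EFinP.
  under eq_integral => t.
    rewrite inE/= in_itv/= => /g0 gt0.
    rewrite ger0_norm//. over.
  by rewrite ltey.
pose gg := g \_ `[a, b].
have gg0 t : 0 <= gg t.
  rewrite /gg patchE; case: ifPn => //; rewrite inE/= in_itv/=; exact: g0.
have igg : (@lebesgue_measure R).-integrable setT (EFin \o gg).
  by move: ig; rewrite integrable_mkcond// restrict_EFin.
pose G x := (\int[@lebesgue_measure R]_(t in [set` Interval (BLeft a) (BRight x)]) (gg t))%R.
have iS (A : set R) : measurable (A : set (measurableTypeR R)) -> (@lebesgue_measure R).-integrable A (EFin \o gg).
  by move=> mA; exact: integrableS igg.
have Gmono s t : a <= s -> s <= t -> t <= b -> G s <= G t.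
  move=> as_ st tb; rewrite /G /Rintegral fine_le//.
  - by apply: integrable_fin_num => //; exact: iS.
  - by apply: integrable_fin_num => //; exact: iS.
  apply: ge0_subset_integral => //.
  - by have /integrableP[] := iS _ (measurable_itv (Interval (BLeft a) (BRight t))).
  - by move=> x _; rewrite lee_fin.
  - by move=> x /=; rewrite !in_itv/= => /andP[-> /le_trans]; apply.
have locg : locally_integrable setT gg.
  apply: integrable_locally => //; exact: openT.
have := @FTC1 R gg (BLeft a) (fun y => iS _ (measurable_itv _)) locg.
rewrite -/G /= => aeG.
have : f b - f a <= G b - G a.
  apply: ac_le_increment => //.
  apply: ae_imply2 aeP aeG => t Pt Gt tab.
  have /andP[at_ _] : a < t < b by move: tab; rewrite in_itv.
  have [dG G't] := Gt at_.
  have [df f't] := Pt tab; split=> //; rewrite G't /gg patchE mem_set//=.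
  by move: tab; rewrite !in_itv/= => /andP[/ltW-> /ltW->].
have -> : G a = 0 by rewrite /G /Rintegral set_itv1 integral_set1.
rewrite subr0 -lee_fin => /le_trans; apply.
rewrite /G /Rintegral fineK; last by apply: integrable_fin_num => //; exact: iS.
apply: ge0_le_integral => //.
- by move=> x _; rewrite lee_fin.
- by have /integrableP[] := iS _ (measurable_itv (Interval (BLeft a) (BRight b))).
- by apply/measurable_EFinP.
- by move=> x /= abx; rewrite lee_fin /gg patchE mem_set.
Qed.

(** * Affine changes of variable for the Lebesgue measure *)

Section affine.
Context (R : realType) (c d : R).
Hypothesis c0 : c != 0.
Let phi : measurableTypeR R -> measurableTypeR R := fun t => c * t + d.

Let mphi : measurable_fun setT phi.
Proof. by apply: measurable_funD => //; exact: measurable_funM. Qed.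

Let pushed : {measure set (measurableTypeR R) -> \bar R} :=
  measure_function_pushforward__canonical__measure_function_Measure lebesgue_measure mphi.

Let nc : {nonneg R} := NngNum (normr_ge0 c).

(** By uniqueness of the Lebesgue measure it suffices to treat half-open intervals. For [c < 0] the
    preimage is closed at the opposite end, which does not change its length. *)
Lemma lebesgue_measure_affine (A : set (measurableTypeR R)) : measurable A ->
  (`|c|%:E * @lebesgue_measure R (phi @^-1` A) = @lebesgue_measure R A)%E.
Proof.
move=> mA.
apply/esym/(@lebesgue_measure_unique R (mscale nc pushed)) => //.
move=> _ [[u v]] _ <-.
change (@lebesgue_measure R `]u, v] = `|c|%:E * @lebesgue_measure R (phi @^-1` `]u, v]))%E.
have nc0 : 0 < `|c| by rewrite normr_gt0.
have [cgt0|cle0] := ltP 0 c.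
  rewrite (_ : phi @^-1` _ = [set` `](u - d) / c, (v - d) / c]]); last first.
    by apply/seteqP; split=> t /=; rewrite !in_itv/= /phi ltr_pdivrMr// ler_pdivlMr// ltrBlDr lerBrDr ![t * c]mulrC.
  rewrite !lebesgue_measure_itv/= !lte_fin ltr_pM2r ?invr_gt0// ltrD2r gtr0_norm//.
  case: ifPn => _; last by rewrite mule0.
  by rewrite -!EFinB -EFinM; congr EFin; field; rewrite gt_eqF.
have clt0 : c < 0 by rewrite lt_neqAle c0.
rewrite (_ : phi @^-1` _ = [set` `[(v - d) / c, (u - d) / c[]); last first.
  apply/seteqP; split=> t /=; rewrite !in_itv/= /phi ltr_ndivlMr// ler_ndivrMr// ltrBlDr lerBrDr ![t * c]mulrC => /andP[-> ->]//.
rewrite !lebesgue_measure_itv/= !lte_fin ltr_nM2r ?invr_lt0// ltrD2r ltr0_norm//.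
case: ifPn => _; last by rewrite mule0.
by rewrite -!EFinB -EFinM; congr EFin; field; rewrite lt_eqF.
Qed.

Lemma ge0_integral_affine (D : set R) (F : R -> \bar R) :
  measurable (D : set (measurableTypeR R)) -> measurable_fun D F ->
  (forall t, D t -> (0 <= F t)%E) ->
  (`|c|%:E * \int[@lebesgue_measure R]_(t in (fun t => (c * t + d)%R) @^-1` D) F (c * t + d)%R
   = \int[@lebesgue_measure R]_(t in D) F t)%E.
Proof.
move=> mD mF F0.
have := @ge0_integral_pushforward _ _ _ _ R _ mphi (@lebesgue_measure R) D F mD mF.
move=> /(_ _)/= <-; last by move=> t; rewrite inE; exact: F0.
rewrite -(@ge0_integral_mscale _ _ R pushed D mD nc)//.
by apply: eq_measure_integral => A mA _; exact: lebesgue_measure_affine.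
Qed.

Lemma measurable_preimage_affine (A : set R) : measurable (A : set (measurableTypeR R)) ->
  measurable ((fun t => c * t + d) @^-1` A : set (measurableTypeR R)).
Proof. by move=> mA; rewrite -[X in measurable X]setTI; exact: mphi. Qed.

Lemma ae_affine (P : R -> Prop) : {ae @lebesgue_measure R, forall t, P t} ->
  {ae @lebesgue_measure R, forall t, P (c * t + d)}.
Proof.
move=> [N [mN N0 sub]]; exists ((fun t => c * t + d) @^-1` N); split.
- exact: measurable_preimage_affine.
- have := lebesgue_measure_affine mN; rewrite [X in _ = X]N0 /mscale /pushforward/=.
  by move/eqP; rewrite mule_eq0 eqe normr_eq0 (negPf c0)/= => /eqP.
- by move=> t; exact: sub.
Qed.

Lemma measurable_fun_affine d' (T : measurableType d') (D : set R) (F : R -> T) :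
  measurable (D : set (measurableTypeR R)) ->
  measurable_fun D F ->
  measurable_fun ((fun t => c * t + d) @^-1` D) (fun t => F (c * t + d)).
Proof.
move=> mD mF; apply: (measurable_comp mD _ mF).
  by move=> _ [t Dt <-].
exact: measurable_funS mphi.
Qed.

End affine.

Lemma preimage_affine_itv (R : realType) (c d a b : R) : 0 < c ->
  (fun t => c * t + d) @^-1` `[c * a + d, c * b + d] = `[a, b]%classic.
Proof.
by move=> c0; apply/seteqP; split=> t /=; rewrite !in_itv/= !lerD2r !ler_pM2l.
Qed.

Lemma preimage_affine_itvN (R : realType) (c d a b : R) : c < 0 ->
  (fun t => c * t + d) @^-1` `[c * b + d, c * a + d] = `[a, b]%classic.
Proof.
by move=> c0; apply/seteqP; split=> t /=; rewrite !in_itv/= !lerD2r !ler_nM2l// andbC.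
Qed.

(** * Operations that preserve absolute continuity *)

Section absolute_continuity.
Variable R : realType.
Implicit Types (f g : R -> R) (a b c : R).

Lemma ac_sub f a b a' b' : absolutely_continuous f a b -> a <= a' -> b' <= b ->
  absolutely_continuous f a' b'.
Proof.
move=> acf aa' bb' e /acf [d d0 H]; exists d => // n u v uv; apply: H => i.
by have [? [? ?]] := uv i; split; [exact: le_trans aa' _|split=> //; exact: le_trans bb'].
Qed.

Lemma eq_ac f g a b : (forall t, a <= t <= b -> f t = g t) ->
  absolutely_continuous f a b -> absolutely_continuous g a b.
Proof.
move=> fg acf e /acf [d d0 H]; exists d => // n u v uv tr lt.
rewrite (eq_bigr (fun i => `|f (v i) - f (u i)|)); first exact: H.
move=> i _; have [au [uvi vb]] := uv i.
by rewrite !fg// ?au ?vb ?andbT//=; [exact: le_trans uvi vb | exact: le_trans au uvi].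
Qed.

(** Every interval is cut at [b] by taking the minimum and the maximum of its endpoints with [b].
    The pieces on either side stay disjoint and are no longer than the original intervals. *)
Lemma ac_concat f a b c : a <= b -> b <= c -> absolutely_continuous f a b -> absolutely_continuous f b c ->
  absolutely_continuous f a c.
Proof.
move=> leab lebc ab bc e e0; have e20 : 0 < e / 2 by rewrite divr_gt0.
have [d1 d10 H1] := ab _ e20; have [d2 d20 H2] := bc _ e20.
exists (Num.min d1 d2); first by rewrite lt_min d10.
move=> n u v uv tr; rewrite lt_min => /andP[lt1 lt2].
have sub_triv (p q : 'I_n -> R) : (forall i x, p i < x < q i -> u i < x < v i) ->
    trivIset setT (fun i => [set` `]p i, q i[]).
  move=> H i j _ _ [x [/= xi xj]]; apply: tr => //; exists x; split => /=.
    by rewrite in_itv/= H//; move: xi; rewrite in_itv.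
  by rewrite in_itv/= H//; move: xj; rewrite in_itv.
have le_sum (p q : 'I_n -> R) d : (forall i, q i - p i <= v i - u i) ->
    \sum_i (v i - u i) < d -> \sum_i (q i - p i) < d.
  by move=> H; apply: le_lt_trans; apply: ler_sum.
have h1 : \sum_i `|f (Num.min (v i) b) - f (Num.min (u i) b)| < e / 2.
  apply: H1.
  - move=> i; have [? [uvi ?]] := uv i.
    by split; [rewrite le_min leab andbT | split; [rewrite le_min2 | rewrite ge_min lexx orbT]].
  - apply: sub_triv => i x; rewrite gt_min lt_min => /andP[/orP[ux|bx] /andP[xv xb]].
      by rewrite ux.
    by have := lt_trans bx xb; rewrite ltxx.
  - apply: le_sum lt1 => i; have [_ [uvi _]] := uv i.
    by have [c1|c1] := leP (v i) b; have [c2|c2] := leP (u i) b; move: uvi c1 c2; clear; lra.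
have h2 : \sum_i `|f (Num.max (v i) b) - f (Num.max (u i) b)| < e / 2.
  apply: H2.
  - move=> i; have [? [uvi ?]] := uv i.
    by split; [rewrite le_max lexx orbT | split; [rewrite le_max2 | rewrite ge_max lebc andbT]].
  - apply: sub_triv => i x; rewrite lt_max gt_max => /andP[/andP[ux bx] /orP[xv|xb]].
      by rewrite ux.
    by have := lt_trans bx xb; rewrite ltxx.
  - apply: le_sum lt2 => i; have [_ [uvi _]] := uv i.
    by have [c1|c1] := leP (v i) b; have [c2|c2] := leP (u i) b; move: uvi c1 c2; clear; lra.
rewrite (splitr e); apply: le_lt_trans (ltrD h1 h2).
rewrite -big_split/=; apply: ler_sum => i _.
have [ui [uvi vi]] := uv i.
have [vb|bv] := leP (v i) b.
  rewrite (min_idPl _) ?(min_idPl _)//; last exact: le_trans vb.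
  by rewrite lerDl.
have [bu|ub] := leP b (u i).
  by rewrite subrr normr0 add0r.
by rewrite addrC; exact: ler_distD.
Qed.

Lemma ac_affine f a b a' b' c d : c != 0 ->
  (forall t, a' <= t <= b' -> a <= c * t + d <= b) ->
  absolutely_continuous f a b -> absolutely_continuous (fun t => f (c * t + d)) a' b'.
Proof.
move=> c0 sub acf e /acf [d1 d10 H].
have nc0 : 0 < `|c| by rewrite normr_gt0.
exists (d1 / `|c|); first by rewrite divr_gt0.
move=> n u v uv tr; rewrite ltr_pdivlMr// mulr_suml => lt.
have uvin i : (a <= c * u i + d <= b) /\ (a <= c * v i + d <= b).
  have [ui [uvi vi]] := uv i.
  by split; apply: sub; rewrite ?ui ?vi ?andbT//=; [exact: le_trans uvi vi|exact: le_trans ui uvi].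
have [cgt0|cle0] := ltP 0 c.
  apply: (H n (fun i => c * u i + d) (fun i => c * v i + d)).
  - move=> i; have [/andP[? _] /andP[_ ?]] := uvin i; split=> //; split=> //.
    by rewrite lerD2r ler_pM2l//; case: (uv i) => _ [].
  - move=> i j _ _ [x [/=]]; rewrite !in_itv/= => xi xj; apply: tr => //.
    exists ((x - d) / c); split => /=; rewrite in_itv/= ltr_pdivlMr// ltr_pdivrMr// ltrBrDr ltrBlDr ![_ * c]mulrC//.
  - by rewrite (eq_bigr (fun i => (v i - u i) * `|c|))// => i _; rewrite gtr0_norm//; ring.
have clt0 : c < 0 by rewrite lt_neqAle c0.
rewrite (eq_bigr (fun i => `|f (c * u i + d) - f (c * v i + d)|)); last first.
  by move=> i _; rewrite distrC.
apply: (H n (fun i => c * v i + d) (fun i => c * u i + d)).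
- move=> i; have [/andP[_ ?] /andP[? _]] := uvin i; split=> //; split=> //.
  by rewrite lerD2r ler_nM2l//; case: (uv i) => _ [].
- move=> i j _ _ [x [/=]]; rewrite !in_itv/= => xi xj; apply: tr => //.
  exists ((x - d) / c); split => /=; rewrite in_itv/= ltr_ndivlMr// ltr_ndivrMr// ltrBrDr ltrBlDr ![_ * c]mulrC andbC//.
- by rewrite (eq_bigr (fun i => (v i - u i) * `|c|))// => i _; rewrite ltr0_norm//; ring.
Qed.

Lemma lipschitz_ac f a b K : 0 <= K ->
  (forall s t, a <= s -> s <= t -> t <= b -> `|f t - f s| <= K * (t - s)) ->
  absolutely_continuous f a b.
Proof.
move=> K0 lip e e0; exists (e / (K + 1)); first by rewrite divr_gt0// ltr_pwDr.
move=> n u v uv _; rewrite ltr_pdivlMr ?ltr_pwDr// => lt.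
apply: le_lt_trans lt; rewrite mulr_suml; apply: ler_sum => i _.
have [ui [uvi vi]] := uv i.
apply: (le_trans (lip _ _ ui uvi vi)).
by rewrite mulrC ler_wpM2l ?subr_ge0// lerDl.
Qed.

Lemma ac_scaleD k f g a b : absolutely_continuous f a b -> absolutely_continuous g a b ->
  absolutely_continuous (fun t => k * f t + g t) a b.
Proof.
move=> acf acg e e0; have e20 : 0 < e / 2 by rewrite divr_gt0.
have k0 : 0 < `|k| + 1 by rewrite ltr_pwDr.
have [d1 d10 H1] := acf (e / 2 / (`|k| + 1)) (divr_gt0 e20 k0).
have [d2 d20 H2] := acg _ e20.
exists (Num.min d1 d2); first by rewrite lt_min d10.
move=> n u v uv tr; rewrite lt_min => /andP[lt1 lt2].
have := H1 _ _ _ uv tr lt1; rewrite ltr_pdivlMr// => h1.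
rewrite (splitr e); apply: le_lt_trans (ltrD h1 (H2 _ _ _ uv tr lt2)).
rewrite mulr_suml -big_split/=; apply: ler_sum => i _.
rewrite (_ : k * f (v i) + g (v i) - _ = k * (f (v i) - f (u i)) + (g (v i) - g (u i))); last by ring.
rewrite (le_trans (ler_normD _ _))// lerD2r normrM mulrC ler_wpM2l// lerDl//.
Qed.

Lemma ac_cst k a b : absolutely_continuous (fun=> k) a b.
Proof. by apply: (@lipschitz_ac _ _ _ 0) => // s t _ _ _; rewrite subrr normr0 mul0r. Qed.

Lemma ac_sum (I : finType) (k : I -> R) (f : I -> R -> R) a b :
  (forall i, absolutely_continuous (f i) a b) ->
  absolutely_continuous (fun t => \sum_i k i * f i t) a b.
Proof.
move=> acf; elim: (index_enum I) => [|i s IH].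
  by apply: eq_ac (ac_cst 0 a b) => t _; rewrite big_nil.
apply: eq_ac (ac_scaleD (k i) (acf i) IH) => t _.
by rewrite big_cons.
Qed.

Lemma ac_unif f a b : absolutely_continuous f a b ->
  forall e, 0 < e -> exists2 d, 0 < d &
  forall s t, a <= s -> s <= t -> t <= b -> t - s < d -> `|f t - f s| < e.
Proof.
move=> acf e /acf [d d0 H]; exists d => // s t as_ st tb tsd.
have := H 1%N (fun=> s) (fun=> t); rewrite !big_ord1; apply => //.
by move=> i j _ _ _; rewrite (ord1 i) (ord1 j).
Qed.

Lemma ac_measurable f a b : absolutely_continuous f a b ->
  measurable_fun (`[a, b] : set (measurableTypeR R)) f.
Proof.
move=> acf; apply: subspace_continuous_measurable_fun => //.
apply/subspace_continuousP => x /=; rewrite in_itv/= => /andP[ax xb].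
apply/cvgrPdist_lt => e e0.
have [d d0 H] := ac_unif acf e0.
rewrite near_withinE; exists d => //= t /= xtd; rewrite in_itv/= => /andP[at_ tb].
have [xt|/ltW tx] := leP x t.
  by rewrite distrC; apply: H => //; rewrite -(ger0_norm (_ : 0 <= t - x)) ?subr_ge0// distrC.
by apply: H => //; rewrite -(ger0_norm (_ : 0 <= x - t)) ?subr_ge0.
Qed.

End absolute_continuity.

(** * The logarithmic mean *)

Lemma measurable_fun_powR d (T : measurableType d) (R : realType) (D : set T) (f g : T -> R) :
  measurable D ->
  measurable_fun D f -> measurable_fun D g -> measurable_fun D (fun x => f x `^ g x).
Proof.
move=> mD mf mg; rewrite /powR; apply: measurable_fun_if => //.
- by apply: measurable_fun_eqr.
- apply: (@measurableT_comp _ _ _ _ _ _ (fun b : bool => b%:R : R)) => //.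
  by apply: (@measurable_funS _ _ _ _ D) => //; exact: measurable_fun_eqr.
- apply: (@measurable_funS _ _ _ _ D) => //.
  apply: measurableT_comp => //; apply: measurable_funM => //.
  exact: measurableT_comp.
Qed.

Section log_mean.
Variable R : realType.
Implicit Types s t p c : R.
Local Notation mu := (@lebesgue_measure R).

Let gm s t p := s `^ (1 - p) * t `^ p.

Let mgm s t : measurable_fun (`[0, 1] : set (measurableTypeR R)) (gm s t).
Proof.
apply: measurable_funM; apply: measurable_fun_powR => //.
exact: measurable_funB.
Qed.

Let gm_ge0 s t p : 0 <= gm s t p.
Proof. by rewrite mulr_ge0 ?powR_ge0. Qed.

Let gm_diag c p : 0 <= c -> gm c c p = c.
Proof.
move=> c0; rewrite /gm -powRD ?subrK ?powRr1//; apply/implyP.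
by rewrite oner_eq0.
Qed.

Let gm_mono s t s' t' p : 0 <= p <= 1 -> 0 <= s -> s <= s' -> 0 <= t -> t <= t' ->
  gm s t p <= gm s' t' p.
Proof.
move=> /andP[p0 p1] s0 ss t0 tt; rewrite ler_pM ?powR_ge0//; apply: ge0_ler_powR => //.
- by rewrite subr_ge0.
- by rewrite nnegrE (le_trans s0).
- by rewrite nnegrE (le_trans t0).
Qed.

Let gm_homo c s t p : 0 <= c -> 0 <= s -> 0 <= t -> gm (c * s) (c * t) p = c * gm s t p.
Proof.
move=> c0 s0 t0; rewrite /gm !powRM// mulrACA; congr (_ * _); exact: gm_diag.
Qed.

(* Hoelder's inequality for two terms with exponents 1/(1-p) and 1/p *)
Let gm_superadd s t s' t' p : 0 <= p <= 1 -> 0 <= s -> 0 <= s' -> 0 <= t -> 0 <= t' ->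
  gm s t p + gm s' t' p <= gm (s + s') (t + t') p.
Proof.
move=> /andP[p0 p1] s0 s'0 t0 t'0; rewrite /gm.
have [->|pn0] := eqVneq p 0; first by rewrite subr0 !powRr0 !powRr1 ?mulr1// addr_ge0.
have [->|pn1] := eqVneq p 1; first by rewrite subrr !powRr0 !powRr1 ?mul1r// addr_ge0.
have pgt0 : 0 < p by rewrite lt_neqAle eq_sym pn0.
have qgt0 : 0 < 1 - p by rewrite subr_gt0 lt_neqAle pn1.
have := @hoelder2 R (s `^ (1 - p)) (s' `^ (1 - p)) (t `^ p) (t' `^ p) (1 - p)^-1 p^-1.
rewrite !invrK -!powRrM !divff ?gt_eqF// !powRr1//; apply; rewrite ?powR_ge0 ?invr_gt0//.
by rewrite subrK.
Qed.

Let gm_integrable s t : 0 <= s -> 0 <= t -> mu.-integrable `[0, 1] (EFin \o gm s t).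
Proof.
move=> s0 t0; apply: (@le_integrable _ _ R mu `[0, 1] _ (EFin \o gm s t) (cst (s + t)%:E)) => //.
- by apply/measurable_EFinP; exact: mgm.
- move=> p /=; rewrite in_itv/= => p01; rewrite lee_fin ger0_norm// ger0_norm ?addr_ge0//.
  rewrite -(@gm_diag (s + t) p) ?addr_ge0//.
  by apply: gm_mono => //; rewrite ?lerDl ?lerDr.
- apply/integrableP; split; first exact: measurable_cst.
  rewrite integral_cst// [X in (_ * X)%E]lebesgue_measure_itv/= lte_fin ltr01.
  by rewrite oppr0 adde0 mule1 ltry.
Qed.

Lemma log_meanE s t : 0 <= s -> 0 <= t ->
  (log_mean s t)%:E = (\int[mu]_(p in `[0%R, 1%R]) (gm s t p)%:E)%E.
Proof.
move=> s0 t0; rewrite /log_mean /Rintegral fineK//.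
by apply: integrable_fin_num => //; exact: gm_integrable.
Qed.

Lemma log_mean_ge0 s t : 0 <= log_mean s t.
Proof. by apply: Rintegral_ge0 => p _; exact: gm_ge0. Qed.

Lemma log_mean_le s t s' t' : 0 <= s -> s <= s' -> 0 <= t -> t <= t' ->
  log_mean s t <= log_mean s' t'.
Proof.
move=> s0 ss t0 tt; apply: le_Rintegral => //.
- by apply: gm_integrable.
- by apply: gm_integrable; [exact: le_trans ss|exact: le_trans tt].
- by move=> p /=; rewrite in_itv/= => p01; exact: gm_mono.
Qed.

Lemma log_mean_diag c : 0 <= c -> log_mean c c = c.
Proof.
move=> c0; rewrite /log_mean; transitivity (\int[mu]_(p in `[0, 1]) (cst c p)).
  by apply: eq_Rintegral => p _; exact: gm_diag.
rewrite Rintegral_cst//= [X in fine X]lebesgue_measure_itv/= lte_fin ltr01 oppr0 adde0 mulr1//.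
Qed.

Lemma log_meanZ c s t : 0 <= c -> 0 <= s -> 0 <= t ->
  log_mean (c * s) (c * t) = c * log_mean s t.
Proof.
move=> c0 s0 t0; rewrite /log_mean -RintegralZl//; last exact: gm_integrable.
by apply: eq_Rintegral => p _; exact: gm_homo.
Qed.

(** Together with homogeneity this is the concavity of the logarithmic mean, the source of the joint
    convexity of the squared distance. *)
Lemma log_mean_superadd s t s' t' : 0 <= s -> 0 <= s' -> 0 <= t -> 0 <= t' ->
  log_mean s t + log_mean s' t' <= log_mean (s + s') (t + t').
Proof.
move=> s0 s'0 t0 t'0; rewrite /log_mean -RintegralD//; try exact: gm_integrable.
apply: le_Rintegral => //.
- by apply: (@integrableD _ (measurableTypeR R) R _ _ _ (EFin \o gm s t) (EFin \o gm s' t')) => //; exact: gm_integrable.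
- by apply: gm_integrable; rewrite addr_ge0.
- by move=> p /=; rewrite in_itv/= => p01; exact: gm_superadd.
Qed.

Lemma log_meanC s t : 0 <= s -> 0 <= t -> log_mean s t = log_mean t s.
Proof.
move=> s0 t0; suff : (log_mean s t)%:E = (log_mean t s)%:E by case.
rewrite (log_meanE s0 t0) (log_meanE t0 s0).
have n1 : (-1 : R) != 0 by rewrite oppr_eq0 oner_eq0.
have := @ge0_integral_affine R (-1) 1 n1 `[0, 1] (EFin \o gm s t).
rewrite (_ : _ @^-1` _ = `[0, 1]%classic); last first.
  by apply/seteqP; split=> p /=; rewrite !in_itv/=; lra.
rewrite normrN1 mul1e => <-; first last.
- by move=> p _; rewrite lee_fin.
- by apply/measurable_EFinP; exact: mgm.
- exact: measurable_itv.
- by apply: eq_integral => p _; rewrite /= /gm mulrC mulN1r addrC opprB addrCA subrr addr0.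
Qed.

Lemma log_mean_le_max s t : 0 <= s -> 0 <= t -> log_mean s t <= Num.max s t.
Proof.
move=> s0 t0; have m0 : 0 <= Num.max s t by rewrite le_max s0.
rewrite -[leRHS](log_mean_diag m0).
by apply: log_mean_le; rewrite ?le_max ?lexx ?orbT.
Qed.

Lemma log_mean_ge s t c : 0 <= c -> c <= s -> c <= t -> c <= log_mean s t.
Proof. by move=> c0 cs ct; rewrite -[leLHS](log_mean_diag c0); exact: log_mean_le. Qed.

Lemma log_mean_sum (I : finType) (k f g : I -> R) :
  (forall i, 0 <= k i) -> (forall i, 0 <= f i) -> (forall i, 0 <= g i) ->
  \sum_i k i * log_mean (f i) (g i) <= log_mean (\sum_i k i * f i) (\sum_i k i * g i).
Proof.
move=> k0 f0 g0; elim: (index_enum I) => [|i r IH].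
  by rewrite !big_nil log_mean_ge0.
rewrite !big_cons; apply: le_trans (log_mean_superadd _ _ _ _).
- by rewrite log_meanZ// lerD2l.
- by rewrite mulr_ge0.
- by apply: sumr_ge0 => j _; rewrite mulr_ge0.
- by rewrite mulr_ge0.
- by apply: sumr_ge0 => j _; rewrite mulr_ge0.
Qed.

(** By Tonelli: the integrand is jointly measurable in the time and the exponent once [f] and [g]
    are extended by zero outside [D]. *)
Lemma measurable_log_mean (D : set (measurableTypeR R)) (f g : R -> R) : measurable D ->
  measurable_fun D f -> measurable_fun D g ->
  measurable_fun D (fun t => log_mean (f t) (g t)).
Proof.
move=> mD mf mg.
pose I01 : set (measurableTypeR R) := `[0, 1]%classic.
have mI : measurable I01 by exact: measurable_itv.
pose f' := f \_ D; pose g' := g \_ D.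
have mf' : measurable_fun setT f' by apply/(measurable_restrictT _ _).1.
have mg' : measurable_fun setT g' by apply/(measurable_restrictT _ _).1.
pose F (x : measurableTypeR R * measurableTypeR R) : \bar R :=
  (f' x.1 `^ (1 - x.2) * g' x.1 `^ x.2 * \1_I01 x.2)%:E.
have mF : measurable_fun setT F.
  apply/measurable_EFinP; apply: measurable_funM; first apply: measurable_funM.
  - apply: measurable_fun_powR => //; first exact: (measurableT_comp mf').
    by apply: measurable_funB; [exact: measurable_cst|exact: measurable_snd].
  - apply: measurable_fun_powR => //; exact: (measurableT_comp mg').
  - have mI1 : measurable_fun setT (\1_I01 : measurableTypeR R -> R) by exact: measurable_indic.
    exact: (measurableT_comp mI1 measurable_snd).
have F0 x : (0 <= F x)%E by rewrite lee_fin !mulr_ge0 ?powR_ge0.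
have mFF := @measurable_fun_fubini_tonelli_F _ _ _ _ R mu F mF F0.
apply: (@eq_measurable_fun _ _ _ _ D (fun t => fine (fubini_F mu F t))); last first.
  apply: measurable_funTS; apply: (measurableT_comp _ mFF) => //.
move=> t; rewrite inE => Dt; rewrite /fubini_F /log_mean /Rintegral; congr fine.
rewrite [RHS]integral_mkcond; apply: eq_integral => p _.
have -> : F (t, p) = (f t `^ (1 - p) * g t `^ p * \1_I01 p)%:E.
  by rewrite /F /f' /g' /= /patch mem_set.
have [pI|pI] := boolP (p \in I01).
  by rewrite patchE indicE pI mulr1.
by rewrite patchE indicE (negPf pI) mulr0.
Qed.

End log_mean.

(** * Curves and their action *)

Lemma is_derive1P (R : realType) (f : R -> R) (t l : R) :
  is_derive t 1 f l <-> derivable f t 1 /\ derive1 f t = l.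
Proof.
by split=> [[df <-]|[df dfl]]; [rewrite derive1E | split=> //; rewrite -derive1E].
Qed.

Lemma near_is_derive (R : realType) (f g : R -> R) (t l : R) :
  (\near t, f t = g t) -> is_derive t 1 f l -> is_derive t 1 g l.
Proof.
move=> fg [df dfl]; split; first exact: near_eq_derivable df.
by rewrite -(near_eq_derive (1 : R) fg).
Qed.

Lemma is_derive_affine (R : realType) (c d t : R) :
  is_derive t 1 (fun s => c * s + d) c.
Proof.
rewrite (_ : (fun s => c * s + d) = (c \*: @idfun R) + cst d)//.
have h := is_deriveD (is_deriveZ c (is_derive_id t (1 : R))) (is_derive_cst d t (1 : R)).
by apply: (is_derive_eq h); rewrite addr0 [LHS]mulr1.
Qed.

Lemma ae_neq (R : realType) (a : R) : {ae @lebesgue_measure R, forall t, t != a}.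
Proof.
exists [set a]; split; [exact: measurable_set1|exact: lebesgue_measure_set1|].
by move=> t /= /negP; rewrite negbK => /eqP.
Qed.

Section plans.
Variables (R : realType) (X : finType) (Q : X -> X -> R) (pi : X -> R).
Hypothesis HQ : reversible_chain Q pi.
Local Notation mu := (@lebesgue_measure R).
Implicit Types (a b c d : R) (rho psi : R -> X -> R).

(** The sign is chosen so that the continuity equation says that the time derivative of [rho] equals
    the drift. *)
Definition drift (r p : X -> R) (x : X) : R :=
  \sum_y (p x - p y) * rho_hat r x y * Q x y.

(** The integrand of the action. For [p = ln r] it is also the information of [r], so one set of
    estimates serves both. *)
Definition kinetic (r p : X -> R) : R :=
  2^-1 * \sum_x \sum_y (p x - p y) ^+ 2 * rho_hat r x y * Q x y * pi x.

(** The time interval is arbitrary and the equation is required at interior times only, so that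
    plans can be restricted, rescaled and glued. *)
Record plan_on a b rho psi : Prop := PlanOn {
  plan_on_density : forall t, a <= t <= b -> density pi (rho t);
  plan_on_ac : forall x, absolutely_continuous (rho^~ x) a b;
  plan_on_measurable : forall x, measurable_fun (`[a, b] : set R) (psi^~ x);
  plan_on_drift : {ae mu, forall t, a < t < b -> forall x,
     is_derive t 1 (rho^~ x) (drift (rho t) (psi t) x)} }.

Definition energy a b rho psi : \bar R :=
  (\int[mu]_(t in `[a, b]) (kinetic (rho t) (psi t))%:E)%E.

Lemma kinetic_ge0 r p : 0 <= kinetic r p.
Proof.
rewrite mulr_ge0 ?invr_ge0//; apply: sumr_ge0 => x _; apply: sumr_ge0 => y _.
exact: (mulr_ge0 (mulr_ge0 (mulr_ge0 (sqr_ge0 _) (log_mean_ge0 _ _)) (rates_ge0 HQ x y)) (ltW (Defs.pi_gt0 HQ x))).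
Qed.

Lemma kinetic_measurable a b rho psi :
  (forall x, measurable_fun (`[a, b] : set (measurableTypeR R)) (rho^~ x)) ->
  (forall x, measurable_fun (`[a, b] : set (measurableTypeR R)) (psi^~ x)) ->
  measurable_fun (`[a, b] : set (measurableTypeR R)) (fun t => kinetic (rho t) (psi t)).
Proof.
move=> mr mp; apply: measurable_funM; first exact: measurable_cst.
apply: measurable_sum => x; apply: measurable_sum => y.
apply: measurable_funM; last exact: measurable_cst.
apply: measurable_funM; last exact: measurable_cst.
apply: measurable_funM; first by apply: measurable_funX; apply: measurable_funB.
by apply: measurable_log_mean => //; exact: measurable_itv.
Qed.

Lemma plan_kinetic_measurable a b rho psi : plan_on a b rho psi ->
  measurable_fun (`[a, b] : set (measurableTypeR R)) (fun t => kinetic (rho t) (psi t)).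
Proof.
move=> P; apply: kinetic_measurable => x; last exact: (plan_on_measurable P).
by apply: ac_measurable; exact: (plan_on_ac P).
Qed.

Lemma plan_on_sub a b a' b' rho psi : a <= a' -> b' <= b ->
  plan_on a b rho psi -> plan_on a' b' rho psi.
Proof.
move=> aa bb [dens ac mea dr]; split.
- by move=> t /andP[ta tb]; apply: dens; rewrite (le_trans aa) ?(le_trans tb).
- by move=> x; exact: ac_sub (ac x) aa bb.
- move=> x; apply: measurable_funS (mea x) => //.
  move=> t /=; rewrite !in_itv/= => /andP[ta tb].
  by rewrite (le_trans aa) ?(le_trans tb).
- apply: ae_imply dr => t dr /andP[ta tb]; apply: dr.
  by rewrite (le_lt_trans aa) ?(lt_le_trans tb).
Qed.

Lemma energy_ge0 a b rho psi : (0 <= energy a b rho psi)%E.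
Proof. by apply: integral_ge0 => t _; rewrite lee_fin kinetic_ge0. Qed.

Lemma energyD a b c rho psi : a <= b -> b <= c -> plan_on a c rho psi ->
  energy a c rho psi = (energy a b rho psi + energy b c rho psi)%E.
Proof.
move=> ab bc P; rewrite /energy.
have mk := plan_kinetic_measurable P.
have subm (I : interval R) : [set` I] `<=` `[a, c]%classic ->
    measurable_fun ([set` I] : set (measurableTypeR R)) (fun t => (kinetic (rho t) (psi t))%:E).
  move=> IS; apply/measurable_EFinP; apply: measurable_funS mk => //; exact: measurable_itv.
rewrite -[X in _ = (_ + X)%E]integral_itv_obnd_cbnd; last first.
  by apply: subm => t /=; rewrite !in_itv/= => /andP[/ltW bt ->]; rewrite (le_trans ab).
have -> : `[a, c]%classic = `[a, b]%classic `|` `]b, c]%classic.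
  apply/seteqP; split=> t /=; rewrite !in_itv/=.
    by move=> /andP[-> ->] /=; rewrite andbT; case: leP; [left|right].
  by move=> [/andP[-> tb]|/andP[/ltW bt ->]]; rewrite ?(le_trans tb) ?(le_trans ab).
rewrite ge0_integral_setU//; try exact: measurable_itv.
- apply/measurable_EFinP; apply: measurable_funS mk => //.
  move=> t /= [|]; rewrite !in_itv/=.
    by move=> /andP[-> tb]; rewrite (le_trans tb).
  by move=> /andP[/ltW bt ->]; rewrite (le_trans ab).
- by move=> t _; rewrite lee_fin kinetic_ge0.
- apply/disj_setPLR => t /=; rewrite !in_itv/= => /andP[_ tb] /andP[bt _].
  by move: (le_lt_trans tb bt); rewrite ltxx.
Qed.

Lemma driftZ k r p x : drift r (fun y => k * p y) x = k * drift r p x.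
Proof.
by rewrite /drift mulr_sumr; apply: eq_bigr => y _; rewrite -mulrBr -!mulrA.
Qed.

Lemma kineticZ k r p : kinetic r (fun y => k * p y) = k ^+ 2 * kinetic r p.
Proof.
rewrite /kinetic mulrCA; congr (_ * _); rewrite mulr_sumr; apply: eq_bigr => x _.
by rewrite mulr_sumr; apply: eq_bigr => y _; rewrite -mulrBr exprMn -!mulrA.
Qed.

Lemma plan_on_affine a b a' b' c d rho psi : c != 0 ->
  (fun t => c * t + d) @^-1` `[a, b] = `[a', b']%classic ->
  plan_on a b rho psi ->
  plan_on a' b' (fun t => rho (c * t + d)) (fun t x => c * psi (c * t + d) x).
Proof.
move=> c0 pre [dens ac mea dr].
have im t : a' <= t <= b' -> a <= c * t + d <= b.
  move=> t1; have : `[a', b']%classic t by rewrite /= in_itv.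
  by rewrite -pre /= in_itv.
split.
- by move=> t /im; exact: dens.
- by move=> x; apply: (@ac_affine R (rho^~ x) a b) => //.
- move=> x; apply: measurable_funM; first exact: measurable_cst.
  rewrite -pre; exact: (@measurable_fun_affine R c d _ _ _ (psi^~ x) (measurable_itv _) (mea x)).
- have dr' := @ae_affine R c d c0 _ dr.
  (* The times mapped to [a] and [b] are discarded, since the original equation holds only strictly
     between them. *)
  have [na nb] := (ae_neq ((a - d) / c), ae_neq ((b - d) / c)).
  apply: ae_imply2 dr' (ae_imply2 (fun t => @conj _ _) na nb) => t dt [ta tb] tab x.
  have H : a < c * t + d < b.
    have /andP[h1 h2] : a <= c * t + d <= b.
      by apply: im; case/andP: tab => /ltW-> /ltW->.
    rewrite !lt_neqAle h1 h2 !andbT; apply/andP; split; apply/eqP => E.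
      by move: ta; rewrite E addrK mulrAC divff// mul1r eqxx.
    by move: tb; rewrite -E addrK mulrAC divff// mul1r eqxx.
  rewrite driftZ mulrC; apply: (@is_derive1_comp R (rho^~ x) (fun s => c * s + d)); first exact: dt.
  exact: is_derive_affine.
Qed.

(** The rescaled potential contributes [c ^+ 2] and the change of variable divides by [|c|]. A
    negative [c] covers time reversal. *)
Lemma energy_affine a b a' b' c d rho psi : c != 0 ->
  (fun t => c * t + d) @^-1` `[a, b] = `[a', b']%classic ->
  plan_on a b rho psi ->
  energy a' b' (fun t => rho (c * t + d)) (fun t x => c * psi (c * t + d) x) =
  (`|c|%:E * energy a b rho psi)%E.
Proof.
move=> c0 pre P; rewrite /energy.
have mk := plan_kinetic_measurable P.
rewrite -(@ge0_integral_affine R c d c0 `[a, b] (fun t => (kinetic (rho t) (psi t))%:E)) ?pre; first last.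
- by move=> t _; rewrite lee_fin kinetic_ge0.
- by apply/measurable_EFinP.
- exact: measurable_itv.
rewrite muleA -EFinM -normrM -expr2 ger0_norm ?sqr_ge0//.
rewrite -ge0_integralZl//.
- by apply: eq_integral => t _; rewrite kineticZ EFinM.
- apply/measurable_EFinP; rewrite -pre.
  exact: (@measurable_fun_affine R c d _ _ _ _ (measurable_itv _) mk).
- by move=> t _; rewrite lee_fin kinetic_ge0.
- by rewrite lee_fin sqr_ge0.
Qed.

Definition splice (T : Type) b (f g : R -> T) (t : R) : T := if t <= b then f t else g t.

Lemma spliceL (T : Type) b (f g : R -> T) t : t <= b -> splice b f g t = f t.
Proof. by rewrite /splice => ->. Qed.

Lemma spliceR (T : Type) b (f g : R -> T) t : b < t -> splice b f g t = g t.
Proof. by rewrite /splice leNgt => ->. Qed.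

Lemma plan_on_concat a b c rho psi rho' psi' : a <= b -> b <= c ->
  plan_on a b rho psi -> plan_on b c rho' psi' -> rho b = rho' b ->
  plan_on a c (splice b rho rho') (splice b psi psi').
Proof.
move=> ab bc [dens ac mea dr] [dens' ac' mea' dr'] E.
have gl t : b <= t -> splice b rho rho' t = rho' t.
  move=> bt; rewrite /splice; have [tb|//] := leP t b.
  by have -> : t = b by apply/eqP; rewrite eq_le tb bt.
have gr t : t <= b -> splice b rho rho' t = rho t by rewrite /splice => ->.
split.
- move=> t /andP[ta tc]; have [tb|/ltW bt] := leP t b.
    by rewrite gr//; apply: dens; rewrite ta.
  by rewrite gl//; apply: dens'; rewrite bt.
- move=> x; apply: (ac_concat ab bc).
    by apply: eq_ac (ac x) => t /andP[_ tb]; rewrite gr.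
  by apply: eq_ac (ac' x) => t /andP[tb _]; rewrite gl.
- move=> x; rewrite (_ : (fun t => splice b psi psi' t x) = (fun t => if t <= b then psi t x else psi' t x)); last first.
    by apply/funext => t; rewrite /splice; case: ifP.
  apply: measurable_fun_if.
  + exact: measurable_itv.
  + apply: measurable_fun_ler; [exact: measurable_id|exact: measurable_cst].
  + apply: measurable_funS (mea x); first exact: measurable_itv.
    by move=> t [/=]; rewrite !in_itv/= => /andP[-> _] ->.
  + apply: measurable_funS (mea' x); first exact: measurable_itv.
    by move=> t [/=]; rewrite !in_itv/= => /andP[_ ->]; case: leP => // /ltW->.
- apply: ae_imply2 (ae_imply2 (fun t => @conj _ _) dr dr') (ae_neq b) => t [d1 d2] tb /andP[ta tc] x.
  have [bt|tlb|tE] := ltgtP t b; last by rewrite tE eqxx in tb.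
    have -> : splice b rho rho' t = rho t by rewrite /splice (ltW bt).
    have -> : splice b psi psi' t = psi t by rewrite /splice (ltW bt).
    apply: (near_is_derive (f := rho^~ x)); last by apply: d1; rewrite ta.
    near=> s; rewrite /splice ifT//; apply/ltW; near: s; exact: lt_nbhsl.
  have -> : splice b rho rho' t = rho' t by rewrite /splice leNgt tlb.
  have -> : splice b psi psi' t = psi' t by rewrite /splice leNgt tlb.
  apply: (near_is_derive (f := rho'^~ x)); last by apply: d2; rewrite tlb.
  near=> s; rewrite /splice ifF//; apply/negbTE; rewrite -ltNge; near: s; exact: lt_nbhsr.
Unshelve. all: by end_near. Qed.

Lemma energy_splice a b c rho psi rho' psi' : a <= b -> b <= c ->
  plan_on a b rho psi -> plan_on b c rho' psi' -> rho b = rho' b ->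
  energy a c (splice b rho rho') (splice b psi psi') =
  (energy a b rho psi + energy b c rho' psi')%E.
Proof.
move=> ab bc P P' E; rewrite (energyD ab bc (plan_on_concat ab bc P P' E)).
have -> : energy a b (splice b rho rho') (splice b psi psi') = energy a b rho psi.
  by apply: eq_integral => t; rewrite inE/= in_itv/= => /andP[_ tb]; rewrite /splice tb.
suff -> : energy b c (splice b rho rho') (splice b psi psi') = energy b c rho' psi' by [].
have mk := plan_kinetic_measurable P'.
have mk1 := plan_kinetic_measurable (plan_on_sub ab (lexx c) (plan_on_concat ab bc P P' E)).
have subm (f : R -> R) : measurable_fun (`[b, c] : set (measurableTypeR R)) f ->
    measurable_fun (`]b, c]%classic : set (measurableTypeR R)) (EFin \o f).
  move=> mf; apply/measurable_EFinP; apply: measurable_funS mf => //.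
  exact: subset_itv_oc_cc.
refine (etrans (esym (integral_itv_obnd_cbnd (subm _ mk1))) (etrans _ (integral_itv_obnd_cbnd (subm _ mk)))).
apply: eq_integral => t; rewrite inE/= in_itv/= => /andP[tb _].
by rewrite /splice leNgt tb.
Qed.

End plans.

Lemma is_derive_linear_sum (R : realType) (I : finType) (k d : I -> R) (f : I -> R -> R) (t : R) :
  (forall i, is_derive t 1 (f i) (d i)) ->
  is_derive t 1 (fun s => \sum_i k i * f i s) (\sum_i k i * d i).
Proof.
move=> H; elim: (index_enum I) => [|i r IH].
  rewrite (_ : (fun s => _) = cst (0 : R)) ?big_nil; first exact: is_derive_cst.
  by apply/funext => s; rewrite big_nil.
rewrite (_ : (fun s => _) = (k i \*: f i) + (fun s => \sum_(j <- r) k j * f j s)).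
  rewrite big_cons; exact: (is_deriveD (is_deriveZ (k i) (H i)) IH).
by apply/funext => s; rewrite big_cons.
Qed.

(** * Costs of plans, the triangle inequality, and linear functionals along plans *)

Section cost.
Variables (R : realType) (X : finType) (Q : X -> X -> R) (pi : X -> R).
Hypothesis HQ : reversible_chain Q pi.
Local Notation mu := (@lebesgue_measure R).
Local Notation plan_on := (plan_on Q pi).
Local Notation energy := (energy Q pi).
Local Notation kinetic := (kinetic Q pi).
Implicit Types (A B : R) (u v w : X -> R) (rho psi : R -> X -> R).

(** An actual plan witnessing that the squared distance is at most [A]. As the infimum need not be
    attained, [W_leP] asks for a witness at every [q] larger than the bound. *)
Definition cost_le u v A : Prop := exists rho psi,
  [/\ plan_on 0 1 rho psi, rho 0 = u, rho 1 = v & (energy 0 1 rho psi <= A%:E)%E].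

Lemma transport_planP u v rho psi :
  transport_plan Q pi u v rho psi <-> [/\ plan_on 0 1 rho psi, rho 0 = u & rho 1 = v].
Proof.
have driftE t x : drift Q (rho t) (psi t) x =
    - \sum_y (psi t y - psi t x) * rho_hat (rho t) x y * Q x y.
  rewrite /drift -sumrN; apply: eq_bigr => y _.
  by rewrite -!mulNr opprB.
split=> [[dens r0 r1 ac mea ce]|[[dens ac mea ce] r0 r1]].
- split=> //; split; [exact: dens|exact: ac|exact: mea|].
  + apply: ae_imply ce => t ce /andP[/ltW t0 /ltW t1] x.
    have [|df /eqP] := ce _ x; first by rewrite in_itv/= t0.
    by rewrite addr_eq0 driftE => /eqP dE; apply/is_derive1P.
- split; [exact: dens|exact: r0|exact: r1|exact: ac|exact: mea|].
  apply: (ae_imply2 _ ce (ae_imply2 (fun t => @conj _ _) (ae_neq 0) (ae_neq 1))).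
    move=> t {}ce [t0 t1]; rewrite in_itv/= => /andP[h0 h1] x.
    have [|df ->] := (is_derive1P _ _ _).1 (ce _ x).
      by rewrite !lt_neqAle eq_sym t0 t1 h0.
    by split=> //; rewrite driftE addNr.
Qed.

Lemma action_energy rho psi : plan_on 0 1 rho psi ->
  action Q pi rho psi = energy 0 1 rho psi.
Proof.
move=> P; have mk := plan_kinetic_measurable P.
pose f t := \sum_x \sum_y (psi t x - psi t y) ^+ 2 * rho_hat (rho t) x y * Q x y * pi x.
have fE t : f t = 2 * kinetic (rho t) (psi t) by rewrite /kinetic mulrA divff// mul1r.
have mf : measurable_fun (`[0, 1] : set (measurableTypeR R)) (EFin \o f).
  apply/measurable_EFinP.
  apply: (@eq_measurable_fun _ _ _ _ _ (fun t => 2 * kinetic (rho t) (psi t))); last first.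
    by apply: measurable_funM => //; exact: measurable_cst.
  by move=> t _; rewrite fE.
have f0 t : `[0, 1]%classic t -> (0 <= (EFin \o f) t)%E.
  by move=> _; rewrite lee_fin fE mulr_ge0//; exact: (kinetic_ge0 HQ).
have i2 : (0 <= (2^-1)%:E :> \bar R)%E by rewrite lee_fin invr_ge0.
refine (etrans (esym (@ge0_integralZl _ (measurableTypeR R) R mu _ (measurable_itv _) _ mf _ f0 i2)) _).
by apply: eq_integral => t _; rewrite -EFinM.
Qed.

Lemma sqrte_le_EFin (p : R) (x : \bar R) : 0 <= p -> (sqrte x <= p%:E)%E = (x <= (p ^+ 2)%:E)%E.
Proof.
move=> p0; rewrite -(@lee_sqrt _ x); last by rewrite lee_fin sqr_ge0.
by rewrite /= sqrtr_sqr ger0_norm.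
Qed.

Lemma W_leP u v (p : R) : 0 <= p ->
  (W Q pi u v <= p%:E)%E <-> forall q, p < q -> cost_le u v (q ^+ 2).
Proof.
move=> p0; split=> [Wp q pq|H].
  have q0 : 0 <= q by rewrite ltW// (le_lt_trans p0).
  move: Wp; rewrite /W sqrte_le_EFin// => /le_lt_trans/(_ (_ : _ < (q ^+ 2)%:E)%E).
  have pq2 : ((p ^+ 2)%:E < (q ^+ 2)%:E)%E by rewrite lte_fin ltr_pXn2r.
  move=> /(_ pq2)/ereal_inf_lt[_ [rho [psi [/transport_planP[P r0 r1] ->]]]].
  by rewrite action_energy// => /ltW eq; exists rho, psi.
apply/lee_addgt0Pr => e e0; have pe0 : 0 <= p + e by rewrite addr_ge0// ltW.
rewrite -EFinD /W sqrte_le_EFin//.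
have [|rho [psi [P r0 r1 E]]] := H (p + e); first by rewrite ltrDl.
apply: le_trans E; apply: ereal_inf_lbound; exists rho, psi; rewrite action_energy//.
by split=> //; apply/transport_planP.
Qed.

Lemma W_ge0 u v : (0 <= W Q pi u v)%E.
Proof. exact: sqrte_ge0. Qed.

Lemma cost_le_mono u v A B : A <= B -> cost_le u v A -> cost_le u v B.
Proof.
move=> AB [rho [psi [P r0 r1 E]]]; exists rho, psi; split=> //.
by apply: le_trans E _; rewrite lee_fin.
Qed.

Lemma plan_cost_le a b rho psi A : a < b -> plan_on a b rho psi ->
  (energy a b rho psi <= A%:E)%E -> cost_le (rho a) (rho b) ((b - a) * A).
Proof.
move=> ab P E; have c0 : 0 < b - a by rewrite subr_gt0.
have pre : (fun t => (b - a) * t + a) @^-1` `[a, b] = `[0, 1]%classic.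
  by rewrite -(@preimage_affine_itv R (b - a) a 0 1 c0) mulr0 mulr1 add0r subrK.
have cn0 : b - a != 0 by rewrite gt_eqF.
exists (fun t => rho ((b - a) * t + a)), (fun t x => (b - a) * psi ((b - a) * t + a) x).
split; [exact: plan_on_affine pre P|by rewrite mulr0 add0r|by rewrite mulr1 subrK|].
by rewrite (energy_affine HQ cn0 pre P) gtr0_norm// EFinM lee_pmul2l.
Qed.

Lemma cost_le_sym u v A : cost_le u v A -> cost_le v u A.
Proof.
move=> [rho [psi [P r0 r1 E]]].
have n1 : (-1 : R) != 0 by rewrite oppr_eq0 oner_eq0.
have pre : (fun t : R => -1 * t + 1) @^-1` `[0, 1] = `[0, 1]%classic.
  by rewrite -[RHS](@preimage_affine_itvN R (-1) 1 0 1)// mulr0 add0r mulN1r addNr.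
exists (fun t => rho (-1 * t + 1)), (fun t x => -1 * psi (-1 * t + 1) x).
split; [exact: plan_on_affine pre P|by rewrite mulr0 add0r|by rewrite mulr1 addNr|].
by rewrite (energy_affine HQ n1 pre P) normrN1 mul1e.
Qed.

(** The two plans are run one after the other during times [p] and [q]. Their energies become at
    most [p] and [q], and returning to unit time multiplies the sum by [p + q]. *)
Lemma cost_le_triangle u v w (p q : R) : 0 < p -> 0 < q ->
  cost_le u v (p ^+ 2) -> cost_le v w (q ^+ 2) -> cost_le u w ((p + q) ^+ 2).
Proof.
move=> p0 q0 [rho [psi [P r0 r1 E]]] [rho' [psi' [P' r0' r1' E']]].
have c0 : 0 < p^-1 by rewrite invr_gt0.
have c0' : 0 < q^-1 by rewrite invr_gt0.
have cn0 : p^-1 != 0 by rewrite gt_eqF.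
have cn0' : q^-1 != 0 by rewrite gt_eqF.
have pn0 : p != 0 by rewrite gt_eqF.
have qn0 : q != 0 by rewrite gt_eqF.
have pre : (fun t : R => p^-1 * t + 0) @^-1` `[0, 1] = `[0, p]%classic.
  by rewrite -[RHS](@preimage_affine_itv R p^-1 0 0 p)// mulr0 addr0 mulVf// addr0.
have hE' : q^-1 * p + - p / q = 0 by field.
have hE'' : q^-1 * (p + q) + - p / q = 1 by field.
have pre' : (fun t : R => q^-1 * t + (- p / q)) @^-1` `[0, 1] = `[p, p + q]%classic.
  by rewrite -[RHS](@preimage_affine_itv R q^-1 (- p / q) p (p + q))// hE' hE''.
have P1 := plan_on_affine cn0 pre P.
have P2 := plan_on_affine cn0' pre' P'.
have E1 := energy_affine HQ cn0 pre P.
have E2 := energy_affine HQ cn0' pre' P'.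
have pp : p <= p + q by rewrite lerDl ltW.
have hE : p^-1 * p + 0 = 1 by rewrite mulVf// addr0.
have hE0 : p^-1 * 0 + 0 = 0 by rewrite mulr0 addr0.
have gl : rho (p^-1 * p + 0) = rho' (q^-1 * p + - p / q) by rewrite hE hE' r1 r0'.
have := plan_cost_le _ (plan_on_concat (ltW p0) pp P1 P2 gl) (A := p + q).
rewrite subr0 -expr2 addr_gt0// => /(_ isT).
rewrite (spliceL _ _ (ltW p0)) (spliceR _ _ (_ : p < p + q)) ?ltrDl// hE0 r0 hE'' r1'; apply.
rewrite (energy_splice HQ (ltW p0) pp P1 P2 gl) E1 E2 EFinD.
apply: leeD.
  rewrite gtr0_norm// (_ : p%:E = p^-1%:E * (p ^+ 2)%:E)%E; last by rewrite -EFinM; congr EFin; field.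
  by rewrite lee_pmul2l.
rewrite gtr0_norm// (_ : q%:E = q^-1%:E * (q ^+ 2)%:E)%E; last by rewrite -EFinM; congr EFin; field.
by rewrite lee_pmul2l.
Qed.

Lemma W_sym u v : W Q pi u v = W Q pi v u.
Proof.
suff H x y : (W Q pi x y <= W Q pi y x)%E by apply/eqP; rewrite eq_le !H.
have := W_ge0 y x; case E : (W Q pi y x) => [d| |]; rewrite ?leey//.
rewrite lee_fin => d0; apply/W_leP => // q dq; apply: cost_le_sym.
have /(W_leP _ _ d0) H : (W Q pi y x <= d%:E)%E by rewrite E.
exact: H.
Qed.

Lemma W_triangle u v w : (W Q pi u w <= W Q pi u v + W Q pi v w)%E.
Proof.
have := W_ge0 u v; have := W_ge0 v w.
case E : (W Q pi u v) => [p| |]; case E' : (W Q pi v w) => [q| |]; rewrite ?leey// !lee_fin => q0 p0.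
rewrite -EFinD; apply/W_leP; first by rewrite addr_ge0.
move=> r pqr; pose e := (r - (p + q)) / 2.
have e0 : 0 < e by rewrite divr_gt0// subr_gt0.
rewrite (_ : r = (p + e) + (q + e)); last by rewrite /e; field.
apply: (@cost_le_triangle u v w); rewrite ?ltr_wpDl//.
  have /(W_leP _ _ p0) H : (W Q pi u v <= p%:E)%E by rewrite E.
  by apply: H; rewrite ltrDl.
have /(W_leP _ _ q0) H : (W Q pi v w <= q%:E)%E by rewrite E'.
by apply: H; rewrite ltrDl.
Qed.

Lemma rho_hatC (u : X -> R) x y : density pi u -> rho_hat u x y = rho_hat u y x.
Proof. by move=> [u0 _]; exact: log_meanC. Qed.

Lemma drift_test u f g : density pi u ->
  \sum_x pi x * f x * drift Q u g x =
  2^-1 * \sum_x \sum_y (f x - f y) * (g x - g y) * rho_hat u x y * Q x y * pi x.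
Proof.
move=> du; pose S := \sum_x pi x * f x * drift Q u g x.
have S1 : S = \sum_x \sum_y f x * (g x - g y) * rho_hat u x y * Q x y * pi x.
  apply: eq_bigr => x _; rewrite /drift mulr_sumr; apply: eq_bigr => y _.
  by ring.
have S2 : S = \sum_x \sum_y (- f y) * (g x - g y) * rho_hat u x y * Q x y * pi x.
  rewrite S1 exchange_big; apply: eq_bigr => x _; apply: eq_bigr => y _.
  rewrite (rho_hatC y x du) -(mulrA _ (Q y x)) (detailed_balance HQ y x); ring.
rewrite -/S (_ : S = 2^-1 * (S + S)); last by field.
congr (_ * _); rewrite {1}S1 S2 -big_split; apply: eq_bigr => x _.
by rewrite -big_split; apply: eq_bigr => y _ /=; ring.
Qed.

(* Young's inequality replaces the Cauchy-Schwarz inequality in time. *)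
Lemma drift_test_le u f g (l : R) : density pi u -> 0 < l ->
  \sum_x pi x * f x * drift Q u g x <= (l * kinetic u f + kinetic u g / l) / 2.
Proof.
move=> du l0; rewrite drift_test// /kinetic.
rewrite mulrCA -mulrA -mulrDr -mulrA ler_pM2l ?invr_gt0//.
rewrite mulr_sumr mulr_suml -big_split mulr_suml; apply: ler_sum => x _ /=.
rewrite mulr_sumr mulr_suml -big_split mulr_suml; apply: ler_sum => y _ /=.
have w0 : 0 <= rho_hat u x y * Q x y * pi x.
  exact: (mulr_ge0 (mulr_ge0 (log_mean_ge0 _ _) (rates_ge0 HQ x y)) (ltW (Defs.pi_gt0 HQ x))).
set a := f x - f y; set b := g x - g y.
rewrite (_ : _ / 2 = (l * a ^+ 2 + b ^+ 2 / l) / 2 * (rho_hat u x y * Q x y * pi x)); last by field; rewrite gt_eqF.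
rewrite (_ : a * b * _ * _ * _ = a * b * (rho_hat u x y * Q x y * pi x)); last by rewrite !mulrA.
rewrite ler_wpM2r// -subr_ge0.
rewrite (_ : _ - _ = (l * a - b) ^+ 2 / (2 * l)); last by field; rewrite gt_eqF.
by rewrite divr_ge0 ?sqr_ge0// mulr_ge0// ltW.
Qed.

(** The basic estimate on linear functionals along plans. The Young parameter [l] is left to the
    caller; the best choice would turn the bound into the square root of [G * (b - a) * E]. *)
Lemma plan_test a b rho psi f (G l E : R) : a <= b -> plan_on a b rho psi ->
  (forall t, a <= t <= b -> kinetic (rho t) f <= G) -> 0 < l ->
  (energy a b rho psi <= E%:E)%E ->
  \sum_x pi x * f x * (rho b x - rho a x) <= (l * G * (b - a) + E / l) / 2.
Proof.
move=> ab P fG l0 Ele.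
pose F t := \sum_x (pi x * f x) * rho t x.
pose g t := (l * G + kinetic (rho t) (psi t) / l) / 2.
have mk := plan_kinetic_measurable P.
have G0 : 0 <= G by apply: le_trans (fG a _); rewrite ?lexx//; exact: (kinetic_ge0 HQ).
have mkl : measurable_fun (`[a, b] : set (measurableTypeR R)) (fun t => (2 * l)^-1 * kinetic (rho t) (psi t)).
  by apply: measurable_funM => //; exact: measurable_cst.
have gE t : g t = l * G / 2 + (2 * l)^-1 * kinetic (rho t) (psi t).
  by rewrite /g; field; rewrite gt_eqF.
have : ((F b - F a)%:E <= \int[mu]_(t in `[a, b]) (g t)%:E)%E.
  apply: ac_le_integral => //.
  - exact: ac_sum (plan_on_ac P).
  - apply: (@eq_measurable_fun _ _ _ _ _ (fun t => l * G / 2 + (2 * l)^-1 * kinetic (rho t) (psi t))).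
      by move=> t _; rewrite gE.
    by apply: measurable_funD => //; exact: measurable_cst.
  - move=> t _; rewrite gE addr_ge0//; first by rewrite divr_ge0// mulr_ge0// ltW.
    apply: mulr_ge0; last exact: (kinetic_ge0 HQ).
    by rewrite invr_ge0 mulr_ge0// ltW.
  - apply: ae_imply (plan_on_drift P) => t dr; rewrite in_itv/= => tab.
    have tab' : a <= t <= b by case/andP: tab => /ltW-> /ltW->.
    have dF : is_derive t 1 F (\sum_x (pi x * f x) * drift Q (rho t) (psi t) x).
      by apply: is_derive_linear_sum => x; exact: dr.
    have [? ->] := (is_derive1P _ _ _).1 dF; split=> //.
    apply: (le_trans (drift_test_le _ _ _ l0)); first exact: plan_on_density P _ tab'.
    rewrite /g ler_pM2r ?invr_gt0// lerD2r ler_pM2l//.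
    exact: fG.
rewrite (_ : \sum_x _ = F b - F a); last first.
  by rewrite /F -sumrB; apply: eq_bigr => x _; rewrite mulrBr.
rewrite -lee_fin => /le_trans; apply.
rewrite (eq_integral (fun t : measurableTypeR R => (l * G / 2)%:E + (2 * l)^-1%:E * (kinetic (rho t) (psi t))%:E)%E); last first.
  by move=> t _; rewrite gE EFinD EFinM.
have c0 : 0 <= l * G / 2 by rewrite divr_ge0// mulr_ge0// ltW.
have l20 : 0 <= (2 * l)^-1 by rewrite invr_ge0 mulr_ge0// ltW.
have k0 t : `[a, b]%classic t -> (0 <= (kinetic (rho t) (psi t))%:E)%E.
  by move=> _; rewrite lee_fin; exact: (kinetic_ge0 HQ).
have mkE : measurable_fun (`[a, b] : set (measurableTypeR R)) (fun t => (kinetic (rho t) (psi t))%:E).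
  exact/measurable_EFinP.
rewrite (@ge0_integralD _ (measurableTypeR R) R mu _ (measurable_itv _) (cst (l * G / 2)%:E)); first last.
- by apply/measurable_EFinP.
- by move=> t ht; apply: mule_ge0; [rewrite lee_fin|exact: k0].
- exact: measurable_cst.
- by move=> t _; rewrite lee_fin.
rewrite integral_cst; last exact: measurable_itv.
rewrite (@ge0_integralZl _ (measurableTypeR R) R mu _ (measurable_itv _) _ mkE _ k0) ?lee_fin//.
rewrite (_ : (l * G * (b - a) + E / l) / 2 = l * G / 2 * (b - a) + (2 * l)^-1 * E); last by field; rewrite gt_eqF.
rewrite EFinD; apply: leeD.
  rewrite [X in (_ * X)%E]lebesgue_measure_itv/= lte_fin; case: ltP => [_|ba]; first by rewrite -EFinB -EFinM.
  by rewrite mule0 lee_fin mulr_ge0// subr_ge0.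
by rewrite EFinM lee_wpmul2l// lee_fin.
Qed.

End cost.

(** * The weighted Laplacian *)

(** The inverse is [f] times the power -1 of the nonnegative function [f ^+ 2]. Where [f] vanishes
    both sides are 0 by convention. *)
Lemma measurable_fun_inv d (T : measurableType d) (R : realType) (D : set T) (f : T -> R) :
  measurable D -> measurable_fun D f -> measurable_fun D (fun x => (f x)^-1).
Proof.
move=> mD mf; apply: (@eq_measurable_fun _ _ _ _ _ (fun x => f x * (f x ^+ 2) `^ (-1))).
  move=> x _; rewrite powR_inv1 ?sqr_ge0//.
  have [->|fx0] := eqVneq (f x) 0; first by rewrite mul0r invr0.
  by rewrite expr2 invfM mulrA divff// mul1r.
apply: measurable_funM => //; apply: measurable_fun_powR => //.
exact: measurable_funX.
Qed.

Lemma measurable_fun_det d (T : measurableType d) (R : realType) (D : set T) n (M : T -> 'M[R]_n) :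
  measurable D -> (forall i j, measurable_fun D (fun t => M t i j)) ->
  measurable_fun D (fun t => \det (M t)).
Proof.
move=> mD mM; rewrite /determinant; apply: measurable_sum => s.
apply: measurable_funM; first exact: measurable_cst.
by apply: measurable_prod => i _; exact: mM.
Qed.

Lemma measurable_fun_adj d (T : measurableType d) (R : realType) (D : set T) n (M : T -> 'M[R]_n) i j :
  measurable D -> (forall i j, measurable_fun D (fun t => M t i j)) ->
  measurable_fun D (fun t => (\adj (M t)) i j).
Proof.
move=> mD mM; apply: (@eq_measurable_fun _ _ _ _ _ (fun t => (-1) ^+ (j + i) * \det (row' j (col' i (M t))))).
  by move=> t _; rewrite mxE.
apply: measurable_funM; first exact: measurable_cst.
apply: measurable_fun_det => // k l.
by under eq_fun do rewrite !mxE; exact: mM.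
Qed.

Section laplacian.
Variables (R : realType) (X : finType) (Q : X -> X -> R) (pi : X -> R).
Hypothesis HQ : reversible_chain Q pi.
Local Notation mu := (@lebesgue_measure R).
Local Notation kinetic := (kinetic Q pi).
Local Notation drift := (drift Q).
Implicit Types (u f g p : X -> R) (V : X -> X -> R).

Lemma eq_drift u p q x : p =1 q -> drift u p x = drift u q x.
Proof. by move=> pq; apply: eq_bigr => y _; rewrite !pq. Qed.

Lemma kinetic_drift u p : density pi u -> \sum_x pi x * p x * drift u p x = kinetic u p.
Proof.
move=> du; rewrite (drift_test HQ)//; by [].
Qed.

Lemma sum_drift u p : density pi u -> \sum_x pi x * drift u p x = 0.
Proof.
move=> du; have := drift_test HQ (fun=> 1) p du.
under eq_bigr do rewrite mulr1.
move=> ->; rewrite big1 ?mulr0// => x _; rewrite big1// => y _.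
by rewrite subrr !mul0r.
Qed.

Lemma rho_hat_gt0 u x y : (forall x, 0 < u x) -> 0 < rho_hat u x y.
Proof.
move=> u0; have m0 : 0 < Num.min (u x) (u y) by rewrite lt_min !u0.
apply: lt_le_trans m0 _; apply: log_mean_ge; rewrite ?ge_min ?lexx ?orbT//.
by rewrite le_min !ltW.
Qed.

Lemma kinetic_eq0 u p : (forall x, 0 < u x) -> kinetic u p = 0 -> forall x y, p x = p y.
Proof.
move=> u0 k0.
have term0 x y : 0 <= (p x - p y) ^+ 2 * rho_hat u x y * Q x y * pi x.
  exact: (mulr_ge0 (mulr_ge0 (mulr_ge0 (sqr_ge0 _) (log_mean_ge0 _ _)) (rates_ge0 HQ x y)) (ltW (Defs.pi_gt0 HQ x))).
have edge x y : 0 < Q x y -> p x = p y.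
  move=> Qxy; move: k0 => /eqP; rewrite /kinetic mulf_eq0 invr_eq0 pnatr_eq0/=.
  rewrite psumr_eq0; last by move=> ? _; exact: sumr_ge0.
  move=> /allP/(_ x (mem_index_enum _))/=.
  rewrite psumr_eq0// => /allP/(_ y (mem_index_enum _))/=.
  rewrite !mulf_eq0 (gt_eqF Qxy) (gt_eqF (Defs.pi_gt0 HQ x)) (gt_eqF (rho_hat_gt0 x y u0)) !orbF.
  by rewrite orbb subr_eq0 => /eqP.
move=> x y; have /connectP[s ps ->] := irreducible HQ x y.
elim: s x ps => //= z s IH x /andP[xz ps].
by rewrite (edge _ _ xz); exact: IH.
Qed.

(* The rank-one term makes the weighted Laplacian invertible. *)
Definition lap u p x := pi x * drift u p x + pi x * \sum_z pi z * p z.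

(** Pairing with [p] gives the kinetic energy plus the squared mean. The first vanishes only for
    constants, by irreducibility, and the second then makes the constant 0. *)
Lemma lap_inj u p : density pi u -> (forall x, 0 < u x) ->
  (forall x, lap u p x = 0) -> forall x, p x = 0.
Proof.
move=> du u0 lap0.
have : \sum_x p x * lap u p x = 0 by rewrite big1// => x _; rewrite lap0 mulr0.
rewrite (_ : \sum_x _ = kinetic u p + (\sum_z pi z * p z) ^+ 2); last first.
  rewrite -kinetic_drift// expr2 mulr_suml -big_split; apply: eq_bigr => x _ /=.
  by rewrite /lap; ring.
move=> /eqP; rewrite paddr_eq0 ?sqr_ge0 ?(kinetic_ge0 HQ)// => /andP[/eqP k0].
rewrite sqrf_eq0 => /eqP m0 x.
have pc := kinetic_eq0 u0 k0.
by rewrite -[LHS]mul1r -(pi_sum1 HQ) mulr_suml -[RHS]m0; apply: eq_bigr => z _; rewrite (pc x z).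
Qed.

Definition lap_mx u : 'M[R]_#|X| :=
  \matrix_(i, j) lap u (fun z => (z == enum_val i)%:R) (enum_val j).

Lemma lap_linear u (v : 'rV[R]_#|X|) x :
  (v *m lap_mx u) 0 (enum_rank x) = lap u (fun z => v 0 (enum_rank z)) x.
Proof.
rewrite mxE.
have pE z : v 0 (enum_rank z) = \sum_(i < #|X|) v 0 i * (z == enum_val i)%:R.
  rewrite (bigD1 (enum_rank z))//= enum_rankK eqxx mulr1 big1 ?addr0// => i iz.
  by rewrite -(inj_eq enum_rank_inj) enum_valK eq_sym (negPf iz) mulr0.
under eq_bigr do rewrite mxE enum_rankK /lap.
rewrite /lap.
have -> : drift u (fun z => v 0 (enum_rank z)) x =
    \sum_(i < #|X|) v 0 i * drift u (fun z => (z == enum_val i)%:R) x.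
  rewrite /drift; under [RHS]eq_bigr do rewrite mulr_sumr.
  rewrite exchange_big; apply: eq_bigr => y _ /=; rewrite (pE x) (pE y) -sumrB !mulr_suml.
  by apply: eq_bigr => i _; ring.
have -> : \sum_z pi z * v 0 (enum_rank z) =
    \sum_(i < #|X|) v 0 i * \sum_z pi z * (z == enum_val i)%:R.
  under [RHS]eq_bigr do rewrite mulr_sumr.
  rewrite exchange_big; apply: eq_bigr => z _ /=; rewrite (pE z) mulr_sumr.
  by apply: eq_bigr => i _; ring.
by rewrite !mulr_sumr -big_split; apply: eq_bigr => i _ /=; ring.
Qed.

Lemma lap_mx_unit u : density pi u -> (forall x, 0 < u x) -> lap_mx u \in unitmx.
Proof.
move=> du u0; rewrite -row_free_unit; apply: inj_row_free => v vM0.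
apply/rowP => i; rewrite mxE -(enum_valK i).
apply: (@lap_inj u (fun z => v 0 (enum_rank z)) du u0) => x.
by rewrite -lap_linear vM0 mxE.
Qed.

(* The determinant and the adjugate keep the solution measurable in the parameters. *)
Definition potential u g (x : X) : R :=
  (\det (lap_mx u))^-1 *
  \sum_j pi (enum_val j) * g (enum_val j) * (\adj (lap_mx u)) j (enum_rank x).

Lemma potentialP u g : density pi u -> (forall x, 0 < u x) -> \sum_x pi x * g x = 0 ->
  forall x, drift u (potential u g) x = g x.
Proof.
move=> du u0 g0.
pose b : 'rV[R]_#|X| := \row_j (pi (enum_val j) * g (enum_val j)).
have Mu := lap_mx_unit du u0.
pose v := b *m invmx (lap_mx u).
have vE x : v 0 (enum_rank x) = potential u g x.
  rewrite /v /invmx Mu -scalemxAr mxE /potential; congr (_ * _).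
  by rewrite mxE; apply: eq_bigr => j _; rewrite mxE.
have lapE x : lap u (potential u g) x = pi x * g x.
  have <- : (v *m lap_mx u) 0 (enum_rank x) = pi x * g x.
    by rewrite /v mulmxKV// mxE enum_rankK.
  rewrite lap_linear /lap; congr (_ + _); last first.
    by congr (_ * _); apply: eq_bigr => z _; rewrite vE.
  by congr (_ * _); apply: eq_drift => z; rewrite vE.
set S := \sum_z pi z * potential u g z.
(* Summing the equation over [x] removes the drift, and the right-hand side has mean zero; so the
   rank-one term vanishes and a genuine Poisson equation remains. *)
have S0 : S = 0.
  have : \sum_x lap u (potential u g) x = 0 by under eq_bigr do rewrite lapE.
  rewrite /lap big_split/= sum_drift// add0r -mulr_suml (pi_sum1 HQ) mul1r.
  by [].
move=> x; have := lapE x; rewrite /lap -/S S0 mulr0 addr0.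
by apply: mulfI; rewrite gt_eqF// (Defs.pi_gt0 HQ).
Qed.

(** The action in terms of the flux [V] in place of a potential; at positive [u], taking
    [V x y = (p x - p y) * rho_hat u x y] gives back [kinetic u p]. In this form it is jointly
    convex. *)
Definition flux_energy u V : R :=
  2^-1 * \sum_x \sum_y V x y ^+ 2 / rho_hat u x y * Q x y * pi x.

(* Among the fluxes with a given divergence, the gradient flux has least energy. *)
Lemma potential_kinetic_le u V : density pi u -> (forall x, 0 < u x) ->
  (forall x y, V x y = - V y x) ->
  let g x := \sum_y V x y * Q x y in
  kinetic u (potential u g) <= flux_energy u V /\
  forall x, drift u (potential u g) x = g x.
Proof.
move=> du u0 Vanti g.
have test f : \sum_x pi x * f x * g x = 2^-1 * \sum_x \sum_y (f x - f y) * V x y * Q x y * pi x.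
  pose S := \sum_x pi x * f x * g x.
  have S1 : S = \sum_x \sum_y f x * V x y * Q x y * pi x.
    by apply: eq_bigr => x _; rewrite mulr_sumr; apply: eq_bigr => y _; ring.
  have S2 : S = \sum_x \sum_y (- f y) * V x y * Q x y * pi x.
    rewrite S1 exchange_big; apply: eq_bigr => x _; apply: eq_bigr => y _.
    by rewrite Vanti -(mulrA _ (Q y x)) (detailed_balance HQ y x); ring.
  rewrite -/S (_ : S = 2^-1 * (S + S)); last by field.
  congr (_ * _); rewrite {1}S1 S2 -big_split; apply: eq_bigr => x _.
  by rewrite -big_split; apply: eq_bigr => y _ /=; ring.
have g0 : \sum_x pi x * g x = 0.
  have := test (fun=> 1); under eq_bigr do rewrite mulr1.
  move=> ->; rewrite big1 ?mulr0// => x _; rewrite big1// => y _.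
  by rewrite subrr !mul0r.
have dE := potentialP du u0 g0; split=> //.
set p := potential u g.
(* Testing the equation against [p] writes the kinetic energy as the pairing of [V] with the
   gradient of [p]; Young's inequality on each edge then concludes. *)
suff : 2 * kinetic u p <= kinetic u p + flux_energy u V by rewrite mulrDl mul1r lerD2l.
rewrite -{1}kinetic_drift//; under eq_bigr do rewrite dE.
rewrite test mulrA divff// mul1r /kinetic /flux_energy -mulrDr -big_split mulr_sumr.
apply: ler_sum => x _; rewrite -big_split mulr_sumr; apply: ler_sum => y _ /=.
have w0 : 0 <= Q x y * pi x by rewrite mulr_ge0 ?(rates_ge0 HQ)// ltW// (Defs.pi_gt0 HQ).
have r0 := rho_hat_gt0 x y u0.
rewrite -subr_ge0 (_ : _ - _ = ((p x - p y) * rho_hat u x y - V x y) ^+ 2 / rho_hat u x y * (Q x y * pi x) / 2); last first.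
  by field; rewrite gt_eqF.
by rewrite divr_ge0// mulr_ge0// divr_ge0 ?sqr_ge0// ltW.
Qed.

Lemma lap_measurable (D : set (measurableTypeR R)) (rho psi : R -> X -> R) x : measurable D ->
  (forall x, measurable_fun D (rho^~ x)) -> (forall x, measurable_fun D (psi^~ x)) ->
  measurable_fun D (fun t => lap (rho t) (psi t) x).
Proof.
move=> mD mr mp; apply: measurable_funD; apply: measurable_funM; try exact: measurable_cst.
  apply: measurable_sum => y; apply: measurable_funM; last exact: measurable_cst.
  apply: measurable_funM; first exact: measurable_funB.
  exact: measurable_log_mean.
by apply: measurable_sum => y; apply: measurable_funM => //; exact: measurable_cst.
Qed.

Lemma potential_measurable (D : set (measurableTypeR R)) (rho g : R -> X -> R) x : measurable D ->
  (forall x, measurable_fun D (rho^~ x)) -> (forall x, measurable_fun D (g^~ x)) ->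
  measurable_fun D (fun t => potential (rho t) (g t) x).
Proof.
move=> mD mr mg.
have mM i j : measurable_fun D (fun t => lap_mx (rho t) i j).
  under eq_fun do rewrite mxE.
  by apply: (@lap_measurable _ _ (fun _ z => (z == enum_val i)%:R)) => // z; exact: measurable_cst.
apply: measurable_funM.
  by apply: measurable_fun_inv => //; exact: measurable_fun_det.
apply: measurable_sum => j; apply: measurable_funM; last exact: measurable_fun_adj.
by apply: measurable_funM => //; exact: measurable_cst.
Qed.

Lemma flux_energy_ge0 u V : 0 <= flux_energy u V.
Proof.
rewrite mulr_ge0 ?invr_ge0//; apply: sumr_ge0 => x _; apply: sumr_ge0 => y _.
exact: (mulr_ge0 (mulr_ge0 (divr_ge0 (sqr_ge0 _) (log_mean_ge0 _ _)) (rates_ge0 HQ x y)) (ltW (Defs.pi_gt0 HQ x))).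
Qed.

Lemma flux_energy_measurable (D : set (measurableTypeR R)) (rho : R -> X -> R) (V : R -> X -> X -> R) :
  measurable D -> (forall x, measurable_fun D (rho^~ x)) ->
  (forall x y, measurable_fun D (fun t => V t x y)) ->
  measurable_fun D (fun t => flux_energy (rho t) (V t)).
Proof.
move=> mD mr mV; apply: measurable_funM; first exact: measurable_cst.
apply: measurable_sum => x; apply: measurable_sum => y.
apply: measurable_funM; last exact: measurable_cst.
apply: measurable_funM; last exact: measurable_cst.
apply: measurable_funM; first exact: measurable_funX.
apply: measurable_fun_inv => //; exact: measurable_log_mean.
Qed.

(** Curves built by linear operations come with an antisymmetric flux rather than a potential. At
    each interior time the flux is replaced by the gradient flux of equal divergence, which does not
    raise the energy. The endpoints may touch the boundary of the simplex. *)
Lemma momentum_cost_le (rho : R -> X -> R) (V : R -> X -> X -> R) (A : R) :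
  (forall t, 0 <= t <= 1 -> density pi (rho t)) ->
  (forall t, 0 < t < 1 -> forall x, 0 < rho t x) ->
  (forall x, absolutely_continuous (rho^~ x) 0 1) ->
  (forall x y, measurable_fun (`[0, 1] : set (measurableTypeR R)) (fun t => V t x y)) ->
  (forall t, 0 < t < 1 -> forall x y, V t x y = - V t y x) ->
  {ae mu, forall t : R, 0 < t < 1 -> forall x,
    is_derive t 1 (rho^~ x) (\sum_y V t x y * Q x y)} ->
  (\int[mu]_(t in `[0%R, 1%R]) (flux_energy (rho t) (V t))%:E <= A%:E)%E ->
  cost_le Q pi (rho 0) (rho 1) A.
Proof.
move=> dens pos ac mV Vanti ce EA.
have I01 : measurable (`[0, 1]%classic : set (measurableTypeR R)) by exact: measurable_itv.
have mr x : measurable_fun (`[0, 1] : set (measurableTypeR R)) (rho^~ x).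
  exact: ac_measurable.
pose g t x := \sum_y V t x y * Q x y.
have mg x : measurable_fun (`[0, 1] : set (measurableTypeR R)) (g^~ x).
  by apply: measurable_sum => y; apply: measurable_funM => //; exact: measurable_cst.
exists rho, (fun t => potential (rho t) (g t)).
have key t : 0 < t < 1 -> kinetic (rho t) (potential (rho t) (g t)) <= flux_energy (rho t) (V t) /\
    forall x, drift (rho t) (potential (rho t) (g t)) x = g t x.
  move=> t01; apply: potential_kinetic_le; [|exact: pos|exact: Vanti].
  by apply: dens; case/andP: t01 => /ltW-> /ltW->.
split=> //.
- split=> //.
  + by move=> x; apply: potential_measurable.
  + apply: ae_imply ce => t ce t01 x.
    by have [_ ->] := key _ t01; exact: ce.
- apply: le_trans EA; rewrite /energy.
  apply: (@ae_ge0_le_integral _ (measurableTypeR R) R mu) => //.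
  + by move=> t _; rewrite lee_fin; exact: (kinetic_ge0 HQ).
  + apply/measurable_EFinP; apply: kinetic_measurable => // x.
    exact: potential_measurable.
  + by move=> t _; rewrite lee_fin flux_energy_ge0.
  + by apply/measurable_EFinP; exact: flux_energy_measurable.
  + apply: ae_imply2 (ae_neq 0) (ae_neq 1) => t t0 t1; rewrite /= in_itv/= => /andP[h0 h1].
    by rewrite lee_fin; apply: (key _ _).1; rewrite !lt_neqAle eq_sym t0 t1 h0.
Qed.

End laplacian.

(** * Comparison of the distance with the Euclidean one *)

Lemma integral_unit_le (R : realType) (f : R -> R) (B : R) :
  measurable_fun (`[0, 1] : set (measurableTypeR R)) f ->
  (forall t, 0 <= t <= 1 -> 0 <= f t <= B) ->
  (\int[@lebesgue_measure R]_(t in `[0%R, 1%R]) (f t)%:E <= B%:E)%E.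
Proof.
move=> mf fB.
have -> : B%:E = (\int[@lebesgue_measure R]_(t in `[0%R, 1%R]) (cst B%:E t))%E.
  rewrite integral_cst; last exact: measurable_itv.
  by rewrite [X in (_ * X)%E]lebesgue_measure_itv/= lte_fin ltr01 oppr0 adde0 mule1.
apply: (@ge0_le_integral _ (measurableTypeR R)) => //.
- by move=> t /=; rewrite in_itv/= => /fB/andP[f0 _]; rewrite lee_fin.
- exact/measurable_EFinP.
- by move=> t /=; rewrite in_itv/= => /fB/andP[_ f0]; rewrite lee_fin.
Qed.

Lemma is_derive_quadratic (R : realType) (a b t : R) :
  is_derive t 1 (fun s => a + s ^+ 2 * b) (2 * t * b).
Proof.
rewrite (_ : (fun s => _) = cst a + b \*: ((@idfun R) ^+ 2)); last first.
  by apply/funext => s; rewrite [s ^+ 2 * b]mulrC.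
have h := is_deriveD (is_derive_cst a t (1 : R)) (is_deriveZ b (is_deriveX 2 (is_derive_id t (1 : R)))).
apply: (is_derive_eq h).
by rewrite add0r /GRing.scale /= mulr1 expr1; ring.
Qed.

Section interpolation.
Variables (R : realType) (X : finType) (Q : X -> X -> R) (pi : X -> R).
Hypothesis HQ : reversible_chain Q pi.
Local Notation kinetic := (kinetic Q pi).
Local Notation drift := (drift Q).
Local Notation cost_le := (cost_le Q pi).
Implicit Types (u v w f g p : X -> R) (V : X -> X -> R).

Lemma density1 : density pi (fun=> 1).
Proof.
by split=> [x|]; [exact: ler01|rewrite -[RHS](pi_sum1 HQ); apply: eq_bigr => x _; rewrite mul1r].
Qed.

Lemma density_sum u : density pi u -> \sum_x pi x * u x = 1.
Proof. by move=> [_ <-]; apply: eq_bigr => x _; rewrite mulrC. Qed.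

Lemma density_mix u v s : 0 <= s <= 1 -> density pi u -> density pi v ->
  density pi (fun x => (1 - s) * u x + s * v x).
Proof.
move=> /andP[s0 s1] [u0 u1] [v0 v1]; split.
  by move=> x; rewrite addr_ge0// mulr_ge0// subr_ge0.
under eq_bigr do rewrite mulrDl -!mulrA.
by rewrite big_split/= -!mulr_sumr u1 v1 !mulr1 subrK.
Qed.

(* The time change t^2 makes the action of the linear interpolation finite
   although it may start on the boundary of the simplex. *)
Lemma interpolation_cost : exists2 C, 0 < C & forall u v (N m : R),
  density pi u -> density pi v -> 0 < m -> (forall x, m <= v x) ->
  (forall x, `|u x - v x| <= N) -> cost_le u v (C * N ^+ 2 / m).
Proof.
pose one : X -> R := fun=> 1.
(* A crude bound, in the supremum norm, for the operator solving the Poisson equation at the uniform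
   density. *)
pose C1 := `|(\det (lap_mx Q pi one))^-1| *
  \sum_x \sum_j pi (enum_val j) * `|(\adj (lap_mx Q pi one)) j (enum_rank x)|.
have one0 x : 0 < one x by exact: ltr01.
have pot_le g N : (forall x, `|g x| <= N) -> forall x, `|potential Q pi one g x| <= C1 * N.
  move=> gN x; rewrite /potential normrM /C1 -mulrA ler_wpM2l//.
  apply: (le_trans (ler_norm_sum _ _ _)).
  rewrite mulr_suml (bigD1 x)//= -[leLHS]addr0; apply: lerD.
    rewrite mulr_suml; apply: ler_sum => j _.
    rewrite !normrM (gtr0_norm (Defs.pi_gt0 HQ _)) mulrAC ler_wpM2l//.
    by rewrite mulr_ge0// ltW// (Defs.pi_gt0 HQ).
  apply: sumr_ge0 => y _; apply: mulr_ge0; last exact: le_trans (normr_ge0 _) (gN y).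
  by apply: sumr_ge0 => j _; rewrite mulr_ge0// ltW// (Defs.pi_gt0 HQ).
pose S := \sum_x \sum_y Q x y * pi x.
have S0 : 0 <= S.
  apply: sumr_ge0 => x _; apply: sumr_ge0 => y _.
  by rewrite mulr_ge0 ?(rates_ge0 HQ)// ltW// (Defs.pi_gt0 HQ).
exists (8 * C1 ^+ 2 * S + 1).
  by rewrite ltr_wpDl// mulr_ge0// mulr_ge0// sqr_ge0.
move=> u v N m du dv m0 mv uvN.
(* At the uniform density all logarithmic means are 1, so the gradient of [p] itself is a flux with
   divergence [v - u], whatever the current density is. *)
pose p := potential Q pi one (fun x => v x - u x).
have g0 : \sum_x pi x * (v x - u x) = 0.
  by under eq_bigr do rewrite mulrBr; rewrite sumrB !density_sum// subrr.
have dp := potentialP HQ density1 one0 g0.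
have pN x : `|p x| <= C1 * N by apply: pot_le => y; rewrite distrC.
pose rho t x := u x + t ^+ 2 * (v x - u x).
pose V t x y := 2 * t * (p x - p y).
have rhoE t x : rho t x = (1 - t ^+ 2) * u x + t ^+ 2 * v x by rewrite /rho; ring.
have t2 (t : R) : 0 <= t <= 1 -> 0 <= t ^+ 2 <= 1.
  by move=> /andP[t0 t1]; rewrite sqr_ge0/= -(expr1n R 2) ler_pXn2r ?nnegrE.
have dens t : 0 <= t <= 1 -> density pi (rho t).
  move=> t01; rewrite (_ : rho t = fun x => (1 - t ^+ 2) * u x + t ^+ 2 * v x).
    by apply: density_mix => //; exact: t2.
  by apply/funext => x; rewrite rhoE.
have rho_lb t x : 0 <= t <= 1 -> t ^+ 2 * m <= rho t x.
  move=> /t2/andP[t0 t1]; rewrite rhoE -[leLHS]add0r lerD ?ler_wpM2l//.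
  by rewrite mulr_ge0 ?subr_ge0//; case: du.
have -> : u = rho 0 by apply/funext => x; rewrite /rho expr0n mul0r addr0.
have -> : v = rho 1 by apply/funext => x; rewrite /rho expr1n mul1r addrC subrK.
have ac x : absolutely_continuous (rho^~ x) 0 1.
  apply: (@lipschitz_ac _ _ _ _ (2 * `|v x - u x|)); first by rewrite mulr_ge0.
  move=> s t s0 st t1; rewrite /rho (_ : _ - _ = (t + s) * (v x - u x) * (t - s)); last by ring.
  rewrite !normrM [`|t - s|]ger0_norm ?subr_ge0// ler_wpM2r ?subr_ge0// ler_wpM2r//.
  by rewrite ger0_norm; lra.
have mV x y : measurable_fun (`[0, 1] : set (measurableTypeR R)) (fun t => V t x y).
  apply: measurable_funM; last exact: measurable_cst.
  by apply: measurable_funM; [exact: measurable_cst|exact: measurable_id].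
apply: (@momentum_cost_le _ _ _ _ HQ rho V) => //.
- move=> t /andP[t0 t1] x; apply: lt_le_trans (rho_lb t x _); last by rewrite !ltW.
  by rewrite mulr_gt0// exprn_gt0.
- by move=> t _ x y; rewrite /V; ring.
- apply: (ae_imply _ (ae_neq 0)) => t _ _ x.
  have -> : \sum_y V t x y * Q x y = 2 * t * (v x - u x).
    rewrite -(dp x) /drift mulr_sumr; apply: eq_bigr => y _.
    by rewrite /V /rho_hat log_mean_diag// mulr1 mulrA.
  exact: is_derive_quadratic.
- apply: integral_unit_le.
    by apply: flux_energy_measurable => // x; exact: ac_measurable.
  move=> t t01; rewrite (flux_energy_ge0 HQ)/= /flux_energy.
  have CN0 : 0 <= N ^+ 2 / m by rewrite divr_ge0 ?sqr_ge0// ltW.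
  rewrite -mulrA mulrDl mul1r -[leLHS]addr0 lerD// -mulrA.
  rewrite [leRHS](_ : _ = 2^-1 * (16 * C1 ^+ 2 * (N ^+ 2 / m) * S)); last by field; rewrite gt_eqF.
  rewrite ler_pM2l ?invr_gt0// /S mulr_sumr; apply: ler_sum => x _.
  rewrite mulr_sumr; apply: ler_sum => y _; rewrite -[leLHS]mulrA ler_wpM2r//.
    by rewrite mulr_ge0 ?(rates_ge0 HQ)// ltW// (Defs.pi_gt0 HQ).
  (* The factor [(2 * t) ^+ 2] of the squared flux cancels the lower bound [t ^+ 2 * m] of the mean.
     At [t = 0] the flux vanishes. *)
  have [->|tn0] := eqVneq t 0.
    by rewrite /V mulr0 mul0r expr0n mul0r mulr_ge0// mulr_ge0// sqr_ge0.
  have t20 : 0 < t ^+ 2 by rewrite exprn_even_gt0.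
  have th : t ^+ 2 * m <= rho_hat (rho t) x y.
    by apply: log_mean_ge; rewrite ?rho_lb// mulr_ge0// ltW.
  have th0 : 0 < rho_hat (rho t) x y by apply: lt_le_trans th; rewrite mulr_gt0.
  rewrite ler_pdivrMr//; apply: (@le_trans _ _ (16 * C1 ^+ 2 * (N ^+ 2 / m) * (t ^+ 2 * m))); last first.
    by rewrite ler_wpM2l// mulr_ge0// mulr_ge0// sqr_ge0.
  rewrite (_ : 16 * _ * _ * _ = (2 * t) ^+ 2 * (2 * (C1 * N)) ^+ 2); last by field; rewrite gt_eqF.
  rewrite /V exprMn ler_wpM2l ?sqr_ge0// -[leLHS]ger0_norm ?sqr_ge0// normrX.
  rewrite ler_pXn2r ?nnegrE//.
    by rewrite (le_trans (ler_normB _ _))// mulr_natl mulr2n lerD.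
  by rewrite mulr_ge0//; exact: le_trans (pN x).
Qed.

End interpolation.

Section distance.
Variables (R : realType) (X : finType) (Q : X -> X -> R) (pi : X -> R).
Hypothesis HQ : reversible_chain Q pi.
Local Notation mu := (@lebesgue_measure R).
Local Notation kinetic := (kinetic Q pi).
Local Notation cost_le := (cost_le Q pi).
Local Notation plan_on := (plan_on Q pi).
Local Notation energy := (energy Q pi).
Local Notation W := (W Q pi).
Implicit Types (u v w f : X -> R).

Let pi0 x : 0 < pi x. Proof. exact: (Defs.pi_gt0 HQ). Qed.

Definition density_bound : R := \sum_x (pi x)^-1.
Local Notation M := density_bound.

Lemma inv_pi_le x : (pi x)^-1 <= M.
Proof.
rewrite /M (bigD1 x)//= lerDl; apply: sumr_ge0 => y _.
by rewrite invr_ge0 ltW.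
Qed.

Lemma density_bound_ge0 : 0 <= M.
Proof. by apply: sumr_ge0 => x _; rewrite invr_ge0 ltW. Qed.

Lemma density_le u x : density pi u -> u x <= M.
Proof.
move=> [u0 u1]; apply: le_trans (inv_pi_le x).
rewrite -[leRHS]mul1r ler_pdivlMr// -u1 (bigD1 x)//= lerDl.
by apply: sumr_ge0 => y _; rewrite mulr_ge0// ltW.
Qed.

Lemma density_dist_le u v x : density pi u -> density pi v -> `|u x - v x| <= M.
Proof.
move=> du dv; have [u0 _] := du; have [v0 _] := dv.
have := density_le x du; have := density_le x dv; have := u0 x; have := v0 x.
by rewrite ler_norml => *; apply/andP; split; lra.
Qed.

Lemma cost_leW u v (p : R) : 0 <= p -> cost_le u v (p ^+ 2) -> (W u v <= p%:E)%E.
Proof.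
move=> p0 H; apply/(W_leP HQ) => // q pq; apply: cost_le_mono H.
have q0 : 0 <= q by rewrite ltW// (le_lt_trans p0).
by rewrite ler_pXn2r ?nnegrE// ltW.
Qed.

(** Both densities are joined to [w = (1 - N) u + N], which is at least [N] everywhere and within
    [N * (M + 1)] of each. The interpolation cost is then of order [N ^+ 2 / N = N], whence the
    square root. *)
Lemma W_holder : exists2 K, 0 < K & forall u v (N : R),
  density pi u -> density pi v -> 0 < N <= 1 -> (forall x, `|u x - v x| <= N) ->
  (W u v <= (K * Num.sqrt N)%:E)%E.
Proof.
have [C C0 HC] := interpolation_cost HQ.
have M0 := density_bound_ge0.
have d1 := density1 HQ.
pose p := Num.sqrt C * (M + 1).
have p0 : 0 < p by rewrite mulr_gt0 ?sqrtr_gt0// ltr_wpDl.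
exists (2 * p); first by rewrite mulr_gt0.
move=> u v N du dv /andP[N0 N1] uv.
pose w x := (1 - N) * u x + N * 1.
have dw : density pi w by apply: density_mix => //; rewrite ltW.
have wN x : N <= w x.
  by rewrite /w mulr1 lerDr mulr_ge0 ?subr_ge0//; case: du.
have uw x : `|u x - w x| <= N * (M + 1).
  rewrite (_ : u x - w x = N * (u x - 1)); last by rewrite /w; ring.
  rewrite normrM (gtr0_norm N0) ler_wpM2l ?(ltW N0)//.
  by apply: (le_trans (density_dist_le x du d1)); rewrite lerDl.
have vw x : `|v x - w x| <= N * (M + 1).
  rewrite (_ : v x - w x = - (u x - v x) + N * (u x - 1)); last by rewrite /w; ring.
  apply: (le_trans (ler_normD _ _)); rewrite normrN [leRHS]mulrDr mulr1 [leRHS]addrC lerD//.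
  rewrite normrM (gtr0_norm N0) ler_wpM2l ?(ltW N0)//.
  exact: density_dist_le x du d1.
have cE : C * (N * (M + 1)) ^+ 2 / N = (p * Num.sqrt N) ^+ 2.
  rewrite /p !exprMn !sqr_sqrtr ?(ltW C0) ?(ltW N0)//.
  by field; rewrite gt_eqF.
have pN : 0 <= p * Num.sqrt N by rewrite mulr_ge0 ?sqrtr_ge0// ltW.
have := HC u w _ _ du dw N0 wN uw; rewrite cE => /(cost_leW pN) W1.
have := HC v w _ _ dv dw N0 wN vw; rewrite cE => /(cost_leW pN) W2.
apply: (le_trans (W_triangle HQ u w v)).
rewrite -mulrA mulr_natl mulr2n EFinD leeD//.
by rewrite (W_sym HQ).
Qed.

Lemma W_finite u v : density pi u -> density pi v -> W u v \is a fin_num.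
Proof.
move=> du dv; have [C C0 HC] := interpolation_cost HQ.
have d1 := density1 HQ.
have H w : density pi w -> (W w (fun=> 1%R) < +oo)%E.
  move=> dw; have := HC w (fun=> 1) M 1 dw d1 ltr01 (fun=> lexx _) (fun x => density_dist_le x dw d1).
  rewrite divr1 -(sqr_sqrtr (ltW C0)) -exprMn => /cost_leW h.
  by apply: (le_lt_trans (h _)); rewrite ?ltry// mulr_ge0// density_bound_ge0.
rewrite ge0_fin_numE; last exact: W_ge0.
apply: (le_lt_trans (W_triangle HQ u (fun=> 1) v)).
by rewrite lte_add_pinfty ?H// (W_sym HQ) H.
Qed.

(** Testing with plus or minus the indicator of [x] divided by [pi x], and with Young parameter [e].
    Densities being bounded, the kinetic energy of the test function is at most [G] along any
    plan. *)
Lemma plan_displacement : exists2 K, 0 < K & forall a b rho psi (e : R) x,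
  a <= b -> b - a <= 1 -> plan_on a b rho psi -> 0 < e ->
  (energy a b rho psi <= (e ^+ 2)%:E)%E -> `|rho b x - rho a x| <= K * e.
Proof.
pose G := 2^-1 * \sum_(x : X) \sum_(y : X) (M ^+ 2 * M * Q x y * pi x).
have M0 := density_bound_ge0.
have G0 : 0 <= G.
  rewrite mulr_ge0 ?invr_ge0//; apply: sumr_ge0 => x _; apply: sumr_ge0 => y _.
  by rewrite !mulr_ge0 ?(rates_ge0 HQ) ?sqr_ge0// ltW.
exists ((G + 1) / 2); first by rewrite divr_gt0// ltr_wpDl.
move=> a b rho psi e x ab ab1 P e0 E.
suff H (s : R) : `|s| = 1 -> s * (rho b x - rho a x) <= (G + 1) / 2 * e.
  rewrite ler_norml; apply/andP; split.
    by rewrite lerNl -mulN1r; apply: H; rewrite normrN1.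
  by rewrite -[leLHS]mul1r; apply: H; rewrite normr1.
move=> s1; pose f y := if y == x then s / pi x else 0.
have fM y z : (f y - f z) ^+ 2 <= M ^+ 2.
  have sM : `|s / pi x| <= M.
    by rewrite normrM s1 mul1r gtr0_norm ?invr_gt0// inv_pi_le.
  rewrite -ler_sqrt ?sqr_ge0// !sqrtr_sqr (ger0_norm M0) /f.
  by case: ifP => _; case: ifP => _; rewrite ?subrr ?normr0 ?subr0 ?sub0r ?normrN.
have kG t : a <= t <= b -> kinetic (rho t) f <= G.
  move=> tab; have dt := plan_on_density P tab; have [r0 _] := dt.
  rewrite /kinetic /G ler_pM2l ?invr_gt0//; apply: ler_sum => y _; apply: ler_sum => z _.
  rewrite ler_wpM2r ?(ltW (pi0 _))// ler_wpM2r ?(rates_ge0 HQ)// ler_pM ?sqr_ge0 ?log_mean_ge0//.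
  by apply: (le_trans (log_mean_le_max _ _)); rewrite ?r0// ge_max !density_le.
have := plan_test HQ ab P kG e0 E.
rewrite (bigD1 x)//= big1 ?addr0; last by move=> y yx; rewrite /f (negPf yx) mulr0 mul0r.
rewrite /f eqxx [pi x * _]mulrC divfK ?gt_eqF// => /le_trans; apply.
rewrite expr2 mulfK ?gt_eqF//.
rewrite (_ : (G + 1) / 2 * e = (e * G * 1 + e) / 2); last by field.
by rewrite ler_pM2r ?invr_gt0// lerD2r ler_wpM2l// mulr_ge0// ltW.
Qed.

(** Cauchy-Schwarz with an upper bound on the total weight: each square is bounded below by its
    tangent at [V / T]. *)
Lemma weighted_square_le (I : finType) (c d : I -> R) (T : R) : 0 < T ->
  (forall i, 0 <= c i) -> \sum_i c i <= T ->
  (\sum_i c i * d i) ^+ 2 / T <= \sum_i c i * d i ^+ 2.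
Proof.
move=> T0 c0 cT; set V := \sum_i _; pose a := V / T.
have H : \sum_i c i * (2 * a * d i - a ^+ 2) <= \sum_i c i * d i ^+ 2.
  apply: ler_sum => i _; rewrite ler_wpM2l// -subr_ge0.
  by rewrite (_ : _ - _ = (d i - a) ^+ 2) ?sqr_ge0//; ring.
apply: le_trans H.
rewrite (_ : \sum_i _ = 2 * a * V - a ^+ 2 * \sum_i c i); last first.
  rewrite /V !mulr_sumr -sumrB; apply: eq_bigr => i _; ring.
have : a ^+ 2 * \sum_i c i <= a ^+ 2 * T by rewrite ler_wpM2l ?sqr_ge0.
rewrite (_ : V ^+ 2 / T = 2 * a * V - a ^+ 2 * T); last by rewrite /a; field; rewrite gt_eqF.
lra.
Qed.

(** Fluxes, unlike potentials, may be averaged. The share [s] of the uniform density, which does not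
    move, keeps the mixture positive, as needed to return to a potential. *)
Lemma cost_le_mixture (I : finType) (k : I -> R) (rho psi : I -> R -> X -> R) (s A : R) :
  (forall i, 0 <= k i) -> \sum_i k i = 1 -> 0 < s < 1 ->
  (forall i, plan_on 0 1 (rho i) (psi i)) ->
  (forall i, (energy 0 1 (rho i) (psi i) <= A%:E)%E) ->
  let mix t x := (1 - s) * (\sum_i k i * rho i t x) + s in
  cost_le (mix 0) (mix 1) A.
Proof.
move=> k0 k1 /andP[s0 s1] P E mix.
have s'0 : 0 <= 1 - s by rewrite subr_ge0 ltW.
pose V t x y := \sum_i (1 - s) * k i * ((psi i t x - psi i t y) * rho_hat (rho i t) x y).
have dens0 i t x : 0 <= t <= 1 -> 0 <= rho i t x.
  by move=> t01; have [] := plan_on_density (P i) t01.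
have I01 : measurable (`[0, 1]%classic : set (measurableTypeR R)) by exact: measurable_itv.
have mr i x : measurable_fun (`[0, 1] : set (measurableTypeR R)) ((rho i)^~ x).
  exact: (ac_measurable (plan_on_ac (P i) x)).
have acm x : absolutely_continuous (mix^~ x) 0 1.
  apply: ac_scaleD; last exact: ac_cst.
  by apply: ac_sum => i; exact: (plan_on_ac (P i)).
have mV x y : measurable_fun (`[0, 1] : set (measurableTypeR R)) (fun t => V t x y).
  apply: measurable_sum => i; apply: measurable_funM; first exact: measurable_cst.
  apply: measurable_funM; first by apply: measurable_funB; exact: (plan_on_measurable (P i)).
  exact: measurable_log_mean.
have mix0 t x : 0 <= t <= 1 -> 0 < mix t x.
  move=> t01; rewrite ltr_wpDl// mulr_ge0//; apply: sumr_ge0 => i _.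
  by rewrite mulr_ge0// dens0.
apply: (@momentum_cost_le _ _ _ _ HQ mix V) => //.
- move=> t t01; split; first by move=> x; exact: (ltW (mix0 t x t01)).
  rewrite /mix; under eq_bigr do rewrite mulrDl -mulrA mulr_suml.
  rewrite big_split/= -!mulr_sumr (pi_sum1 HQ) mulr1 exchange_big/=.
  rewrite (_ : \sum_i _ = 1) ?mulr1 ?subrK// -[RHS]k1; apply: eq_bigr => i _.
  under eq_bigr do rewrite -mulrA.
  by rewrite -mulr_sumr; have [_ ->] := plan_on_density (P i) t01; rewrite mulr1.
- by move=> t /andP[t0 t1] x; apply: mix0; rewrite !ltW.
- move=> t /andP[t0 t1] x y; rewrite /V -sumrN; apply: eq_bigr => i _.
  have t01 : 0 <= t <= 1 by rewrite !ltW.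
  rewrite (rho_hatC x y (plan_on_density (P i) t01)); ring.
- have dr : {ae mu, forall t : R, forall i, 0 < t < 1 -> forall x,
     is_derive t 1 ((rho i)^~ x) (drift Q (rho i t) (psi i t) x)}.
    apply: (@filter_forall _ _ _ _ (ae_filter_ringOfSetsType mu)) => i.
    exact: (plan_on_drift (P i)).
  apply: ae_imply dr => t dr t01 x.
  rewrite (_ : mix^~ x = (fun r => \sum_i (1 - s) * k i * rho i r x) + cst s); last first.
    apply/funext => r; rewrite /mix mulr_sumr; congr (_ + _).
    by apply: eq_bigr => i _; rewrite mulrA.
  have h := is_deriveD (is_derive_linear_sum (fun i => (1 - s) * k i) (fun i => dr i t01 x)) (is_derive_cst s t (1 : R)).
  apply: (is_derive_eq h); rewrite addr0 /V /drift.
  under eq_bigr do rewrite mulr_sumr.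
  rewrite exchange_big; apply: eq_bigr => y _; rewrite mulr_suml; apply: eq_bigr => i _ /=.
  by rewrite !mulrA.
- have flux_le t : 0 <= t <= 1 -> flux_energy Q pi (mix t) (V t) <= \sum_i k i * kinetic (rho i t) (psi i t).
    move=> t01; rewrite /flux_energy /kinetic.
    under [leRHS]eq_bigr do rewrite mulrCA.
    rewrite -mulr_sumr ler_pM2l ?invr_gt0//.
    under [leRHS]eq_bigr do rewrite mulr_sumr.
    rewrite [leRHS]exchange_big/=; apply: ler_sum => x _.
    under [leRHS]eq_bigr do rewrite mulr_sumr.
    rewrite [leRHS]exchange_big/=; apply: ler_sum => y _.
    have th0 : 0 < rho_hat (mix t) x y.
      have m0 : 0 < Num.min (mix t x) (mix t y) by rewrite lt_min !mix0.
      apply: (lt_le_trans m0); apply: log_mean_ge; rewrite ?ge_min ?lexx ?orbT//.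
      exact: ltW.
    (* By concavity and monotonicity of the logarithmic mean these weights sum to at most the mean
       of the mixture, which is the denominator of the flux energy. *)
    pose c i := (1 - s) * k i * rho_hat (rho i t) x y.
    have c0 i : 0 <= c i by exact: (mulr_ge0 (mulr_ge0 s'0 (k0 i)) (log_mean_ge0 _ _)).
    have cT : \sum_i c i <= rho_hat (mix t) x y.
      have S0 z : 0 <= \sum_i k i * rho i t z by apply: sumr_ge0 => i _; rewrite mulr_ge0// dens0.
      apply: (@le_trans _ _ (log_mean ((1 - s) * \sum_i k i * rho i t x) ((1 - s) * \sum_i k i * rho i t y))).
        rewrite (log_meanZ s'0 (S0 x) (S0 y)).
        rewrite (_ : \sum_i c i = (1 - s) * \sum_i k i * rho_hat (rho i t) x y); last first.
          by rewrite mulr_sumr; apply: eq_bigr => i _; rewrite /c mulrA.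
        apply: (ler_wpM2l s'0); apply: log_mean_sum => i; [exact: k0|exact: dens0|exact: dens0].
      by apply: log_mean_le; rewrite ?mulr_ge0// /mix lerDl ltW.
    have := @weighted_square_le _ c (fun i => psi i t x - psi i t y) _ th0 c0 cT.
    rewrite (_ : \sum_i c i * _ = V t x y); last first.
      by apply: eq_bigr => i _; rewrite /c; ring.
    move=> h.
    have w0 : 0 <= Q x y * pi x by rewrite mulr_ge0 ?(rates_ge0 HQ)// ltW.
    apply: (@le_trans _ _ ((\sum_i c i * (psi i t x - psi i t y) ^+ 2) * (Q x y * pi x))).
      by rewrite -mulrA ler_wpM2r.
    rewrite mulr_suml; apply: ler_sum => i _.
    rewrite (_ : k i * _ = k i * rho_hat (rho i t) x y * (psi i t x - psi i t y) ^+ 2 * (Q x y * pi x)); last by ring.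
    apply: (ler_wpM2r w0); apply: (ler_wpM2r (sqr_ge0 _)); rewrite /c -mulrA; apply: ler_piMl.
      exact: (mulr_ge0 (k0 i) (log_mean_ge0 _ _)).
    by rewrite gerBl ltW.
  have mk i : measurable_fun (`[0, 1] : set (measurableTypeR R)) (fun t => (k i * kinetic (rho i t) (psi i t))%:E).
    apply/measurable_EFinP; apply: measurable_funM; first exact: measurable_cst.
    exact: (plan_kinetic_measurable (P i)).
  apply: (@le_trans _ _ (\int[mu]_(t in `[0%R, 1%R]) (\sum_i (k i * kinetic (rho i t) (psi i t))%:E))%E).
    apply: (@ge0_le_integral _ (measurableTypeR R)) => //.
    + by move=> t _; rewrite lee_fin (flux_energy_ge0 HQ).
    + by apply/measurable_EFinP; apply: flux_energy_measurable => // x; exact: ac_measurable.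
    + exact: emeasurable_sum.
    + by move=> t /=; rewrite in_itv/= => t01; rewrite sumEFin lee_fin flux_le.
  rewrite (@ge0_integral_sum _ (measurableTypeR R) R mu _ I01 I (fun i t => (k i * kinetic (rho i t) (psi i t))%:E) mk); last first.
    by move=> i t _; rewrite lee_fin mulr_ge0// (kinetic_ge0 HQ).
  rewrite (_ : A = \sum_i k i * A); last by rewrite -mulr_suml k1 mul1r.
  rewrite -sumEFin; apply: lee_sum => i _.
  under eq_integral do rewrite EFinM.
  rewrite (@ge0_integralZl _ (measurableTypeR R) R mu _ I01 _ _ (k i)%:E) ?lee_fin//.
  + by rewrite EFinM lee_wpmul2l ?lee_fin//; exact: E.
  + apply/measurable_EFinP; exact: (plan_kinetic_measurable (P i)).
  + by move=> t _; rewrite lee_fin (kinetic_ge0 HQ).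
Qed.

Lemma W_to_uniform (D : R) u : 0 <= D -> (forall x y, (dW Q pi x y <= D%:E)%E) -> density pi u ->
  (W u (fun=> 1%R) <= D%:E)%E.
Proof.
move=> D0 HD du; have [u0 u1] := du; have d1 := density1 HQ; have M0 := density_bound_ge0.
have [K K0 HK] := W_holder.
apply/lee_addgt0Pr => e e0; have e20 : 0 < e / 2 by rewrite divr_gt0.
have Dq : D < D + e / 2 by rewrite ltrDl.
have /choice[rho /choice[psi HP]] : forall p : X * X, exists rho psi,
    [/\ plan_on 0 1 rho psi, rho 0 = dirac_density pi p.1, rho 1 = dirac_density pi p.2 &
     (energy 0 1 rho psi <= ((D + e / 2) ^+ 2)%:E)%E].
  by move=> [x y]; exact: ((W_leP HQ _ _ D0).1 (HD x y) _ Dq).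
(* The product coupling of [u pi] with [pi]: mixing the Dirac masses at the two coordinates gives
   [u] and the uniform density. *)
pose k (p : X * X) := u p.1 * pi p.1 * pi p.2.
have k0 (p : X * X) : 0 <= k p by rewrite !mulr_ge0// ltW.
have k1 : \sum_p k p = 1.
  rewrite -(pair_bigA _ (fun x y => u x * pi x * pi y))/=.
  under eq_bigr do rewrite -mulr_sumr (pi_sum1 HQ) mulr1.
  exact: u1.
(* Mixing displaces the starting density by at most [N], which costs at most [e / 2] by [W_holder];
   the bound 1/2 ensures [s < 1]. The final density, being uniform, is not displaced. *)
pose N := Num.min 2^-1 ((e / 2 / K) ^+ 2).
have eK0 : 0 < e / 2 / K by rewrite divr_gt0.
have N0 : 0 < N by rewrite lt_min invr_gt0 ltr0n exprn_gt0.
have N12 : N <= 2^-1 by rewrite ge_min lexx.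
have M1 : 0 < M + 1 by rewrite ltr_wpDl.
pose s := N / (M + 1).
have s0 : 0 < s by rewrite divr_gt0.
have sN : s <= N by rewrite ler_pdivrMr// ler_peMr ?lerDr// ltW.
have s1 : s < 1 by apply: (le_lt_trans sN); apply: (le_lt_trans N12); rewrite invf_lt1 ?ltr1n.
have s01 : 0 < s < 1 by rewrite s0.
have := @cost_le_mixture _ k rho psi s _ k0 k1 s01 (fun p => let: And4 h _ _ _ := HP p in h) (fun p => let: And4 _ _ _ h := HP p in h).
rewrite /=; set m0 := fun _ => _; set m1 := fun _ => _.
have m0E x : m0 x = (1 - s) * u x + s.
  rewrite /m0; congr (_ * _ + _).
  under eq_bigr => p _ do rewrite (let: And4 _ h _ _ := HP p in h).
  rewrite -(pair_bigA _ (fun y z => k (y, z) * dirac_density pi y x))/= (bigD1 x)//= [X in _ + X]big1 ?addr0; last first.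
    by move=> y yx; rewrite big1// => z _; rewrite /dirac_density eq_sym (negPf yx) mulr0.
  rewrite /dirac_density eqxx -mulr_suml /k/= -mulr_sumr (pi_sum1 HQ) mulr1.
  by rewrite mulfK// gt_eqF.
have m1E : m1 = fun=> 1.
  apply/funext => x; rewrite /m1.
  under eq_bigr => p _ do rewrite (let: And4 _ _ h _ := HP p in h).
  rewrite -(pair_bigA _ (fun y z => k (y, z) * dirac_density pi z x))/=.
  rewrite (_ : \sum_y _ = 1); first by rewrite mulr1 subrK.
  rewrite -[RHS]u1; apply: eq_bigr => y _.
  rewrite (bigD1 x)//= big1 ?addr0; last first.
    by move=> z zx; rewrite /dirac_density eq_sym (negPf zx) mulr0.
  by rewrite /dirac_density eqxx /k/= mulfK// gt_eqF.
rewrite m1E => /cost_leW W1.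
have dm : density pi m0.
  rewrite (_ : m0 = fun x => (1 - s) * u x + s * 1); last by apply/funext => x; rewrite m0E mulr1.
  by apply: density_mix => //; rewrite !ltW.
have N01 : 0 < N <= 1 by rewrite N0 (le_trans N12)// invf_le1 ?ler1n.
have um x : `|u x - m0 x| <= N.
  rewrite m0E (_ : u x - _ = s * (u x - 1)); last by ring.
  rewrite normrM (gtr0_norm s0) /s mulrAC -mulrA ler_piMr ?(ltW N0)// ler_pdivrMr// mul1r.
  by apply: (le_trans (density_dist_le x du d1)); rewrite lerDl.
apply: (le_trans (W_triangle HQ u m0 (fun=> 1))).
rewrite -EFinD (_ : D + e = e / 2 + (D + e / 2)); last by field.
rewrite EFinD; apply: leeD; last by apply: W1; rewrite addr_ge0// ltW.
apply: (le_trans (HK _ _ _ du dm N01 um)).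
rewrite lee_fin -ler_pdivlMl// mulrC -[leRHS]ger0_norm ?(ltW eK0)// -sqrtr_sqr ler_wsqrtr//.
by rewrite ge_min lexx orbT.
Qed.

End distance.

(** * Geodesics *)

(* The ultrafilter replaces a diagonal extraction: it converges at all times at once. *)
Lemma ultrafilter_limit (R : realType) (T : Type) (X : finType) (f : nat -> T -> X -> R) (M : R) :
  (forall n t x, 0 <= f n t x <= M) ->
  exists g : T -> X -> R, (forall t x, 0 <= g t x <= M) /\
    forall s t (e : R) n0, 0 < e -> exists n, [/\ (n0 <= n)%N,
      forall x, `|f n s x - g s x| <= e & forall x, `|f n t x - g t x| <= e].
Proof.
move=> fM.
have [G [GU sG]] := ultraFilterLemma (@eventually_filter).
have GP : ProperFilter G := @ultra_proper _ _ GU.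
have lim1 (h : nat -> R) : (forall n, 0 <= h n <= M) ->
    exists p, 0 <= p <= M /\ forall e, 0 < e -> G [set n | `|h n - p| <= e].
  move=> hM; have hA : G (h @^-1` `[0, M]%classic).
    by apply: filterS filterT => n _; rewrite /= in_itv/= hM.
  have [p] := @segment_compact R 0 M (h @ G) _ hA.
  move=> [/=]; rewrite in_itv/= => pM cl; exists p; split=> // e e0.
  (* A cluster point of an ultrafilter is a limit: otherwise the complement would belong to [G]
     while missing a ball around [p]. *)
  have [//|nG] := @in_ultra_setVsetC _ _ [set n | `|h n - p| <= e] GU.
  have [x [/= + /=]] := cl [set y | ~ `|y - p| <= e] (ball p e) nG (nbhsx_ballx p e e0).
  by move=> nb; rewrite /ball/= distrC => /ltW.
have /choice[g Hg] : forall tx : T * X, exists p, 0 <= p <= M /\ forall e, 0 < e -> G [set n | `|f n tx.1 tx.2 - p| <= e].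
  by move=> [t x]; apply: lim1 => n; exact: fM.
exists (fun t x => g (t, x)); split; first by move=> t x; have [] := Hg (t, x).
move=> s t e n0 e0.
have Gs r : G [set n | forall x, `|f n r x - g (r, x)| <= e].
  by apply: (@filter_forall _ _ _ _ GP) => x; have [_] := Hg (r, x); exact.
have Gn : G [set n | (n0 <= n)%N] by apply: sG; exists n0.
have [n [[h1 h2] h3]] := @filter_ex _ G GP _ (filterI (filterI Gn (Gs s)) (Gs t)).
by exists n.
Qed.

Section geodesics.
Variables (R : realType) (X : finType) (Q : X -> X -> R) (pi : X -> R).
Hypothesis HQ : reversible_chain Q pi.
Local Notation cost_le := (cost_le Q pi).
Local Notation plan_on := (plan_on Q pi).
Local Notation energy := (energy Q pi).
Local Notation W := (W Q pi).
Implicit Types (u v w f : X -> R).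

Definition dist u v : R := fine (W u v).

Lemma distE u v : density pi u -> density pi v -> W u v = (dist u v)%:E.
Proof. by move=> du dv; rewrite /dist fineK//; exact: W_finite. Qed.

Lemma dist_ge0 u v : 0 <= dist u v.
Proof. by rewrite fine_ge0//; exact: W_ge0. Qed.

Lemma dist_sym u v : dist u v = dist v u.
Proof. by rewrite /dist W_sym. Qed.

Lemma dist_triangle u v w : density pi u -> density pi v -> density pi w ->
  dist u w <= dist u v + dist v w.
Proof.
move=> du dv dw; rewrite -lee_fin EFinD -!distE//.
exact: W_triangle.
Qed.

Lemma dist_holder : exists2 K, 0 < K & forall u v (N : R),
  density pi u -> density pi v -> 0 < N <= 1 -> (forall x, `|u x - v x| <= N) ->
  dist u v <= K * Num.sqrt N.
Proof.
have [K K0 HK] := W_holder HQ; exists K => // u v N du dv N01 uv.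
by rewrite -lee_fin -distE//; exact: HK.
Qed.

Lemma dist_xx u : density pi u -> dist u u = 0.
Proof.
move=> du; have [K K0 HK] := dist_holder.
apply/eqP; rewrite eq_le dist_ge0 andbT; apply/ler_addgt0Pr => e e0; rewrite add0r.
pose N := Num.min 1 ((e / K) ^+ 2).
have eK : 0 < e / K by rewrite divr_gt0.
have N0 : 0 < N by rewrite lt_min ltr01 exprn_gt0.
have N01 : 0 < N <= 1 by rewrite N0 ge_min lexx.
apply: (le_trans (HK u u N du du N01 _)).
  by move=> x; rewrite subrr normr0 ltW.
rewrite -ler_pdivlMl// mulrC -[leRHS]ger0_norm ?(ltW eK)// -sqrtr_sqr ler_wsqrtr//.
by rewrite ge_min lexx orbT.
Qed.

(** With [T = b - a] and [B] the distance, [B ^+ 2 / T] equals [2 d B - T d ^+ 2] plus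
    [(B - T d) ^+ 2 / T], and [T <= 1]. This form is free of division, allows [T = 0], and has a
    first part that adds up over consecutive intervals. *)
Lemma plan_energy_dist a b rho psi (E d : R) : a <= b -> b - a <= 1 -> plan_on a b rho psi ->
  energy a b rho psi = E%:E ->
  2 * d * dist (rho a) (rho b) - (b - a) * d ^+ 2 + (dist (rho a) (rho b) - (b - a) * d) ^+ 2 <= E.
Proof.
move=> ab ba1 P EE.
have E0 : 0 <= E by rewrite -lee_fin -EE; exact: energy_ge0.
have [eab|nab] := eqVneq a b.
  rewrite -eab dist_xx; last by apply: (plan_on_density P); rewrite lexx ab.
  by rewrite subrr; move: E0; lra.
have ltab : a < b by rewrite lt_neqAle nab.
set B := dist _ _; set T := b - a.
have T0 : 0 < T by rewrite subr_gt0.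
have B2 : B ^+ 2 <= T * E.
  have TE0 : 0 <= T * E by rewrite mulr_ge0// ltW.
  have := plan_cost_le HQ ltab P (A := E); rewrite EE lexx => /(_ isT).
  rewrite -(sqr_sqrtr TE0) => /(cost_leW HQ (sqrtr_ge0 _)).
  rewrite distE ?lee_fin; [|by apply: (plan_on_density P); rewrite lexx ?ab..].
  by move=> h; rewrite ler_pXn2r ?nnegrE ?sqrtr_ge0 ?dist_ge0.
rewrite -(ler_pM2l T0); apply: le_trans B2.
have T1 : T <= 1 by [].
rewrite -subr_ge0 (_ : _ - _ = (1 - T) * (B - T * d) ^+ 2); last by ring.
by rewrite mulr_ge0 ?sqr_ge0// subr_ge0.
Qed.

(** [plan_energy_dist] is added over the three intervals cut by [s] and [t]. The linear parts
    already account for [d ^+ 2] by the triangle inequality, so the squared deviations from speed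
    [d] share what is left, at most [e ^+ 2]. *)
Lemma near_optimal_speed rho psi (d e : R) s t : 0 <= d -> 0 <= e ->
  d <= dist (rho 0) (rho 1) -> plan_on 0 1 rho psi ->
  (energy 0 1 rho psi <= (d ^+ 2 + e ^+ 2)%:E)%E ->
  0 <= s -> s <= t -> t <= 1 -> dist (rho s) (rho t) <= (t - s) * d + e.
Proof.
move=> d0 e0 dW P E s0 st t1.
have s1 := le_trans st t1; have t0 := le_trans s0 st.
have P1 := plan_on_sub (lexx 0) s1 P.
have P2 := plan_on_sub s0 t1 P.
have P3 := plan_on_sub t0 (lexx 1) P.
have P23 := plan_on_sub s0 (lexx 1) P.
have := E; rewrite (energyD HQ s0 s1 P) (energyD HQ st t1 P23).
have := energy_ge0 HQ 0 s rho psi; have := energy_ge0 HQ s t rho psi; have := energy_ge0 HQ t 1 rho psi.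
case E1 : (energy 0 s rho psi) => [A| |]//; case E2 : (energy s t rho psi) => [B| |]//; case E3 : (energy t 1 rho psi) => [C| |]//.
rewrite !lee_fin => C0 B0 A0 ABC.
have h1 := @plan_energy_dist _ _ _ _ _ d s0 _ P1 E1.
have h2 := @plan_energy_dist _ _ _ _ _ d st _ (plan_on_sub (lexx s) (lexx t) (plan_on_sub s0 t1 P)) E2.
have h3 := @plan_energy_dist _ _ _ _ _ d t1 _ P3 E3.
have dens r : 0 <= r <= 1 -> density pi (rho r) by move=> r01; exact: (plan_on_density P r01).
have ds : density pi (rho s) by apply: dens; rewrite s0.
have dt : density pi (rho t) by apply: dens; rewrite t0.
have dd0 : density pi (rho 0) by apply: dens; rewrite lexx ler01.
have dd1 : density pi (rho 1) by apply: dens; rewrite lexx ler01.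
have tri : d <= dist (rho 0) (rho s) + dist (rho s) (rho t) + dist (rho t) (rho 1).
  apply: (le_trans dW); apply: (le_trans (dist_triangle dd0 dt dd1)).
  by rewrite lerD2r dist_triangle.
move: h1 h2 h3 => /(_ ltac:(by rewrite subr0)) h1 /(_ ltac:(by lra)) h2 /(_ ltac:(by lra)) h3.
set a := dist (rho 0) (rho s) in h1 tri *; set b := dist (rho s) (rho t) in h2 tri *.
set c := dist (rho t) (rho 1) in h3 tri *.
have [//|lt] := leP b ((t - s) * d + e).
have sq : (b - (t - s) * d) ^+ 2 <= e ^+ 2.
  have : 0 <= (a + b + c - d) * d by rewrite mulr_ge0// subr_ge0.
  have := sqr_ge0 (a - (s - 0) * d); have := sqr_ge0 (c - (1 - t) * d).
  move: h1 h2 h3 ABC; rewrite subr0.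
  set x := (a - s * d) ^+ 2; set y := (b - (t - s) * d) ^+ 2; set z := (c - _) ^+ 2.
  move=> *; nra.
have : e ^+ 2 < (b - (t - s) * d) ^+ 2.
  by rewrite ltr_pXn2r ?nnegrE//; lra.
by move=> /(le_lt_trans sq); rewrite ltxx.
Qed.

Lemma geodesic_exists u v : density pi u -> density pi v ->
  exists rho, [/\ constant_speed_geodesic Q pi rho, rho 0 = u & rho 1 = v].
Proof.
move=> du dv; pose d := dist u v; have d0 : 0 <= d := dist_ge0 u v.
have M0 := density_bound_ge0 HQ; set M := density_bound pi in M0.
have eps n : 0 < n.+1%:R^-1 :> R by rewrite invr_gt0.
have /choice[rho /choice[psi HP]] : forall n : nat, exists rho psi,
    [/\ plan_on 0 1 rho psi, rho 0 = u, rho 1 = v &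
     (energy 0 1 rho psi <= (d ^+ 2 + n.+1%:R^-1 ^+ 2)%:E)%E].
  move=> n; have sq0 : 0 <= d ^+ 2 + n.+1%:R^-1 ^+ 2 by rewrite addr_ge0 ?sqr_ge0.
  have : cost_le u v (d ^+ 2 + n.+1%:R^-1 ^+ 2).
    rewrite -(sqr_sqrtr sq0); apply: (W_leP HQ u v d0).1; first by rewrite distE.
    rewrite -[ltLHS]ger0_norm// -sqrtr_sqr ltr_sqrt ?ltr_pwDr ?sqr_ge0// ?exprn_gt0//.
  by [].
(* Cutting off outside the unit interval makes the bounds required for the limit valid at every real
   time. *)
pose f n (t : R) x : R := if (0 <= t <= 1) then rho n t x else 0.
have dens n t : 0 <= t <= 1 -> density pi (rho n t).
  by case: (HP n) => P _ _ _ t01; exact: (plan_on_density P t01).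
have fM n t x : 0 <= f n t x <= M.
  rewrite /f; case: ifP => [t01|_]; last by rewrite lexx.
  by have dt := dens n t t01; rewrite (density_le HQ)// andbT; case: dt.
have [g [gM Hg]] := ultrafilter_limit fM.
have fE n t : 0 <= t <= 1 -> forall x, f n t x = rho n t x by rewrite /f => ->.
have I0 : 0 <= (0 : R) <= 1 by rewrite lexx ler01.
have I1 : 0 <= (1 : R) <= 1 by rewrite lexx ler01.
have gdens t : 0 <= t <= 1 -> density pi (g t).
  move=> t01; split; first by move=> x; case/andP: (gM t x).
  apply/eqP; rewrite -subr_eq0 -normr_le0; apply/ler_addgt0Pr => e e0; rewrite add0r.
  have [n [_ h _]] := Hg t t e 0%N e0.
  have [_ <-] := dens n t t01; rewrite -sumrB.
  apply: (le_trans (ler_norm_sum _ _ _)).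
  rewrite -[e]mulr1 -(pi_sum1 HQ) mulr_sumr; apply: ler_sum => x _.
  rewrite -mulrBl normrM (gtr0_norm (Defs.pi_gt0 HQ x)) ler_wpM2r ?(ltW (Defs.pi_gt0 HQ x))//.
  by rewrite -(fE n t t01) distrC.
have gend t w : 0 <= t <= 1 -> (forall n, rho n t = w) -> g t = w.
  move=> t01 H; apply/funext => x; apply/eqP; rewrite -subr_eq0 -normr_le0.
  apply/ler_addgt0Pr => e e0; rewrite add0r.
  have [n [_ h _]] := Hg t t e 0%N e0.
  by rewrite distrC -(H n) -(fE n t t01).
have g0 : g 0 = u by apply: gend => // n; case: (HP n).
have g1 : g 1 = v by apply: gend => // n; case: (HP n).
have [K K0 HK] := dist_holder.
have speed s t : 0 <= s -> s <= t -> t <= 1 -> dist (g s) (g t) <= (t - s) * d.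
  move=> s0 st t1; have s01 : 0 <= s <= 1 by rewrite s0 (le_trans st).
  have t01 : 0 <= t <= 1 by rewrite t1 (le_trans s0).
  apply/ler_addgt0Pr => e e0.
  have e30 : 0 < e / 3 by rewrite divr_gt0.
  pose N := Num.min 1 ((e / 3 / K) ^+ 2).
  have eK : 0 < e / 3 / K by rewrite divr_gt0.
  have N0 : 0 < N by rewrite lt_min ltr01 exprn_gt0.
  have N01 : 0 < N <= 1 by rewrite N0 ge_min lexx.
  have KN : K * Num.sqrt N <= e / 3.
    rewrite -ler_pdivlMl// mulrC -[leRHS]ger0_norm ?(ltW eK)// -sqrtr_sqr ler_wsqrtr//.
    by rewrite ge_min lexx orbT.
  have [n0 Hn0] : exists n0, forall n, (n0 <= n)%N -> n.+1%:R^-1 <= e / 3.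
    exists (Num.truncn (e / 3)^-1) => n le_n.
    rewrite -[leRHS]invrK lef_pV2 ?posrE ?invr_gt0//.
    by rewrite ltW// (lt_le_trans (truncnS_gt _))// ler_nat ltnS.
  have [n [nn0 hs ht]] := Hg s t N n0 N0.
  have [P r0 r1 E] := HP n.
  have sp : dist (rho n s) (rho n t) <= (t - s) * d + n.+1%:R^-1.
    by apply: (near_optimal_speed d0 (ltW (eps n)) _ P E) => //; rewrite r0 r1.
  have h1 : dist (g s) (rho n s) <= e / 3.
    by apply: le_trans KN; apply: HK => //; [exact: gdens|exact: dens|move=> x; rewrite distrC -(fE n s s01)].
  have h2 : dist (rho n t) (g t) <= e / 3.
    by apply: le_trans KN; apply: HK => //; [exact: dens|exact: gdens|move=> x; rewrite -(fE n t t01)].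
  have tr1 := dist_triangle (gdens s s01) (dens n s s01) (gdens t t01).
  have tr2 := dist_triangle (dens n s s01) (dens n t t01) (gdens t t01).
  have {}sp : dist (rho n s) (rho n t) <= (t - s) * d + e / 3.
    by apply: (le_trans sp); rewrite lerD2l; exact: Hn0.
  lra.
(* The upper bounds on the three pieces add up to exactly [d], so the triangle inequality makes each
   of them an equality. *)
have dE s t : 0 <= s -> s <= t -> t <= 1 -> dist (g s) (g t) = (t - s) * d.
  move=> s0 st t1; apply/eqP; rewrite eq_le speed//=.
  have s01 : 0 <= s <= 1 by rewrite s0 (le_trans st).
  have t01 : 0 <= t <= 1 by rewrite t1 (le_trans s0).
  have := speed 0 s (lexx 0) s0 (le_trans st t1).
  have := speed t 1 (le_trans s0 st) t1 (lexx 1).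
  have := dist_triangle (gdens 0 I0) (gdens s s01) (gdens 1 I1).
  have := dist_triangle (gdens s s01) (gdens t t01) (gdens 1 I1).
  rewrite g0 g1 -/d; lra.
exists g; split=> //; split.
  by move=> t; rewrite in_itv; exact: gdens.
move=> s t; rewrite !in_itv/= => s01 t01.
rewrite g0 g1 (distE (gdens s s01) (gdens t t01)) (distE du dv) -/d -EFinM.
congr EFin.
have /andP[s0 s1] := s01; have /andP[t0 t1] := t01.
have [st|/ltW ts] := leP s t.
  by rewrite dE// distrC ger0_norm// subr_ge0.
by rewrite dist_sym dE// ger0_norm// subr_ge0.
Qed.

End geodesics.

(** * The HWI inequality *)

Section hwi.
Variables (R : realType) (X : finType) (Q : X -> X -> R) (pi : X -> R).
Hypothesis HQ : reversible_chain Q pi.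
Local Notation cost_le := (cost_le Q pi).
Local Notation plan_on := (plan_on Q pi).
Local Notation energy := (energy Q pi).
Local Notation kinetic := (kinetic Q pi).
Local Notation dist := (dist Q pi).
Local Notation W := (W Q pi).
Implicit Types (u v w f : X -> R).

Let pi0 x : 0 < pi x. Proof. exact: (Defs.pi_gt0 HQ). Qed.

Lemma entropy1 : entropy pi (fun=> 1) = 0.
Proof. by apply: big1 => x _; rewrite ln1 mulr0. Qed.

(** The tangent inequality for [t ln t]. Its derivative is [ln u + 1], and the constant 1 integrates
    to zero against [u - v]. *)
Lemma entropy_sub_le u v : density pi u -> (forall x, 0 < u x) -> density pi v ->
  entropy pi u - entropy pi v <= \sum_x pi x * ln (u x) * (u x - v x).
Proof.
move=> du u0 dv; have [v0 _] := dv.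
have : \sum_x (pi x * u x - pi x * v x) = 0 by rewrite sumrB !density_sum// subrr.
move=> uv; rewrite /entropy -sumrB.
have -> : \sum_x pi x * ln (u x) * (u x - v x) =
    \sum_x (pi x * ln (u x) * (u x - v x) + (pi x * u x - pi x * v x)).
  by rewrite big_split/= uv addr0.
apply: ler_sum => x _.
have -> : pi x * u x * ln (u x) - pi x * v x * ln (v x) = pi x * (u x * ln (u x) - v x * ln (v x)) by ring.
have -> : pi x * ln (u x) * (u x - v x) + (pi x * u x - pi x * v x) = pi x * (ln (u x) * (u x - v x) + (u x - v x)) by ring.
rewrite ler_pM2l//.
have [vx0|vx0] := eqVneq (v x) 0.
  by rewrite vx0 mul0r !subr0 mulrC lerDl ltW.
have vx : 0 < v x by rewrite lt_neqAle eq_sym vx0 v0.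
have h : ln (u x / v x) <= u x / v x - 1.
  by rewrite -[X in ln X](subrK 1) addrC le_ln1Dx// ltrBrDr addNr divr_gt0.
have h2 : v x * (ln (u x) - ln (v x)) <= u x - v x.
  rewrite -ln_div ?posrE//; apply: (le_trans (ler_wpM2l (ltW vx) h)).
  by rewrite mulrBr mulr1 mulrCA divff// mulr1.
rewrite -subr_ge0 (_ : _ - _ = u x - v x - v x * (ln (u x) - ln (v x))); last by ring.
by rewrite subr_ge0.
Qed.

Lemma kinetic_scale_le u v f (c : R) : (forall x, 0 <= u x) -> (forall x, 0 <= v x) -> 0 <= c ->
  (forall x, v x <= c * u x) -> kinetic v f <= c * kinetic u f.
Proof.
move=> u0 v0 c0 vu; rewrite /kinetic mulrCA ler_pM2l ?invr_gt0// mulr_sumr.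
apply: ler_sum => x _; rewrite mulr_sumr; apply: ler_sum => y _.
have -> : c * ((f x - f y) ^+ 2 * rho_hat u x y * Q x y * pi x) =
  (f x - f y) ^+ 2 * (c * rho_hat u x y) * Q x y * pi x by ring.
apply: (ler_wpM2r (ltW (pi0 x))); apply: (ler_wpM2r (rates_ge0 HQ x y)).
apply: (ler_wpM2l (sqr_ge0 _)).
rewrite /rho_hat -(log_meanZ c0 (u0 x) (u0 y)); apply: log_mean_le => //.
Qed.

(** A bound on the metric slope at [u] of the linear functional [f]. A short plan never leaves the
    region of densities below [2 u], where the kinetic energy of [f] at most doubles; hence
    [2 * G]. *)
Lemma linear_slope u f (G : R) : density pi u -> (forall x, 0 < u x) -> kinetic u f < G ->
  exists2 q0, 0 < q0 & forall v (q : R), 0 < q -> q <= q0 -> cost_le u v (q ^+ 2) ->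
    \sum_x pi x * f x * (v x - u x) <= q * Num.sqrt (2 * G).
Proof.
move=> du u0 kG; have [K K0 HK] := plan_displacement HQ.
have [m m0 mu] : exists2 m, 0 < m & forall x, m <= u x.
  exists (\big[Num.min/1]_x u x); last by move=> x; apply: bigmin_le_cond.
  by apply/bigmin_gtP; split=> // x _.
have k0 := kinetic_ge0 HQ u f.
have G0 : 0 < G by exact: le_lt_trans kG.
(* Along a plan of energy at most [q ^+ 2] every coordinate moves by at most [K * q], which must not
   exceed the minimum [m] of [u]. *)
exists (m / K); first by rewrite divr_gt0.
move=> v q q0 qq [rho [psi [P r0 r1 E]]].
have kq t : 0 <= t <= 1 -> kinetic (rho t) f <= 2 * G.
  move=> /andP[t0 t1].
  have P1 := plan_on_sub (lexx 0) t1 P.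
  have E1 : (energy 0 t rho psi <= (q ^+ 2)%:E)%E.
    apply: le_trans E; rewrite (energyD HQ t0 t1 P) leeDl//; exact: energy_ge0.
  have disp x : `|rho t x - u x| <= K * q.
    by rewrite -r0; apply: (HK 0 t rho psi q x t0 _ P1 q0 E1); rewrite subr0.
  have [v0 _] : density pi (rho t) by apply: (plan_on_density P); rewrite t0.
  apply: (@le_trans _ _ (2 * kinetic u f)); last by rewrite ler_pM2l// ltW.
  apply: kinetic_scale_le => // x; first exact: ltW.
  have := disp x; rewrite ler_norml => /andP[_].
  rewrite lerBlDl mulr_natl mulr2n => /le_trans; apply.
  rewrite lerD2l; apply: le_trans (mu x).
  by rewrite mulrC -ler_pdivlMr.
have G20 : 0 < 2 * G by rewrite mulr_gt0.
have sG : 0 < Num.sqrt (2 * G) by rewrite sqrtr_gt0.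
have l0 : 0 < q / Num.sqrt (2 * G) by rewrite divr_gt0.
have := plan_test HQ ler01 P kq l0 E.
rewrite r0 r1 => /le_trans; apply.
have sq := sqr_sqrtr (ltW G20).
rewrite -{2}sq; set g := Num.sqrt _ in sG *.
by rewrite le_eqVlt; apply/orP; left; apply/eqP; field; rewrite !gt_eqF.
Qed.

Lemma hwi (kappa D G : R) u : 0 <= kappa -> 0 < D -> Ric_ge Q pi (- kappa) ->
  (diamW Q pi <= D%:E)%E -> density pi u -> (forall x, 0 < u x) ->
  kinetic u (fun x => ln (u x)) < G ->
  entropy pi u <= 2 * D * Num.sqrt (2 * G) + kappa * D ^+ 2 / 2.
Proof.
move=> k0 D0 ric diam du u0 kG.
have d1 := density1 HQ.
have dD : dist u (fun=> 1) <= D.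
  rewrite -lee_fin -distE//; apply: (W_to_uniform HQ (ltW D0)) => // x y.
  by apply: le_trans diam; apply: ereal_sup_ubound; exists x, y.
set d := dist u (fun=> 1) in dD.
have d0 : 0 <= d by exact: dist_ge0.
have [g [geo g0 g1]] := geodesic_exists HQ du d1.
have kN : kinetic u (fun x => - ln (u x)) < G.
  rewrite (_ : kinetic _ _ = kinetic u (fun x => ln (u x)))//.
  congr (_ * _); apply: eq_bigr => x _; apply: eq_bigr => y _.
  by rewrite -opprD sqrrN.
have [q0 q00 slope] := linear_slope du u0 kN.
(* So small that [linear_slope] applies to the plan from [u] to [g t]. The length [2 * D] strictly
   exceeds [d], even when [d = D], as needed to extract an actual plan from the infimum. *)
pose t := Num.min 1 (q0 / (2 * D)).
have t0 : 0 < t by rewrite lt_min ltr01 divr_gt0// mulr_gt0.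
have t1 : t <= 1 by rewrite ge_min lexx.
have t01 : t \in `[0, 1] by rewrite in_itv/= t1 ltW.
have tq : t * (2 * D) <= q0.
  by rewrite -ler_pdivlMr ?mulr_gt0// ge_min lexx orbT.
have [gd gW] := geo.
have dt := gd t t01.
have Wt : W u (g t) = (t * d)%:E.
  rewrite -{1}g0 gW ?in_itv/= ?lexx ?ler01// g0 g1 distE// sub0r normrN.
  by rewrite ger0_norm ?ltW// -EFinM.
have c : cost_le u (g t) ((t * (2 * D)) ^+ 2).
  have td0 : 0 <= t * d by rewrite mulr_ge0// ltW.
  apply: (W_leP HQ u (g t) td0).1; first by rewrite Wt.
  by rewrite ltr_pM2l// mulr_natl mulr2n (le_lt_trans dD)// ltrDl.
have := slope (g t) (t * (2 * D)) _ tq c; rewrite mulr_gt0 ?mulr_gt0// => /(_ isT) sl.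
have H1 : entropy pi u - entropy pi (g t) <= t * (2 * D) * Num.sqrt (2 * G).
  apply: (le_trans (entropy_sub_le du u0 dt)); apply: le_trans sl.
  by apply: ler_sum => x _; rewrite le_eqVlt; apply/orP; left; apply/eqP; ring.
have := ric g geo t t01.
rewrite g0 g1 entropy1 mulr0 addr0 distE// -/d.
rewrite -EFin_expe -EFinM -EFinB lee_fin => H2.
have H3 : t * entropy pi u <= t * (2 * D * Num.sqrt (2 * G) + kappa * D ^+ 2 / 2).
  have h : kappa / 2 * t * (1 - t) * d ^+ 2 <= t * (kappa * D ^+ 2 / 2).
    rewrite (_ : t * _ = kappa / 2 * t * D ^+ 2); last by ring.
    have ktn : 0 <= kappa / 2 * t by rewrite !mulr_ge0// ?invr_ge0// ltW.
    rewrite -(mulrA _ (1 - t)); apply: (ler_wpM2l ktn).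
    apply: (@le_trans _ _ (d ^+ 2)); last by rewrite ler_pXn2r ?nnegrE// ltW.
    by rewrite ler_piMl ?sqr_ge0// gerBl ltW.
  move: H1 H2 h; set s := Num.sqrt _; set H := entropy pi u; set Ht := entropy pi (g t).
  lra.
by rewrite ler_pM2l in H3.
Qed.

End hwi.

(** * From capacities to the Poincare inequality *)

Section constants.
Variable R : realType.

Lemma ln2_ge : 2^-1 <= ln 2 :> R.
Proof.
have : ln (1 + - 2^-1) <= - 2^-1 :> R by apply: le_ln1Dx; rewrite ltrN2; lra.
rewrite (_ : 1 + - 2^-1 = 2^-1 :> R); last by field.
by rewrite lnV ?posrE// lerN2.
Qed.

(** Since [46 / 5] is 8 times [1 + 3 / 20], [ln Z] is at most [3 ln 2 + 3 / 20], while [8 / Z] is at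
    least [20 / 23] and [ln M] at least [4 ln 2]. With [ln 2 >= 1 / 2] the remaining margin is only
    about 0.004, which explains the choice of [10 ^- 3]. *)
Lemma ln_margin (M Z : R) : 16 <= M -> 1 <= Z -> Z <= 46 / 5 ->
  10 ^- 3 * ln M + 12^-1 < 8 / Z * ln M - ln Z.
Proof.
move=> M16 Z1 Z9.
have L : 4 * ln 2 <= ln M.
  rewrite mulr_natl -lnXn// ler_ln ?posrE//; last by apply: lt_le_trans M16.
  by apply: le_trans M16; rewrite -natrX ler_nat.
have lZ : ln Z <= 3 * ln 2 + 3 / 20.
  rewrite (le_trans (y := ln (2 ^+ 3 * (1 + 3 / 20))))//.
    rewrite ler_ln ?posrE ?mulr_gt0 ?exprn_gt0 ?addr_gt0 ?divr_gt0//.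
      by apply: (le_trans Z9); lra.
    exact: lt_le_trans Z1.
  rewrite lnM ?posrE ?exprn_gt0// ?addr_gt0 ?divr_gt0// lnXn//.
  have : ln (1 + 3 / 20) <= 3 / 20 :> R by apply: le_ln1Dx; lra.
  by rewrite -mulr_natl; set b := ln (1 + _); lra.
have l2 := ln2_ge.
have L0 : 0 <= ln M by lra.
have ZM : 20 / 23 * ln M <= 8 / Z * ln M.
  apply: (ler_wpM2r L0); rewrite ler_pdivlMr; last by apply: lt_le_trans Z1.
  lra.
set l := ln M in L L0 ZM *; set z := ln Z in lZ *; set b := 8 / Z * l in ZM *.
set a := ln 2 in L lZ l2.
have : 10 ^- 3 * l <= 1000^-1 * l by apply: (ler_wpM2r L0); rewrite -natrX.
lra.
Qed.

End constants.

Section capacity.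
Variables (R : realType) (X : finType) (Q : X -> X -> R) (pi : X -> R).
Hypothesis HQ : reversible_chain Q pi.
Local Notation kinetic := (kinetic Q pi).
Local Notation E := (dirichlet Q pi).
Implicit Types (f g h u v : X -> R).

Let pi0 x : 0 < pi x. Proof. exact: (Defs.pi_gt0 HQ). Qed.
Let Q0 x y : 0 <= Q x y. Proof. exact: (rates_ge0 HQ). Qed.

Lemma mass_le (P P' : pred X) : (forall x, P x -> P' x) ->
  \sum_(x | P x) pi x <= \sum_(x | P' x) pi x.
Proof.
move=> PP; rewrite big_mkcond [leRHS]big_mkcond/=; apply: ler_sum => x _.
by case: ifP => [/PP ->//|_]; case: ifP => // _; exact: ltW.
Qed.

Lemma dirichlet_ge0 f : 0 <= E f.
Proof.
rewrite mulr_ge0 ?invr_ge0//; apply: sumr_ge0 => x _; apply: sumr_ge0 => y _.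
exact: (mulr_ge0 (mulr_ge0 (sqr_ge0 _) (Q0 x y)) (ltW (pi0 x))).
Qed.

Lemma dirichletZ (a : R) f : E (fun x => a * f x) = a ^+ 2 * E f.
Proof.
rewrite /dirichlet [RHS]mulrCA; congr (_ * _); rewrite mulr_sumr; apply: eq_bigr => x _.
by rewrite mulr_sumr; apply: eq_bigr => y _; ring.
Qed.

Lemma kinetic_le_dirichlet u f (c : R) : (forall x, 0 <= u x) -> (forall x, u x <= c) ->
  kinetic u f <= c * E f.
Proof.
move=> u0 uc; rewrite /kinetic /dirichlet mulrCA ler_pM2l ?invr_gt0// mulr_sumr.
apply: ler_sum => x _; rewrite mulr_sumr; apply: ler_sum => y _.
have -> : c * ((f y - f x) ^+ 2 * Q x y * pi x) = (f x - f y) ^+ 2 * c * Q x y * pi x by ring.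
apply: (ler_wpM2r (ltW (pi0 x))); apply: (ler_wpM2r (Q0 x y)).
apply: (ler_wpM2l (sqr_ge0 _)).
by apply: (le_trans (log_mean_le_max (u0 x) (u0 y))); rewrite ge_max !uc.
Qed.

Variables D : R.
Hypothesis D0 : 0 < D.
(** The only form in which curvature and diameter enter the capacity estimate. *)
Hypothesis entropy_control : forall (G : R) u, density pi u -> (forall x, 0 < u x) ->
  kinetic u (fun x => ln (u x)) < G -> entropy pi u <= 2 * D * Num.sqrt (2 * G) + 12^-1.

Let C : R := 64 * (10 ^+ 3) ^+ 2 * D ^+ 2.

Lemma capacity_ge h : (forall x, 0 <= h x <= 1) ->
  \sum_(x | 0 < h x) pi x <= 2^-1 ->
  49 / 50 * \sum_(x | 0 < h x) pi x <= \sum_(x | h x == 1) pi x ->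
  \sum_(x | h x == 1) pi x <= C * E h.
Proof.
move=> h01; set a := \sum_(x | 0 < h x) _; set p := \sum_(x | h x == 1) _ => a2 pa.
have p_ge0 : 0 <= p by apply: sumr_ge0 => x _; exact: ltW.
have [->|pn0] := eqVneq p 0.
  by rewrite mulr_ge0 ?dirichlet_ge0// !mulr_ge0// ?exprn_ge0// ltW.
have p0 : 0 < p by rewrite lt_neqAle eq_sym pn0.
have pla : p <= a.
  by apply: mass_le => x /eqP ->; exact: ltr01.
pose M := 8 / p; pose L := ln M.
have M0 : 0 < M by rewrite divr_gt0.
have M16 : 16 <= M by rewrite ler_pdivlMr//; lra.
have L0 : 0 < L by apply: ln_gt0; apply: lt_le_trans M16; rewrite ltr1n.
pose v x := expR (L * h x); pose Z := \sum_x v x * pi x.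
have v1 x : 1 <= v x.
  by rewrite -expR0 ler_expR mulr_ge0 ?(ltW L0)//; case/andP: (h01 x).
have vM x : v x <= M.
  rewrite -[leRHS](lnK M0) ler_expR -[leRHS]mulr1 ler_pM2l//.
  by case/andP: (h01 x).
have Z1 : 1 <= Z.
  rewrite -(pi_sum1 HQ); apply: ler_sum => x _; exact: (ler_peMl (ltW (pi0 x)) (v1 x)).
have Z0 : 0 < Z by exact: lt_le_trans Z1.
(* Off the support of [h] the weight is 1, elsewhere at most [M], so [Z <= 1 + M * a]. The ratio
   49/50 gives [M * a <= 400 / 49]. *)
have Z9 : Z <= 46 / 5.
  apply: (@le_trans _ _ (1 + M * a)).
    rewrite -(pi_sum1 HQ) /a [X in M * X]big_mkcond/= mulr_sumr -big_split/=.
    apply: ler_sum => x _; case: ifPn => hx.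
      rewrite -[X in _ <= X + _]mul1r -mulrDl; apply: (ler_wpM2r (ltW (pi0 x))).
      by apply: (le_trans (vM x)); rewrite lerDr.
    rewrite mulr0 addr0; have -> : v x = 1; last by rewrite mul1r.
    rewrite /v (_ : h x = 0) ?mulr0 ?expR0//; apply/eqP; rewrite eq_le.
    by rewrite leNgt hx; case/andP: (h01 x).
  have : M * a <= 400 / 49; last by lra.
  rewrite /M mulrAC ler_pdivrMr//; lra.
pose r x := v x / Z.
have r0 x : 0 < r x by rewrite divr_gt0// expR_gt0.
have dr : density pi r.
  split=> [x|]; first exact: ltW.
  under eq_bigr do rewrite /r mulrAC.
  by rewrite -mulr_suml divff ?gt_eqF.
have lnr x : ln (r x) = L * h x - ln Z.
  by rewrite ln_div ?posrE ?expR_gt0// expRK.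
have kr : kinetic r (fun x => ln (r x)) <= M * (L ^+ 2 * E h).
  rewrite -dirichletZ (_ : kinetic _ _ = kinetic r (fun x => L * h x)).
    apply: kinetic_le_dirichlet => x; first exact: ltW.
    rewrite ler_pdivrMr//; apply: (le_trans (vM x)); rewrite ler_peMr// ltW//.
  congr (_ * _); apply: eq_bigr => x _; apply: eq_bigr => y _.
  by rewrite !lnr opprB addrA subrK.
(* The entropy is [L] times the mean of [h] under [r], minus [ln Z]; that mean is at least the mass
   [M * p / Z = 8 / Z] that [r] gives to the set where [h] is 1. *)
have Hr : 8 / Z * L - ln Z <= entropy pi r.
  have -> : entropy pi r = L / Z * (\sum_x pi x * v x * h x) - ln Z.
    rewrite -[X in _ - X]mulr1 -[X in _ - _ * X]dr.2 !mulr_sumr -sumrB; apply: eq_bigr => x _.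
    rewrite lnr /r; ring.
  rewrite lerD2r mulrAC (mulrC 8) mulrAC ler_pM2l ?divr_gt0//.
  apply: (@le_trans _ _ (M * p)); first by rewrite /M divfK.
  rewrite /p big_mkcond/= mulr_sumr; apply: ler_sum => x _.
  case: eqP => [hx|_]; last first.
    by rewrite mulr0 !mulr_ge0 ?(ltW (pi0 x)) ?expR_ge0//; case/andP: (h01 x).
  by rewrite /v hx !mulr1 lnK// mulrC.
have marg := ln_margin M16 Z1 Z9.
rewrite leNgt; apply/negP => lt_p.
pose c := (10 ^+ 3)^-1 : R.
have c0 : 0 < c by rewrite invr_gt0 exprn_gt0.
(* Chosen so that [2 * D * Num.sqrt (2 * G)] is [c * L], just what [ln_margin] rules out. The
   information bound [8 / p * L ^+ 2 * E h] falls below [G] exactly when [C * E h < p], which fixes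
   [C]. *)
pose G := (c * L) ^+ 2 / (8 * D ^+ 2).
have D2 : 0 < 8 * D ^+ 2 by rewrite mulr_gt0// exprn_gt0.
have kG : kinetic r (fun x => ln (r x)) < G.
  apply: (le_lt_trans kr); rewrite ltr_pdivlMr//.
  have : c ^+ 2 * L ^+ 2 * M * (C * E h) < c ^+ 2 * L ^+ 2 * M * p.
    have cLM : 0 < c ^+ 2 * L ^+ 2 * M by rewrite (mulr_gt0 (mulr_gt0 _ _) M0) ?exprn_gt0.
    by rewrite ltr_pM2l.
  rewrite /M -[X in _ < X]mulrA divfK// => H.
  have cc : c ^+ 2 * (10 ^+ 3) ^+ 2 = 1.
    by rewrite -exprMn mulVf ?expr1n// gt_eqF// exprn_gt0.
  have : c ^+ 2 * L ^+ 2 * (8 / p) * (C * E h) =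
     8 * (8 / p * (L ^+ 2 * E h) * (8 * D ^+ 2)) * (c ^+ 2 * (10 ^+ 3) ^+ 2).
    by rewrite /C; ring.
  rewrite cc mulr1 => HH; rewrite HH in H.
  rewrite exprMn; lra.
have := entropy_control dr r0 kG.
have -> : 2 * D * Num.sqrt (2 * G) = c * L.
  have -> : 2 * G = (c * L / (2 * D)) ^+ 2.
    by rewrite /G; field; rewrite gt_eqF.
  rewrite sqrtr_sqr ger0_norm; first by field; rewrite gt_eqF.
  by rewrite !mulr_ge0// ?invr_ge0 ?mulr_ge0// ltW.
move=> H; have := lt_le_trans marg (le_trans Hr H).
by rewrite ltxx.
Qed.

End capacity.

(** * Slicing a function along geometric levels *)

Section level_sets.
Variables (R : realType) (X : finType) (Q : X -> X -> R) (pi : X -> R).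
Hypothesis HQ : reversible_chain Q pi.
Local Notation E := (dirichlet Q pi).
Implicit Types (f g h : X -> R).

Let pi0 x : 0 < pi x. Proof. exact: (Defs.pi_gt0 HQ). Qed.
Let Q0 x y : 0 <= Q x y. Proof. exact: (rates_ge0 HQ). Qed.

Lemma dirichlet_sum_le (I : Type) (s : seq I) (F : I -> X -> R) f :
  (forall x y, \sum_(i <- s) (F i y - F i x) ^+ 2 <= (f y - f x) ^+ 2) ->
  \sum_(i <- s) E (F i) <= E f.
Proof.
move=> Ff; rewrite -mulr_sumr ler_pM2l ?invr_gt0// exchange_big/=.
apply: ler_sum => x _; rewrite exchange_big/=; apply: ler_sum => y _.
rewrite -2!mulr_suml; apply: (ler_wpM2r (ltW (pi0 x))).
exact: (ler_wpM2r (Q0 x y)).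
Qed.

(** For [b <= a] the terms are squares of the nonnegative increments of [d], and the sum of their
    squares is at most the square of their sum. *)
Lemma sum_sqr_slices_le (s : nat -> R) (N : nat) (a b : R) : {homo s : m n / (m <= n)%N >-> m <= n} ->
  \sum_(0 <= k < N) ((Num.min a (s k.+1) - Num.min a (s k))
    - (Num.min b (s k.+1) - Num.min b (s k))) ^+ 2 <= (a - b) ^+ 2.
Proof.
move=> s_homo; wlog ba : a b / b <= a.
  move=> H; case: (leP b a) => [|/ltW] /H//; rewrite -(sqrrN (b - a)) opprB.
  by under eq_bigr do rewrite -sqrrN opprB.
pose d k := Num.min a (s k) - Num.min b (s k).
have sS k : s k <= s k.+1 by exact: s_homo.
have d0 k : 0 <= d k.
  by rewrite subr_ge0 le_min !ge_min ba lexx orbT.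
have dS k : d k <= d k.+1.
  rewrite /d; have := sS k; case: (leP a (s k)); case: (leP a (s k.+1));
  case: (leP b (s k)); case: (leP b (s k.+1)); lra.
have dN : d N <= a - b.
  by rewrite /d; case: (leP a (s N)); case: (leP b (s N)); lra.
apply: (@le_trans _ _ (d N ^+ 2)); last by rewrite ler_pXn2r// nnegrE ?d0 ?subr_ge0.
elim: N {dN} => [|N IH]; first by rewrite big_geq// sqr_ge0.
rewrite big_nat_recr//= (le_trans (lerD IH (lexx _)))//.
have -> : Num.min a (s N.+1) - Num.min a (s N) - (Num.min b (s N.+1) - Num.min b (s N)) = d N.+1 - d N.
  by rewrite /d; ring.
have := d0 N; have := dS N; set u := d N; set v := d N.+1; nra.
Qed.

Lemma layer_le (s : nat -> R) (N : nat) (t : R) : (forall k, 0 <= s k) -> 0 <= t -> t < s N ->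
  t ^+ 2 <= s 0 ^+ 2 + \sum_(0 <= k < N) (if s k <= t then s k.+1 ^+ 2 else 0).
Proof.
move=> s0 t0; elim: N => [|N IH] tN.
  by rewrite big_geq// addr0 ler_pXn2r ?nnegrE// ltW.
rewrite big_nat_recr//= addrA; case: (leP (s N) t) => [le|/IH h]; last by rewrite addr0.
rewrite ler_wpDl//; last by rewrite ler_pXn2r ?nnegrE// ltW.
by rewrite addr_ge0 ?sqr_ge0//; apply: sumr_ge0 => k _; case: ifP => // _; exact: sqr_ge0.
Qed.

Variable C : R.
Hypothesis C0 : 0 <= C.
Hypothesis capacity : forall h, (forall x, 0 <= h x <= 1) ->
  \sum_(x | 0 < h x) pi x <= 2^-1 ->
  49 / 50 * \sum_(x | 0 < h x) pi x <= \sum_(x | h x == 1) pi x ->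
  \sum_(x | h x == 1) pi x <= C * E h.

(** The capacity bound is applied to the slice rescaled to [[0, 1]]. Adding the bounds of the two
    cases turns the alternative into one linear recursion. *)
Lemma level_step g (s t : R) : 0 < s -> s < t -> \sum_(x | 0 < g x) pi x <= 2^-1 ->
  \sum_(x | t <= g x) pi x <= 49 / 50 * \sum_(x | s <= g x) pi x
    + C * E (fun x => Num.min (g x) t - Num.min (g x) s) / (t - s) ^+ 2.
Proof.
move=> s0 st a2; set Ft := \sum_(x | t <= _) _; set Fs := \sum_(x | s <= _) _.
have ts : 0 < t - s by rewrite subr_gt0.
pose h x := (t - s)^-1 * (Num.min (g x) t - Num.min (g x) s).
have h01 x : 0 <= h x <= 1.
  rewrite /h; apply/andP; split.
    rewrite mulr_ge0 ?invr_ge0 ?(ltW ts)//.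
    by case: (leP (g x) t); case: (leP (g x) s); lra.
  rewrite mulrC ler_pdivrMr// mul1r.
  by case: (leP (g x) t); case: (leP (g x) s); lra.
have h1 x : (h x == 1) = (t <= g x).
  rewrite /h mulrC -(inj_eq (mulIf (lt0r_neq0 ts))) divfK ?lt0r_neq0// mul1r.
  apply/eqP/idP.
    by case: (leP (g x) t); case: (leP (g x) s); lra.
  by case: (leP (g x) t); case: (leP (g x) s); lra.
have hs x : 0 < h x -> s <= g x.
  rewrite /h pmulr_rgt0 ?invr_gt0//.
  by case: (leP (g x) t); case: (leP (g x) s); lra.
have F1 : \sum_(x | h x == 1) pi x = Ft by apply: eq_bigl => x; exact: h1.
have F2 : \sum_(x | 0 < h x) pi x <= Fs by exact: (mass_le HQ).
have F3 : \sum_(x | 0 < h x) pi x <= 2^-1.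
  by apply: le_trans a2; apply: (mass_le HQ) => x /hs; exact: lt_le_trans.
have Eh : E h = E (fun x => Num.min (g x) t - Num.min (g x) s) / (t - s) ^+ 2.
  by rewrite /h (dirichletZ Q pi (t - s)^-1) exprVn mulrC.
have Fs0 : 0 <= Fs by apply: sumr_ge0 => x _; exact: ltW.
rewrite -(mulrA C) -Eh.
have CE : 0 <= C * E h by rewrite mulr_ge0// (dirichlet_ge0 HQ).
have := capacity h01 F3; rewrite F1.
case: (leP (49 / 50 * \sum_(x | 0 < h x) pi x) Ft) => [_ /(_ isT)|le _]; lra.
Qed.

(** A geometric sequence cannot start at 0: it starts at [e], and the part below contributes a
    multiple of [e ^+ 2] that tends to 0. The factor [101 ^+ 2] is the squared ratio of [s k.+1] to
    [s k.+1 - s k]. *)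
Lemma level_poincare g : (forall x, 0 <= g x) -> \sum_(x | 0 < g x) pi x <= 2^-1 ->
  \sum_x g x ^+ 2 * pi x <= 5 * 10 ^+ 3 * (101 ^+ 2 * C * E g).
Proof.
move=> g0 a2; set B := 101 ^+ 2 * C * E g.
have B0 : 0 <= B.
  exact: (mulr_ge0 (mulr_ge0 (exprn_ge0 _ (ler0n _ _)) C0) (dirichlet_ge0 HQ _)).
suff H (e : R) : 0 < e -> \sum_x g x ^+ 2 * pi x <= 5 * 10 ^+ 3 * B + 5 * 10 ^+ 3 * e ^+ 2.
  apply/ler_addgt0Pr => e e0.
  have := H (Num.sqrt (e / (5 * 10 ^+ 3))).
  have K0 : 0 < 5 * 10 ^+ 3 :> R by rewrite mulr_gt0// exprn_gt0.
  rewrite sqrtr_gt0 divr_gt0// => /(_ isT).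
  rewrite sqr_sqrtr ?divr_ge0 ?(ltW K0) ?(ltW e0)//.
  by rewrite [X in _ + X](mulrC _ (e / _)) divfK ?gt_eqF.
(* The ratio r is chosen with [49 / 50 * r ^+ 2 < 1]. *)
move=> e0; pose r : R := 101 / 100; pose s k := e * r ^+ k.
have r1 : 1 < r by rewrite /r; lra.
have r0 : 0 < r by exact: lt_trans r1.
have s0 k : 0 < s k by rewrite mulr_gt0// exprn_gt0.
have sS k : s k.+1 = r * s k by rewrite /s exprS mulrCA.
have s_homo : {homo s : m n / (m <= n)%N >-> m <= n}.
  by move=> m n mn; rewrite ler_pM2l// ler_weXn2l// ltW.
have sn (k : nat) : e + e / 100 * k%:R <= s k.
  elim: k => [|k IH]; first by rewrite mulr0 addr0 /s expr0 mulr1.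
  have es : e <= s k by rewrite -[leLHS]mulr1 -(expr0 r); exact: s_homo.
  rewrite sS -[k.+1%:R]natr1 (mulrDr (e / 100)) mulr1 /r; move: IH; set z := _ * k%:R; lra.
have [N gN] : exists N, forall x, g x < s N.
  exists (Num.truncn (\sum_x g x * 100 / e)).+1 => x.
  apply: lt_le_trans (sn _); rewrite ltr_wpDl ?(ltW e0)//.
  rewrite mulrC -ltr_pdivrMr ?divr_gt0// invf_div mulrA.
  apply: le_lt_trans (truncnS_gt _).
  rewrite (bigD1 x)//= lerDl; apply: sumr_ge0 => y _.
  by rewrite !mulr_ge0 ?invr_ge0 ?(ltW e0).
pose F k := \sum_(x | s k <= g x) pi x.
pose Ek k := E (fun x => Num.min (g x) (s k.+1) - Num.min (g x) (s k)).
have F0 k : 0 <= F k by apply: sumr_ge0 => x _; exact: ltW.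
have sumE : \sum_(0 <= k < N) Ek k <= E g.
  by apply: dirichlet_sum_le => x y; exact: sum_sqr_slices_le.
pose A k := s k ^+ 2 * F k.
have A0 k : 0 <= A k by rewrite mulr_ge0 ?sqr_ge0.
have AS k : A k.+1 <= 49 / 50 * r ^+ 2 * A k + 101 ^+ 2 * C * Ek k.
  have st : s k < s k.+1 by rewrite sS ltr_pMl.
  have := level_step (s0 k) st a2; rewrite -/(F k.+1) -/(F k) -/(Ek k).
  move=> /(ler_wpM2l (sqr_ge0 (s k.+1))) /le_trans; apply.
  rewrite le_eqVlt; apply/orP; left; apply/eqP; rewrite sS /A /r.
  rewrite (_ : 101 / 100 * s k - s k = s k / 100); last by field.
  by field; rewrite gt_eqF.
have AN : A 0 <= e ^+ 2.
  rewrite /A /s expr0 mulr1 ler_piMr ?sqr_ge0// -(pi_sum1 HQ) /F big_mkcond/=.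
  by apply: ler_sum => x _; case: ifP => // _; exact: ltW.
pose S := \sum_(0 <= k < N) A k.
have S1 : S <= A 0 + \sum_(0 <= k < N) A k.+1.
  by rewrite -big_nat_recl// big_nat_recr//= lerDl.
have S2 : \sum_(0 <= k < N) A k.+1 <= 49 / 50 * r ^+ 2 * S + B.
  apply: (le_trans (ler_sum _ (fun k _ => AS k))).
  rewrite big_split/= -mulr_sumr lerD2l -mulr_sumr.
  by apply: ler_wpM2l => //; rewrite mulr_ge0// exprn_ge0.
have L : \sum_x g x ^+ 2 * pi x <= e ^+ 2 + r ^+ 2 * S.
  have -> : r ^+ 2 * S = \sum_x (\sum_(0 <= k < N) (if s k <= g x then s k.+1 ^+ 2 else 0)) * pi x.
    under [RHS]eq_bigr do rewrite mulr_suml.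
    rewrite exchange_big mulr_sumr; apply: eq_bigr => k _ /=.
    rewrite /A /F mulrA -exprMn -sS big_mkcond mulr_sumr; apply: eq_bigr => x _.
    by case: ifP => _; rewrite ?mulr0 ?mul0r.
  have -> : e ^+ 2 = \sum_x e ^+ 2 * pi x by rewrite -mulr_sumr (pi_sum1 HQ) mulr1.
  rewrite -big_split/=; apply: ler_sum => x _; rewrite -mulrDl.
  apply: (ler_wpM2r (ltW (pi0 x))).
  have := layer_le (fun k => ltW (s0 k)) (g0 x) (gN x).
  by rewrite {1}/s expr0 mulr1.
have e20 : 0 <= e ^+ 2 by exact: sqr_ge0.
(* The recursion loses a factor [1 - 49 / 50 * r ^+ 2 = 0.000302], and [r ^+ 2] divided by this is
   about 3378, below 5000. *)
have K : 5 * 10 ^+ 3 = 5000 :> R by rewrite -natrX -natrM.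
rewrite K.
move: S1 S2 L; rewrite (_ : r ^+ 2 = 10201 / 10000); last by rewrite /r; field.
move: (e ^+ 2) (\sum_x g x ^+ 2 * pi x) S (\sum_(0 <= k < N) A k.+1) (A 0) AN B B0 e20 => *.
lra.
Qed.

(** The largest value of [f] with mass at most 1/2 strictly below it. The next larger value, if any,
    has more than 1/2 strictly below it, hence less than 1/2 at or above it. *)
Lemma medianP f : exists m : R,
  \sum_(x | f x < m) pi x <= 2^-1 /\ \sum_(x | m < f x) pi x <= 2^-1.
Proof.
have [x0 _] : exists x : X, true.
  apply/existsP; rewrite -[[exists _, _]]negbK; apply/negP => /existsPn H.
  have := pi_sum1 HQ; rewrite big1 => [/esym/eqP|x]; first by rewrite oner_eq0.
  by have := H x.
pose P x := \sum_(y | f y < f x) pi y <= 2^-1.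
have [i0 _ i0min] := @Order.TotalTheory.arg_minP _ _ _ x0 xpredT f isT.
have Pi0 : P i0.
  rewrite /P big_pred0 ?invr_ge0// => y; apply/negbTE; rewrite -leNgt; exact: i0min.
have [i Pi imax] := @Order.TotalTheory.arg_maxP _ _ _ i0 P f Pi0.
exists (f i); split=> //.
have [[j ij]|no] := pselect (exists j, f i < f j); last first.
  rewrite big_pred0 ?invr_ge0// => y; apply/negP => iy; apply: no; by exists y.
have [k ik kmin] := @Order.TotalTheory.arg_minP _ _ _ j (fun y => f i < f y) f ij.
have : ~~ P k by apply/negP => /imax; rewrite /= leNgt ik.
rewrite /P -ltNge => Pk.
apply: (@le_trans _ _ (\sum_(x | ~~ (f x < f k)) pi x)).
  by apply: (mass_le HQ) => x /kmin; rewrite leNgt.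
have := pi_sum1 HQ; rewrite (bigID (fun x => f x < f k))/=; lra.
Qed.

Lemma variance_le_mean (m : R) f : Defs.variance pi f <= \sum_x (f x - m) ^+ 2 * pi x.
Proof.
have -> : \sum_x (f x - m) ^+ 2 * pi x = mean pi (fun x => f x ^+ 2) - 2 * m * mean pi f + m ^+ 2.
  rewrite -[X in _ + X]mulr1 -{2}(pi_sum1 HQ) /mean !mulr_sumr -sumrB -big_split/=.
  by apply: eq_bigr => x _; ring.
rewrite /Defs.variance; have := sqr_ge0 (mean pi f - m); nra.
Qed.

Lemma poincare_of_capacity : PI Q pi (5 * 10 ^+ 3 * (101 ^+ 2 * C))^-1.
Proof.
move=> f; rewrite invrK; have [m [ma mb]] := medianP f.
pose g1 x := Num.max (f x - m) 0; pose g2 x := Num.max (m - f x) 0.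
have p1 : \sum_x g1 x ^+ 2 * pi x <= 5 * 10 ^+ 3 * (101 ^+ 2 * C * E g1).
  apply: level_poincare => [x|]; first by rewrite le_max lexx orbT.
  by under eq_bigl do rewrite lt_max ltxx orbF subr_gt0.
have p2 : \sum_x g2 x ^+ 2 * pi x <= 5 * 10 ^+ 3 * (101 ^+ 2 * C * E g2).
  apply: level_poincare => [x|]; first by rewrite le_max lexx orbT.
  by under eq_bigl do rewrite lt_max ltxx orbF subr_gt0.
(* The increments of the two parts have opposite signs and differ by the increment of [f], so their
   squares sum to at most its square. *)
have e12 : E g1 + E g2 <= E f.
  pose G (b : bool) := if b then g1 else g2.
  have := @dirichlet_sum_le _ [:: true; false] G f.
  rewrite !big_cons big_nil addr0; apply => x y.
  rewrite !big_cons big_nil addr0 /G /g1 /g2.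
  case: (leP (f x - m) 0); case: (leP (f y - m) 0); case: (leP (m - f x) 0); case: (leP (m - f y) 0); nra.
apply: (le_trans (variance_le_mean m f)).
have -> : \sum_x (f x - m) ^+ 2 * pi x = \sum_x g1 x ^+ 2 * pi x + \sum_x g2 x ^+ 2 * pi x.
  rewrite -big_split/=; apply: eq_bigr => x _; rewrite -mulrDl; congr (_ * _).
  rewrite /g1 /g2 -(opprB (f x)).
  by case: (leP (f x - m) 0) => h; case: (leP (- (f x - m)) 0) => h'; nra.
apply: (le_trans (lerD p1 p2)).
rewrite -2!mulrDr -[leRHS]mulrA.
apply: ler_wpM2l; first by rewrite mulr_ge0// exprn_ge0.
by apply: ler_wpM2l => //; rewrite mulr_ge0// exprn_ge0.
Qed.

End level_sets.

Theorem theorem5p7 (R : realType) :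
  (forall kappa D : R, 0 <= kappa -> 0 < D ->
     expR (D ^+ 2 * kappa / 2)
       + Num.sqrt ((3 * kappa * D ^+ 2 / 2 + expR (D ^+ 2 * kappa / 2) - 1)
                   * (2 + expR (D ^+ 2 * kappa / 2))) < 2 ->
     exists lambda : R, 0 < lambda /\
       forall (X : finType) (Q : X -> X -> R) (pi : X -> R),
         reversible_chain Q pi ->
         Ric_ge Q pi (- kappa) ->
         (diamW Q pi <= D%:E)%E ->
         PI Q pi lambda)
  /\
  (exists c : R, 0 < c /\
     forall (D : R) (X : finType) (Q : X -> X -> R) (pi : X -> R),
       0 < D ->
       reversible_chain Q pi ->
       Ric_ge Q pi 0 ->
       (diamW Q pi <= D%:E)%E ->
       PI Q pi (c * D ^- 2)).
Proof.
pose c : R := (5 * 10 ^+ 3 * (101 ^+ 2 * (64 * (10 ^+ 3) ^+ 2)))^-1.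
have c0 : 0 < c by rewrite invr_gt0 !mulr_gt0 ?exprn_gt0.
(* Both claims follow from this one, the second with [kappa = 0]. The constant does not depend on
   [kappa] once [kappa * D ^+ 2 / 2] is at most 1/12. *)
have key (kappa D : R) (X : finType) (Q : X -> X -> R) (pi : X -> R) :
    0 <= kappa -> 0 < D -> kappa * D ^+ 2 / 2 <= 12^-1 -> reversible_chain Q pi ->
    Ric_ge Q pi (- kappa) -> (diamW Q pi <= D%:E)%E -> PI Q pi (c * D ^- 2).
  move=> k0 D0 kD HQ ric diam.
  have control (G : R) u : density pi u -> (forall x, 0 < u x) ->
      kinetic Q pi u (fun x => ln (u x)) < G -> entropy pi u <= 2 * D * Num.sqrt (2 * G) + 12^-1.
    move=> du u0 kG; apply: (le_trans (hwi HQ k0 D0 ric diam du u0 kG)).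
    by rewrite lerD2l.
  have C0 : 0 <= 64 * (10 ^+ 3) ^+ 2 * D ^+ 2.
    exact: (mulr_ge0 (mulr_ge0 (ler0n _ _) (sqr_ge0 _)) (sqr_ge0 _)).
  have := poincare_of_capacity HQ C0 (capacity_ge HQ D0 control).
  by rewrite /c -invfM !mulrA.
split; last first.
  exists c; split=> // D X Q pi D0 HQ ric diam.
  by apply: (key 0) => //; rewrite ?oppr0// !mul0r invr_ge0.
move=> kappa D k0 D0 hyp; exists (c * D ^- 2); split.
  by rewrite mulr_gt0// invr_gt0 exprn_gt0.
move=> X Q pi; apply: key => //.
have u0 : 0 <= kappa * D ^+ 2 / 2 by rewrite divr_ge0// mulr_ge0 ?sqr_ge0.
(* All that is used of the exponential: with [w >= 1 + u], the two factors under the root are at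
   least [4 * u] and 3. *)
have e1 := expR_ge1Dx (D ^+ 2 * kappa / 2).
move: hyp e1; rewrite (_ : D ^+ 2 * kappa / 2 = kappa * D ^+ 2 / 2); last by ring.
rewrite (_ : 3 * kappa * D ^+ 2 / 2 = 3 * (kappa * D ^+ 2 / 2)); last by ring.
move: (kappa * D ^+ 2 / 2) u0 => u u0; move: (expR u) => w hyp e1.
rewrite leNgt; apply/negP => u12.
(* For [u > 1/12] the product is at least [4 u * 3 > 1]. *)
have : 1 <= Num.sqrt ((3 * u + w - 1) * (2 + w)).
  rewrite -[leLHS]sqrtr1; apply: ler_wsqrtr.
  apply: (@le_trans _ _ (3^-1 * 3)); first by rewrite mulVf.
  by apply: ler_pM => //; lra.
lra.
Qed.
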